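(* Let $0<c<1$ and $\tau>0$, and let $\lambda=e^{i\theta}\in\mathbb{C}$, $\theta\in\mathbb{R}$, satisfy $$|\lambda^k-1|\ge c\,|k|^{-\tau}\qquad\text{for all } k\in\mathbb{Z}\setminus\{0\}.$$ Then there exist real formal power series $$q(t)=\sum_{k=0}^\infty q_{2k}t^{2k},\qquad \varphi(z,\bar z)=\sum_{n=0}^\infty\ \sum_{j+k=2n+1}\varphi_{j,k}z^j\bar z^k,\qquad \varphi_{j,k}=\varphi_{k,j},$$ with $q_0=1$ and $\varphi=z+\bar z+(\text{terms of total degree}\ge 3)$, which solve $$\mathcal{E}(q,\varphi)=0$$ as an identity of formal power series in $z,\bar z$, and which have the following property: for every $\alpha>\frac54$ there exists $C>0$, depending only on $c,\tau$ (and $\alpha$), such that for all $k,n\ge 0$ $$|q_{2k}|\le C^{2k}e^{\alpha(2k)\log(2k)},\qquad \sup_{j+k=n}|\varphi_{j,k}|\le C^{n}e^{\alpha n\log n}$$ (with the convention $0\log 0=0$). In particular, the series $q$ and $\varphi$ are of Gevrey order $1+\alpha$.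
   Context: Here $z,\bar z$ are treated as two independent formal variables. For a formal power series $\varphi(z,\bar z)$ put $$\varphi^-(z,\bar z)=\varphi(\lambda^{-1}z,\lambda\bar z),\qquad \varphi^+(z,\bar z)=\varphi(\lambda z,\lambda^{-1}\bar z).$$ For a formal power series $q(t)$ let $$S(t_1,t_2)=S_q(t_1,t_2)=q\Big(\frac{t_1+t_2}{2}\Big)\cos\Big(\frac{t_1-t_2}{2}\Big),$$ and define $$\mathcal{E}(q,\varphi)=(\partial_2S_q)(\varphi^-,\varphi)+(\partial_1S_q)(\varphi,\varphi^+),$$ where $\partial_i$ is the derivative in the $i$-th argument. (The equation $\mathcal{E}(q,\varphi)=0$ says that the billiard map of the $\mathbb{Z}_2\times\mathbb{Z}_2$-symmetric billiard with support function $q$ is formally conjugate, near its horizontal two-periodic orbit, to the rotation by $\theta$.) A formal power series is said to be of Gevrey order $s\ge1$ if its coefficients $a_n$ of total degree $n$ satisfy $|a_n|\le A B^{n}(n!)^{s-1}$ for some constants $A,B>0$; equivalently $|a_n|\le A' (B')^{n} e^{(s-1)n\log n}$. *)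

(* Defs.v *)
From HB Require Import structures.
From mathcomp Require Import all_boot all_order all_algebra.
From mathcomp Require Import all_classical all_reals all_analysis.
From mathcomp Require Import complex.

Set Implicit Arguments.
Unset Strict Implicit.
Unset Printing Implicit Defensive.

Import Order.TTheory GRing.Theory Num.Theory.
Local Open Scope ring_scope.

(* Formal power series are given by their coefficients:
   a : fps1 K is \sum_n a n t^n, and f : fps2 K is \sum_(j, k) f j k x^j y^k. *)
Definition fps1 (K : Type) := nat -> K.
Definition fps2 (K : Type) := nat -> nat -> K.

Section FormalPowerSeries.
Variable K : fieldType.
Implicit Types (a : fps1 K) (f g h F : fps2 K).

Definition fps2_one : fps2 K := fun j k => ((j == 0%N) && (k == 0%N))%:R.

Definition fps2_add f g : fps2 K := fun j k => f j k + g j k.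

Definition fps2_mul f g : fps2 K := fun j k =>
  \sum_(i < j.+1) \sum_(l < k.+1) f i l * g (j - i)%N (k - l)%N.

Definition fps2_exp f n : fps2 K := iter n (fps2_mul f) fps2_one.

Definition fps2_d1 f : fps2 K := fun j k => f j.+1 k *+ j.+1.
Definition fps2_d2 f : fps2 K := fun j k => f j k.+1 *+ k.+1.

Definition fps2_scale (u v : K) f : fps2 K := fun j k => f j k * u ^+ j * v ^+ k.

(* a(g) and F(g, h), for g and h without constant term.  The sums can then be
   truncated at the total degree j + k of the coefficient being computed: see
   fps2_comp1_widen and fps2_comp2_widen. *)
Definition fps2_comp1 a g : fps2 K := fun j k =>
  \sum_(n < (j + k).+1) a n * fps2_exp g n j k.

Definition fps2_comp2 F g h : fps2 K := fun j k =>
  \sum_(m < (j + k).+1) \sum_(n < (j + k).+1)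
    F m n * fps2_mul (fps2_exp g m) (fps2_exp h n) j k.

(* u x + v y *)
Definition fps2_lin (u v : K) : fps2 K := fun j k =>
  if (j == 1%N) && (k == 0%N) then u
  else if (j == 0%N) && (k == 1%N) then v else 0.

Definition fps1_cos : fps1 K := fun n =>
  if odd n then 0 else (-1) ^+ n./2 / n`!%:R.

(* S_q(x, y) = q((x + y) / 2) cos((x - y) / 2) *)
Definition genS a : fps2 K :=
  fps2_mul (fps2_comp1 a (fps2_lin 2^-1 2^-1))
           (fps2_comp1 fps1_cos (fps2_lin 2^-1 (- 2^-1))).

Definition fps2_minus (lam : K) f := fps2_scale lam^-1 lam f.
Definition fps2_plus (lam : K) f := fps2_scale lam lam^-1 f.

Definition calE (lam : K) a f : fps2 K :=
  fps2_add (fps2_comp2 (fps2_d2 (genS a)) (fps2_minus lam f) f)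
           (fps2_comp2 (fps2_d1 (genS a)) f (fps2_plus lam f)).

Lemma fps2_mul_ord m n f g :
    (forall j k, (j + k < m)%N -> f j k = 0) ->
    (forall j k, (j + k < n)%N -> g j k = 0) ->
  forall j k, (j + k < m + n)%N -> fps2_mul f g j k = 0.
Proof.
move=> f0 g0 j k jk; rewrite /fps2_mul big1// => i _; rewrite big1// => l _.
have [il|il] := ltnP (i + l) m; first by rewrite f0 ?mul0r.
rewrite g0 ?mulr0//.
have ij : (i <= j)%N by rewrite -ltnS.
have lk : (l <= k)%N by rewrite -ltnS.
rewrite -(ltn_add2l m); apply: leq_ltn_trans jk.
apply: (@leq_trans ((i + l) + ((j - i) + (k - l)))); first by rewrite leq_add2r.
by rewrite addnACA !subnKC.
Qed.

Lemma fps2_exp_ord g n : g 0%N 0%N = 0 ->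
  forall j k, (j + k < n)%N -> fps2_exp g n j k = 0.
Proof.
move=> g0; elim: n => [//|n IH] j k jk.
apply: (@fps2_mul_ord 1 n) => // -[|j'] [|k'] //=.
Qed.

Lemma fps2_comp1_widen a g N j k : g 0%N 0%N = 0 -> (j + k <= N)%N ->
  fps2_comp1 a g j k = \sum_(n < N.+1) a n * fps2_exp g n j k.
Proof.
move=> g0 jkN; rewrite /fps2_comp1.
rewrite (big_ord_widen N.+1 (fun n => a n * fps2_exp g n j k)) ?ltnS//.
rewrite big_mkcond/=; apply: eq_bigr => i _; case: ltnP => // jki.
by rewrite fps2_exp_ord ?mulr0.
Qed.

Lemma fps2_comp2_widen F g h N j k :
  g 0%N 0%N = 0 -> h 0%N 0%N = 0 -> (j + k <= N)%N ->
  fps2_comp2 F g h j k = \sum_(m < N.+1) \sum_(n < N.+1)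
    F m n * fps2_mul (fps2_exp g m) (fps2_exp h n) j k.
Proof.
move=> g0 h0 jkN; rewrite /fps2_comp2.
set G := fun m n => F m n * fps2_mul (fps2_exp g m) (fps2_exp h n) j k.
have G0 m n : (j + k < m + n)%N -> G m n = 0.
  by move=> jk; rewrite /G (fps2_mul_ord (fps2_exp_ord (n := m) g0)
    (fps2_exp_ord (n := n) h0) jk) mulr0.
rewrite (big_ord_widen N.+1 (fun m => \sum_(n < (j + k).+1) G m n)) ?ltnS//.
rewrite big_mkcond/=; apply: eq_bigr => i _; case: ltnP => jki; last first.
  by rewrite big1// => n _; rewrite -/(G i n) G0// (leq_trans jki)// leq_addr.
rewrite (big_ord_widen N.+1 (G i)) ?ltnS// big_mkcond/=.
apply: eq_bigr => n _; case: ltnP => // jkn.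
by rewrite -/(G i n) G0// (leq_trans jkn)// leq_addl.
Qed.

End FormalPowerSeries.

Definition fps1_complex (R : realType) (a : fps1 R) : fps1 R[i] :=
  fun n => (a n)%:C%C.
Definition fps2_complex (R : realType) (f : fps2 R) : fps2 R[i] :=
  fun j k => (f j k)%:C%C.

(* The modulus `|_| on R[i] takes values in R[i], and <= there holds only between
   numbers with equal imaginary parts; both sides here are real, so this is the
   usual inequality in R. *)
Definition diophantine (R : realType) (c tau : R) (lam : R[i]) : Prop :=
  forall k : int, k != 0 ->
    (c * (`|k|%N%:R `^ (- tau)))%:C%C <= `|lam ^ k - 1|.

Definition gevrey1 (R : realType) (s : R) (a : fps1 R) : Prop :=
  1 <= s /\ exists A B : R, [/\ 0 < A, 0 < B &
    forall n, `|a n| <= A * B ^+ n * n`!%:R `^ (s - 1)].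

Definition gevrey2 (R : realType) (s : R) (f : fps2 R) : Prop :=
  1 <= s /\ exists A B : R, [/\ 0 < A, 0 < B &
    forall n j k, (j + k = n)%N -> `|f j k| <= A * B ^+ n * n`!%:R `^ (s - 1)].

(* Main.v *)
Require Import Defs.
From HB Require Import structures.
From mathcomp Require Import all_boot all_order all_algebra.
From mathcomp Require Import all_classical all_reals all_analysis.
From mathcomp Require Import complex.
From mathcomp Require Import ring lra zify.

Set Implicit Arguments.
Unset Strict Implicit.
Unset Printing Implicit Defensive.

Import Order.TTheory GRing.Theory Num.Theory.
Local Open Scope ring_scope.

(** Write f^+ and f^- for the two rotations of a series f, and put
    M = (phi + phi^+)/2, D = (phi - phi^+)/2, X = q'(M) cos D, Y = q(M) sin D.
    By the chain rule twice the equation reads (X + Y)^- + X - Y = 0.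

    Existence.  The linearisation L of the equation in phi is a second order
    difference operator h |-> bet h^+ + (bet h)^- + alp h.  With
    q_2 = (1 - cos theta) / (2 (1 + cos theta)) its constant part multiplies
    z^j zb^l by a number that vanishes only for |j - l| = 1, and at
    z^(k+1) zb^k the coefficient q_(2k+2) enters the equation with a nonzero
    factor.  So one solves degree by degree, under the normalisation that phi has
    no further resonant terms z^(k+1) zb^k; reality, parity and symmetry of the
    solution are inherited from symmetries of the equation (formal_solution).

    Growth.  The recursion divides by a small divisor in every degree, and the
    products of these divisors are out of control.  They disappear as follows.
    Applying the angular and the radial Euler derivative to the equation shows
    that u = ang phi and v = rad phi both satisfy L u = L v = 0.  For any h the
    Casoratians B = bet (u h^+ - u^+ h) and A = bet (v h^+ - v^+ h) satisfy
    B - B^- = u L h and A - A^- = v L h (green), while the Casoratian W of u and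
    v is invariant under the rotation, hence a series in z zb, and
    h W = v B - u A.  Take for h the part of phi beyond half of the degree 2k+1
    under study: the Taylor formula expresses L h up to that degree through the
    equation at the lower half of phi, B and A follow by dividing once by the
    numbers 1 - lam^n, their diagonal parts are determined by the
    normalisation, and h is recovered by inverting W.  Thus phi costs one small
    divisor of size k^(-tau) in degree 2k+1 (tail_step), and the diagonal part of
    the identity for A gives q_(2k+2) without any division by small divisors
    (coefficient_step).

    These two steps are turned into bounds by measuring series in the l1 norm of
    the coefficients at the radius t = 1/(C0 k), which depends on the degree.
    If the j-th coefficients grow like C^j j^(2j) then at this radius their
    contributions are of the order of (j/k)^(2j): summable near j = k, and so
    small for j up to k/2 that they absorb the factors k and k^2 produced by the
    derivatives of q.  Choosing C large closes the induction (all_bounds).  The result is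
    |q_n|, |phi_(j,l)| <= G^n n^n in degree n, with G depending on c and tau
    only, which is the assertion with exponent 1; it implies the one with any
    alpha > 5/4, and n^n <= e^n n! gives the Gevrey bounds. *)

(** * The ring of formal power series in two variables *)

(** A record around the coefficient function, so that the ring structure of
    power series does not compete with the pointwise one on functions. *)
Record ser (K : Type) := Ser { cf :> nat -> nat -> K }.

HB.instance Definition _ (K : Type) := gen_eqMixin (ser K).
HB.instance Definition _ (K : Type) := gen_choiceMixin (ser K).

Lemma serP (K : Type) (f g : ser K) : (forall j k, f j k = g j k) -> f = g.
Proof.
case: f g => f [g] /= fg; congr Ser.
by apply/funext => j; apply/funext => k; exact: fg.
Qed.

Section SerRing.
Variable K : fieldType.
Implicit Types f g h : ser K.

Definition sadd f g := Ser (fps2_add f g).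
Definition sopp f : ser K := Ser (fun j k => - f j k).
Definition szero : ser K := Ser (fun _ _ => 0).
Definition smul f g := Ser (fps2_mul f g).
Definition sone : ser K := Ser (fps2_one K).

Fact saddA : associative sadd.
Proof. by move=> f g h; apply: serP => j k /=; rewrite /fps2_add addrA. Qed.
Fact saddC : commutative sadd.
Proof. by move=> f g; apply: serP => j k /=; rewrite /fps2_add addrC. Qed.
Fact sadd0 : left_id szero sadd.
Proof. by move=> f; apply: serP => j k /=; rewrite /fps2_add add0r. Qed.
Fact saddN : left_inverse szero sopp sadd.
Proof. by move=> f; apply: serP => j k /=; rewrite /fps2_add addNr. Qed.

HB.instance Definition _ := GRing.isZmodule.Build (ser K) saddA saddC sadd0 saddN.

(** Below the bidegree (N, N) the coefficients of a product are those of the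
    product of truncations, so the ring laws are inherited from polynomials. *)
Definition trunc_poly N f : {poly {poly K}} :=
  \poly_(j < N) \poly_(k < N) f j k.

Lemma coef_trunc_poly N f j k : (j < N)%N -> (k < N)%N ->
  (trunc_poly N f)`_j`_k = f j k.
Proof. by move=> jN kN; rewrite coef_poly jN coef_poly kN. Qed.

Lemma coef_trunc_polyM N f g j k : (j < N)%N -> (k < N)%N ->
  (trunc_poly N f * trunc_poly N g)`_j`_k = smul f g j k.
Proof.
move=> jN kN; rewrite coefM coef_sum; apply: eq_bigr => i _.
rewrite coefM; apply: eq_bigr => l _.
have iN : (i < N)%N by apply: leq_ltn_trans jN; rewrite -ltnS.
have lN : (l < N)%N by apply: leq_ltn_trans kN; rewrite -ltnS.
by rewrite !coef_trunc_poly ?(leq_ltn_trans (leq_subr _ _)).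
Qed.

Fact smulC : commutative smul.
Proof.
move=> f g; apply: serP => j k.
by rewrite -!(@coef_trunc_polyM (j + k).+1) ?ltnS ?leq_addl ?leq_addr// mulrC.
Qed.

Fact smulA : associative smul.
Proof.
move=> f g h; apply: serP => j k.
have jN : (j < (j + k).+1)%N by rewrite ltnS leq_addr.
have kN : (k < (j + k).+1)%N by rewrite ltnS leq_addl.
move: (j + k).+1 jN kN => N jN kN.
transitivity ((trunc_poly N f * trunc_poly N g * trunc_poly N h)`_j`_k); last first.
  rewrite -[RHS]/(\sum_(i < j.+1) \sum_(l < k.+1)
    smul f g i l * h (j - i)%N (k - l)%N) coefM coef_sum. refine (eq_bigr _ _) => i _.
  rewrite [LHS]coefM; refine (eq_bigr _ _) => l _.
  have iN : (i < N)%N by apply: leq_ltn_trans jN; rewrite -ltnS.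
  have lN : (l < N)%N by apply: leq_ltn_trans kN; rewrite -ltnS.
  by rewrite coef_trunc_polyM ?coef_trunc_poly ?(leq_ltn_trans (leq_subr _ _)).
rewrite -[LHS]/(\sum_(i < j.+1) \sum_(l < k.+1)
  f i l * smul g h (j - i)%N (k - l)%N) -mulrA [in RHS]coefM [RHS]coef_sum; refine (eq_bigr _ _) => i _.
rewrite [RHS]coefM; refine (eq_bigr _ _) => l _.
have iN : (i < N)%N by apply: leq_ltn_trans jN; rewrite -ltnS.
have lN : (l < N)%N by apply: leq_ltn_trans kN; rewrite -ltnS.
by rewrite coef_trunc_polyM ?coef_trunc_poly ?(leq_ltn_trans (leq_subr _ _)).
Qed.

Fact smul1 : left_id sone smul.
Proof.
move=> f; apply: serP => j k /=; rewrite /fps2_mul big_ord_recl big_ord_recl/=.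
rewrite /fps2_one /= mul1r !subn0 big1 ?addr0 => [|i _]; last by rewrite mul0r.
by rewrite big1 ?addr0// => i _; rewrite big1// => l _; rewrite mul0r.
Qed.

Fact smulD : left_distributive smul +%R.
Proof.
move=> f g h; apply: serP => j k /=; rewrite /fps2_mul /fps2_add -big_split.
by apply: eq_bigr => i _; rewrite -big_split; apply: eq_bigr => l _; rewrite mulrDl.
Qed.

Fact sone_neq0 : sone != 0.
Proof. by apply/eqP => /(congr1 (fun f : ser K => f 0%N 0%N)) /eqP; rewrite oner_eq0. Qed.

HB.instance Definition _ := GRing.Zmodule_isComNzRing.Build (ser K)
  smulA smulC smul1 smulD sone_neq0.

Lemma cfD f g j k : (f + g) j k = f j k + g j k. Proof. by []. Qed.
Lemma cfN f j k : (- f) j k = - f j k. Proof. by []. Qed.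
Lemma cfB f g j k : (f - g) j k = f j k - g j k. Proof. by []. Qed.
Lemma cf0 j k : (0 : ser K) j k = 0. Proof. by []. Qed.
Lemma cfM f g j k : (f * g) j k =
  \sum_(i < j.+1) \sum_(l < k.+1) f i l * g (j - i)%N (k - l)%N.
Proof. by []. Qed.
Lemma cf_sum (I : Type) (r : seq I) (P : pred I) (F : I -> ser K) j k :
  (\sum_(i <- r | P i) F i) j k = \sum_(i <- r | P i) F i j k.
Proof. by apply: (big_morph (fun f : ser K => f j k)). Qed.
Lemma cfX f n : cf (f ^+ n) = fps2_exp f n.
Proof. by elim: n => // n IH; rewrite exprS /= IH. Qed.
Lemma cfMn f n j k : (f *+ n) j k = f j k *+ n.
Proof. by elim: n => // n IH; rewrite !mulrS cfD IH. Qed.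

Definition sC (c : K) : ser K :=
  Ser (fun j k => if (j == 0%N) && (k == 0%N) then c else 0).

Lemma cf_sCM c f j k : (sC c * f) j k = c * f j k.
Proof.
rewrite cfM big_ord_recl big_ord_recl/= !subn0 big1 ?addr0 => [|i _]; last by rewrite mul0r.
by rewrite big1 ?addr0// => i _; rewrite big1// => l _; rewrite mul0r.
Qed.

Fact sC_zmod : zmod_morphism sC.
Proof. by move=> a b; apply: serP => -[|j] [|k] //=; rewrite /fps2_add subr0. Qed.
Fact sC_monoid : monoid_morphism sC.
Proof.
split; first by apply: serP => -[|j] [|k].
move=> a b; apply: serP => j k; rewrite cf_sCM /=.
by case: ifP => // _; rewrite mulr0.
Qed.
HB.instance Definition _ := GRing.isZmodMorphism.Build K (ser K) sC sC_zmod.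
HB.instance Definition _ := GRing.isMonoidMorphism.Build K (ser K) sC sC_monoid.

(** * Order of vanishing *)

Definition ord n f := forall j k, (j + k < n)%N -> f j k = 0.

Lemma ordW m n f : (m <= n)%N -> ord n f -> ord m f.
Proof. by move=> mn fn j k jk; apply: fn; exact: leq_trans mn. Qed.
Lemma ord_zero n : ord n 0. Proof. by []. Qed.
Lemma ordD n f g : ord n f -> ord n g -> ord n (f + g).
Proof. by move=> fn gn j k jk; rewrite cfD fn// gn// addr0. Qed.
Lemma ordN n f : ord n f -> ord n (- f).
Proof. by move=> fn j k jk; rewrite cfN fn// oppr0. Qed.
Lemma ordB n f g : ord n f -> ord n g -> ord n (f - g).
Proof. by move=> fn gn; apply: ordD => //; exact: ordN. Qed.
Lemma ord_sum n (I : Type) (r : seq I) (P : pred I) (F : I -> ser K) :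
  (forall i, P i -> ord n (F i)) -> ord n (\sum_(i <- r | P i) F i).
Proof. by move=> H; apply: big_ind => //; exact: ordD. Qed.
Lemma ordM m n f g : ord m f -> ord n g -> ord (m + n) (f * g).
Proof. by move=> fm gn; exact: fps2_mul_ord. Qed.
Lemma ordMl n f g : ord n f -> ord n (f * g).
Proof. by move=> fn; rewrite -(addn0 n); apply: ordM. Qed.
Lemma ordMr n f g : ord n g -> ord n (f * g).
Proof. by rewrite mulrC; exact: ordMl. Qed.
Lemma ord1P f : ord 1 f <-> f 0%N 0%N = 0.
Proof. by split=> [->//|f0 [|j] [|k]]. Qed.
Lemma ordX n f : ord 1 f -> ord n (f ^+ n).
Proof.
move=> f1; elim: n => [//|n IH]; rewrite exprS -add1n; exact: ordM.
Qed.
Lemma ordXM m n f : ord m f -> ord (m * n) (f ^+ n).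
Proof.
move=> f1; elim: n => [|n IH]; first by rewrite muln0.
by rewrite exprS mulnS; exact: ordM.
Qed.
Lemma ord_eq f g : (forall n, ord n (f - g)) -> f = g.
Proof.
move=> fg; apply: serP => j k; apply/eqP; rewrite -subr_eq0.
by rewrite -[X in X == _]/((f - g) j k) (fg (j + k).+1).
Qed.
Lemma ord_cf n f g j k : ord n (f - g) -> (j + k < n)%N -> f j k = g j k.
Proof. by move=> fg /fg; rewrite cfB => /eqP; rewrite subr_eq0 => /eqP. Qed.

(** The next lemmas treat membership of a difference in ord n as a congruence,
    compatible with the ring operations. *)
Lemma ord_refl n f : ord n (f - f). Proof. by rewrite subrr. Qed.
Lemma ord_sym n f g : ord n (f - g) -> ord n (g - f).
Proof. by move=> /ordN; rewrite opprB. Qed.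
Lemma ord_trans n g f h : ord n (f - g) -> ord n (g - h) -> ord n (f - h).
Proof. by move=> a b; rewrite -(subrKA g); exact: ordD. Qed.
Lemma ordBD n f f' g g' : ord n (f - f') -> ord n (g - g') ->
  ord n ((f + g) - (f' + g')).
Proof. by move=> a b; rewrite opprD addrACA; exact: ordD. Qed.
Lemma ordBN n f f' : ord n (f - f') -> ord n (- f - - f').
Proof. by move=> /ordN; rewrite opprD. Qed.
Lemma ordBB n f f' g g' : ord n (f - f') -> ord n (g - g') ->
  ord n ((f - g) - (f' - g')).
Proof. by move=> a b; apply: ordBD => //; exact: ordBN. Qed.
Lemma ordBM n f f' g g' : ord n (f - f') -> ord n (g - g') ->
  ord n (f * g - f' * g').
Proof.
move=> a b; rewrite (_ : _ - _ = (f - f') * g + f' * (g - g')); last by ring.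
by apply: ordD; [exact: ordMl | exact: ordMr].
Qed.
Lemma ordBX n f f' m : ord n (f - f') -> ord n (f ^+ m - f' ^+ m).
Proof.
move=> a; elim: m => [|m IH]; first by rewrite subrr.
by rewrite !exprS; exact: ordBM.
Qed.
Lemma ordB_sum n (I : Type) (r : seq I) (P : pred I) (F G : I -> ser K) :
  (forall i, P i -> ord n (F i - G i)) ->
  ord n (\sum_(i <- r | P i) F i - \sum_(i <- r | P i) G i).
Proof. by move=> H; rewrite -sumrB; exact: ord_sum. Qed.

End SerRing.
Arguments ord_refl {K} n f.
Arguments ord_zero {K} n.

(** * Composition of power series *)

Section Composition.
Variable K : fieldType.
Implicit Types (f g h F G : ser K) (a b : fps1 K).

Definition cmp a g := Ser (fps2_comp1 a g).

(** The bridge from the coefficientwise definition of composition to algebra: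
    modulo order N a composition is a polynomial in the inner series. *)
Lemma cmp_trunc N a g : ord 1 g ->
  ord N (cmp a g - \sum_(n < N) sC (a n) * g ^+ n).
Proof.
move=> /ord1P g0 j k; case: N => // N jk.
rewrite cfB cf_sum [cmp a g j k](@fps2_comp1_widen _ _ _ N)//.
by rewrite -sumrB big1// => i _; rewrite cf_sCM cfX subrr.
Qed.

Arguments cmp_trunc N a [g].

Definition dfps1 a : fps1 K := fun n => a n.+1 *+ n.+1.

Lemma cmp_cong n a g g' : ord 1 g -> ord 1 g' -> ord n (g - g') ->
  ord n (cmp a g - cmp a g').
Proof.
move=> g1 g1' gg'.
apply: ord_trans (cmp_trunc n a g1) _.
apply: ord_trans (ord_sym (cmp_trunc n a g1')).
by apply: ordB_sum => i _; apply: ordBM; [exact: ord_refl | exact: ordBX].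
Qed.

Lemma cmp_ord n a g : ord 1 g -> (forall i, (i < n)%N -> a i = 0) -> ord n (cmp a g).
Proof.
move=> g1 a0; rewrite -[cmp a g](subr0); apply: ord_trans (cmp_trunc n a g1) _.
by rewrite subr0; apply: ord_sum => i _; rewrite a0// rmorph0 mul0r.
Qed.

Lemma cmpD a b g : cmp (fun n => a n + b n) g = cmp a g + cmp b g.
Proof.
apply: serP => j k; rewrite cfD /= /fps2_comp1 -big_split.
by apply: eq_bigr => i _; rewrite mulrDl.
Qed.

Lemma cmpN a g : cmp (fun n => - a n) g = - cmp a g.
Proof.
apply: serP => j k; rewrite cfN /= /fps2_comp1 -sumrN.
by apply: eq_bigr => i _; rewrite mulNr.
Qed.

Lemma eq_cmp a b g : a =1 b -> cmp a g = cmp b g.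
Proof. by move=> ab; apply: serP => j k; apply: eq_bigr => i _; rewrite ab. Qed.

(** Additive maps compatible with products and with the vanishing order commute
    with composition, since composition is a limit of polynomials. *)
Definition continuous_morphism (T : ser K -> ser K) :=
  [/\ zmod_morphism T, monoid_morphism T & forall n f, ord n f -> ord n (T f)].

Section Morph.
Variable T : ser K -> ser K.
Hypothesis cT : continuous_morphism T.
Let T_zmod : zmod_morphism T. Proof. by case: cT. Qed.
Let T_monoid : monoid_morphism T. Proof. by case: cT. Qed.
Let Tm : {rmorphism ser K -> ser K} := HB.pack T
  (GRing.isZmodMorphism.Build _ _ T T_zmod)
  (GRing.isMonoidMorphism.Build _ _ T T_monoid).

Lemma morph_ord n f : ord n f -> ord n (T f). Proof. by case: cT => _ _; apply. Qed.
Lemma morphD f g : T (f + g) = T f + T g. Proof. exact: (rmorphD Tm). Qed.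
Lemma morphB f g : T (f - g) = T f - T g. Proof. exact: (rmorphB Tm). Qed.
Lemma morphN f : T (- f) = - T f. Proof. exact: (rmorphN Tm). Qed.
Lemma morphM f g : T (f * g) = T f * T g. Proof. exact: (rmorphM Tm). Qed.

Lemma morph_cmp a b g : ord 1 g -> (forall n, T (sC (a n)) = sC (b n)) ->
  T (cmp a g) = cmp b (T g).
Proof.
move=> g1 Ta; apply: ord_eq => n.
apply: (@ord_trans _ _ (T (\sum_(i < n) sC (a i) * g ^+ i))).
  by rewrite -morphB; apply: morph_ord; exact: cmp_trunc.
apply: ord_trans (ord_sym (cmp_trunc n b (morph_ord g1))).
rewrite -[T (\sum_(i < n) _)]/(Tm _) rmorph_sum; apply: ordB_sum => i _.
by rewrite rmorphM rmorphXn /= Ta subrr.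
Qed.
End Morph.

(** Derivations lowering the vanishing order by at most one; the chain rule
    below covers partial and Euler derivatives alike. *)
Definition derivation (D : ser K -> ser K) :=
  [/\ zmod_morphism D, (forall f g, D (f * g) = D f * g + f * D g),
    (forall c, D (sC c) = 0) & forall n f, ord n.+1 f -> ord n (D f)].

Section Der.
Variable D : ser K -> ser K.
Hypothesis dD : derivation D.
Let D_zmod : zmod_morphism D. Proof. by case: dD. Qed.
Let Dm : {additive ser K -> ser K} := HB.pack D
  (GRing.isZmodMorphism.Build _ _ D D_zmod).

Lemma der_mul f g : D (f * g) = D f * g + f * D g. Proof. by case: dD. Qed.
Lemma der_sC c : D (sC c) = 0. Proof. by case: dD. Qed.
Lemma derD f g : D (f + g) = D f + D g. Proof. exact: (raddfD Dm). Qed.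
Lemma derB f g : D (f - g) = D f - D g. Proof. exact: (raddfB Dm). Qed.
Lemma der0 : D 0 = 0. Proof. exact: (raddf0 Dm). Qed.
Lemma der_sCM c f : D (sC c * f) = sC c * D f.
Proof. by rewrite der_mul der_sC mul0r add0r. Qed.

Lemma der_exp f n : D (f ^+ n.+1) = f ^+ n * D f *+ n.+1.
Proof.
elim: n => [|n IH]; first by rewrite expr1 expr0 mul1r.
by rewrite exprS der_mul IH [in RHS]mulrSr -mulrnAr mulrA -exprS mulrnAr [RHS]addrC mulrC.
Qed.

Lemma der_cmp a g : ord 1 g -> D (cmp a g) = cmp (dfps1 a) g * D g.
Proof.
move=> g1; apply: ord_eq => n.
apply: (@ord_trans _ _ (D (\sum_(i < n.+1) sC (a i) * g ^+ i))).
  rewrite -derB; case: dD => _ _ _; apply; exact: (cmp_trunc _ _ g1).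
apply: ord_sym; apply: ord_trans (ordBM (cmp_trunc n (dfps1 a) g1) (ord_refl n (D g))) _.
rewrite -[D (\sum_(i < n.+1) _)]/(Dm _) raddf_sum big_ord_recl /= expr0 mulr1 der_sC add0r mulr_suml.
apply: ordB_sum => i _; rewrite /bump /= add1n.
rewrite der_sCM der_exp /dfps1 rmorphMn/= -[(i.+1)%N]/(i.+1).
rewrite (_ : _ - _ = 0)//; rewrite mulrnAr mulrnAl mulrnAl mulrA subrr//.
Qed.
End Der.

(** First order Taylor expansion; the remainder vanishes to twice the order of
    the increment, which is what allows a step to double the known degree. *)
Lemma exp_taylor g h m n : ord m h ->
  ord (m + m) ((g + h) ^+ n.+1 - g ^+ n.+1 - g ^+ n * h *+ n.+1).
Proof.
move=> hm; elim: n => [|n IH].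
  by rewrite !expr1 expr0 mul1r addrAC addrK subrr.
rewrite (_ : _ - _ = (g + h) * ((g + h) ^+ n.+1 - g ^+ n.+1 - g ^+ n * h *+ n.+1)
   + g ^+ n *+ n.+1 * (h * h)).
  by apply: ordD; apply: ordMr => //; exact: ordM.
rewrite [in LHS]exprS [g ^+ n.+2]exprS [g ^+ n.+1]exprS.
move: ((g + h) ^+ n.+1) (g ^+ n) => x y; ring.
Qed.

Lemma cmp_taylor a g h m : ord 1 g -> ord 1 h -> ord m h ->
  ord (m + m) (cmp a (g + h) - cmp a g - cmp (dfps1 a) g * h).
Proof.
move=> g1 h1 hm; set N := (m + m)%N.
have gh1 : ord 1 (g + h) by exact: ordD.
rewrite -(subr0 (_ - _)).
apply: (@ord_trans _ _ ((\sum_(n < N.+1) sC (a n) * (g + h) ^+ n)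
  - (\sum_(n < N.+1) sC (a n) * g ^+ n)
  - (\sum_(n < N) sC (dfps1 a n) * g ^+ n) * h)).
  apply: ordBB; last by apply: ordBM (ord_refl _ _); exact: cmp_trunc.
  by apply: ordBB; apply: ordW (cmp_trunc _ _ _).
rewrite subr0 !big_ord_recl /= !expr0 opprD addrACA subrr add0r -sumrB.
rewrite mulr_suml -sumrB; apply: ord_sum => i _; rewrite /bump /= add1n.
rewrite (_ : _ - _ = sC (a i.+1) *
   ((g + h) ^+ i.+1 - g ^+ i.+1 - g ^+ i * h *+ i.+1)).
  by apply: ordMr; exact: exp_taylor.
rewrite /dfps1 rmorphMn/=.
move: ((g + h) ^+ i.+1) (g ^+ i.+1) (g ^+ i) (sC _) => x y z c; ring.
Qed.

(** * Two-variable composition *)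

Definition cmp2 F g h := Ser (fps2_comp2 F g h).

Lemma cmp2_trunc N F g h : ord 1 g -> ord 1 h ->
  ord N (cmp2 F g h - \sum_(m < N) \sum_(n < N) sC (F m n) * g ^+ m * h ^+ n).
Proof.
move=> /ord1P g0 /ord1P h0 j k; case: N => // N jk.
rewrite cfB cf_sum [cmp2 F g h j k](@fps2_comp2_widen _ _ _ _ N)//.
rewrite -sumrB big1// => i _; rewrite cf_sum -sumrB big1// => l _.
by rewrite -mulrA cf_sCM -!cfX subrr.
Qed.

Arguments cmp2_trunc N F [g h].

Definition lin u v : ser K := Ser (fps2_lin u v).
Definition sX : ser K := lin 1 0.
Definition sY : ser K := lin 0 1.

Lemma lin_ord u v : ord 1 (lin u v). Proof. by apply/ord1P. Qed.

Lemma linE u v : lin u v = sC u * sX + sC v * sY.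
Proof.
apply: serP => j k; rewrite cfD !cf_sCM /= /fps2_lin.
by case: j k => [|[|j]] [|[|k]]; rewrite /= ?mulr1 ?mulr0 ?addr0 ?add0r.
Qed.

Lemma cf_sXM0 f k : (sX * f) 0%N k = 0.
Proof.
by rewrite cfM big_ord1 big1// => -[[|[|i]] ?] _; rewrite /= /fps2_lin /= mul0r.
Qed.
Lemma cf_sXMS f j k : (sX * f) j.+1 k = f j k.
Proof.
rewrite cfM big_ord_recl big1 ?add0r => [|[[|[|i]] ?] _]; last 3 first.
- by rewrite /= /fps2_lin /= mul0r.
- by rewrite /= /fps2_lin /= mul0r.
- by rewrite /= /fps2_lin /= mul0r.
rewrite big_ord_recl big_ord_recl /= subn0 {1}/fps2_lin /= mul1r.
rewrite subSS subn0 big1 ?addr0 => [|i _]; last by rewrite /fps2_lin /= mul0r.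
rewrite big1 ?addr0// => -[i ?] _; rewrite big1// => l _.
by rewrite /fps2_lin /= mul0r.
Qed.
Lemma cf_sYM0 f j : (sY * f) j 0%N = 0.
Proof.
rewrite cfM big1// => -[[|[|i]] ?] _; rewrite big_ord1 /= /fps2_lin /= mul0r//.
Qed.
Lemma cf_sYMS f j k : (sY * f) j k.+1 = f j k.
Proof.
rewrite cfM big_ord_recl [X in _ + X]big1 ?addr0 => [|[i ?] _]; last first.
  by rewrite big1// => l _; rewrite /= /fps2_lin /=; case: ifP; rewrite mul0r.
rewrite big_ord_recl big_ord_recl /= {1}/fps2_lin /= mul0r add0r.
rewrite {1}/fps2_lin /= mul1r subn0 subSS subn0 big1 ?addr0// => -[i ?] _.
by rewrite /fps2_lin /= mul0r.
Qed.

End Composition.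
Arguments cmp_trunc {K} N a [g].
Arguments cmp2_trunc {K} N F [g h].

(** * Scalings, Euler derivatives and partial derivatives *)

Section Operators.
Variable K : fieldType.
Implicit Types (f g h F G : ser K) (a b : fps1 K).

Definition sc u v f : ser K := Ser (fps2_scale u v f).

Lemma cf_sc u v f j k : sc u v f j k = f j k * u ^+ j * v ^+ k. Proof. by []. Qed.

Lemma sc_morph u v : continuous_morphism (sc u v).
Proof.
split.
- by move=> f g; apply: serP => j k; rewrite cfB !cf_sc cfB !mulrBl.
- split; first by apply: serP => -[|j] [|k]; rewrite cf_sc /= /fps2_one /= ?mulr1 ?mul0r.
  move=> f g; apply: serP => j k; rewrite cf_sc !cfM !mulr_suml.
  apply: eq_bigr => -[i /= ij] _; rewrite !mulr_suml; apply: eq_bigr => -[l /= lk] _.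
  rewrite /fps2_scale -[in u ^+ j](@subnKC i j)// -[in v ^+ k](@subnKC l k)// !exprD.
  move: (u ^+ i) (u ^+ _) (v ^+ l) (v ^+ _) (f _ _) (g _ _) => x1 x2 x3 x4 x5 x6.
  ring.
- by move=> n f fn j k jk; rewrite cf_sc fn// !mul0r.
Qed.

Lemma sc_sC u v c : sc u v (sC c) = sC c.
Proof. by apply: serP => -[|j] [|k]; rewrite cf_sc /= ?mulr1 ?mul0r. Qed.

Lemma sc_sc u v u' v' f : sc u v (sc u' v' f) = sc (u * u') (v * v') f.
Proof.
apply: serP => j k; rewrite !cf_sc !exprMn.
move: (f j k) (u ^+ j) (u' ^+ j) (v ^+ k) (v' ^+ k) => x1 x2 x3 x4 x5; ring.
Qed.

Lemma sc1 f : sc 1 1 f = f.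
Proof. by apply: serP => j k; rewrite cf_sc !expr1n !mulr1. Qed.

(** An Euler derivative multiplies the coefficient of each monomial by a weight
    additive in the bidegree; it therefore commutes with every scaling. *)
Section Euler.
Variable w : nat -> nat -> K.
Hypothesis wD : forall j k j' k', w (j + j')%N (k + k')%N = w j k + w j' k'.

Definition eul f : ser K := Ser (fun j k => w j k * f j k).

Lemma eul_der : derivation eul.
Proof.
have w0 : w 0%N 0%N = 0.
  by have /eqP := wD 0 0 0 0; rewrite -[X in X == _]addr0 (inj_eq (addrI _)) eq_sym => /eqP.
split.
- by move=> f g; apply: serP => j k; rewrite cfB /= /fps2_add mulrDr mulrN.
- move=> f g; apply: serP => j k; rewrite cfD /= /fps2_mul mulr_sumr -big_split.
  apply: eq_bigr => -[i /= ij] _; rewrite mulr_sumr -big_split.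
  apply: eq_bigr => -[l /= lk] _.
  rewrite -[in w j k](@subnKC i j)// -[in w _ k](@subnKC l k)// wD /=.
  by rewrite mulrDl mulrA; congr (_ + _); rewrite mulrCA.
- by move=> c; apply: serP => j k /=; case: ifP => [/andP[/eqP -> /eqP ->]|]; rewrite ?w0 ?mul0r ?mulr0.
- by move=> n f fn j k jk /=; rewrite fn ?mulr0// ltnW.
Qed.

Lemma eul_ord n f : ord n f -> ord n (eul f).
Proof. by move=> fn j k jk /=; rewrite fn ?mulr0. Qed.

Lemma eul_sc u v f : eul (sc u v f) = sc u v (eul f).
Proof. by apply: serP => j k; rewrite /= /fps2_scale !mulrA. Qed.
End Euler.

Definition pd1 f : ser K := Ser (fps2_d1 f).
Definition pd2 f : ser K := Ser (fps2_d2 f).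

(** The Leibniz rule for the partial derivatives is deduced from that of the
    Euler derivatives, multiplication by a variable being injective. *)
Lemma sXM_inj f g : sX K * f = sX K * g -> f = g.
Proof. by move=> fg; apply: serP => j k; rewrite -(cf_sXMS f) -(cf_sXMS g) fg. Qed.
Lemma sYM_inj f g : sY K * f = sY K * g -> f = g.
Proof. by move=> fg; apply: serP => j k; rewrite -(cf_sYMS f) -(cf_sYMS g) fg. Qed.

Lemma sXM_pd1 f : sX K * pd1 f = eul (fun j _ => j%:R) f.
Proof.
apply: serP => -[|j] k; first by rewrite cf_sXM0 /= mul0r.
by rewrite cf_sXMS /= /fps2_d1 mulr_natl.
Qed.
Lemma sYM_pd2 f : sY K * pd2 f = eul (fun _ k => k%:R) f.
Proof.
apply: serP => j [|k]; first by rewrite cf_sYM0 /= mul0r.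
by rewrite cf_sYMS /= /fps2_d2 mulr_natl.
Qed.

Lemma pd1_der : derivation pd1.
Proof.
split.
- by move=> f g; apply: serP => j k; rewrite cfB -[LHS]/((f - g) j.+1 k *+ j.+1) cfB mulrnBl.
- move=> f g; apply: sXM_inj; rewrite sXM_pd1 mulrDr mulrA sXM_pd1 mulrCA sXM_pd1.
  by apply: der_mul; apply: eul_der => *; rewrite natrD.
- by move=> c; apply: serP => j k /=; rewrite /fps2_d1 /= mul0rn.
- by move=> n f fn j k jk /=; rewrite /fps2_d1 fn ?mul0rn// addSn ltnS.
Qed.
Lemma pd2_der : derivation pd2.
Proof.
split.
- by move=> f g; apply: serP => j k; rewrite cfB -[LHS]/((f - g) j k.+1 *+ k.+1) cfB mulrnBl.
- move=> f g; apply: sYM_inj; rewrite sYM_pd2 mulrDr mulrA sYM_pd2 mulrCA sYM_pd2.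
  by apply: der_mul; apply: eul_der => *; rewrite natrD.
- by move=> c; apply: serP => j k /=; rewrite /fps2_d2 /= andbF mul0rn.
- by move=> n f fn j k jk /=; rewrite /fps2_d2 fn ?mul0rn// addnS ltnS.
Qed.

Lemma pd1_lin u v : pd1 (lin u v) = sC u.
Proof.
by apply: serP => -[|j] [|k]; rewrite /= /fps2_d1 /fps2_lin /= ?mulr1n ?mul0rn.
Qed.
Lemma pd2_lin u v : pd2 (lin u v) = sC v.
Proof.
by apply: serP => -[|[|j]] [|k]; rewrite /= /fps2_d2 /fps2_lin /= ?mulr1n ?mul0rn.
Qed.

Section Cmp2.
Variables g h : ser K.
Hypotheses (g1 : ord 1 g) (h1 : ord 1 h).

Lemma cmp2D F G : cmp2 (F + G) g h = cmp2 F g h + cmp2 G g h.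
Proof.
apply: ord_eq => n; apply: ord_trans (cmp2_trunc n (F + G) g1 h1) _.
apply: ord_sym.
apply: ord_trans (ordBD (cmp2_trunc n F g1 h1) (cmp2_trunc n G g1 h1)) _.
rewrite -big_split; apply: ordB_sum => i _; rewrite -big_split.
by apply: ordB_sum => l _; rewrite cfD rmorphD/= !mulrDl subrr.
Qed.

Lemma cmp2_sCM c F : cmp2 (sC c * F) g h = sC c * cmp2 F g h.
Proof.
apply: ord_eq => n; apply: ord_trans (cmp2_trunc n (sC c * F) g1 h1) _.
apply: ord_sym.
apply: ord_trans (ordBM (ord_refl n (sC c)) (cmp2_trunc n F g1 h1)) _.
rewrite mulr_sumr; apply: ordB_sum => i _; rewrite mulr_sumr.
by apply: ordB_sum => l _; rewrite cf_sCM rmorphM/= !mulrA subrr.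
Qed.

Lemma cmp2_ord n F : ord n F -> ord n (cmp2 F g h).
Proof.
move=> Fn; rewrite -[cmp2 _ _ _]subr0; apply: ord_trans (cmp2_trunc n F g1 h1) _.
rewrite subr0; apply: ord_sum => i _; apply: ord_sum => l _.
have [il|il] := ltnP (i + l) n; first by rewrite Fn// rmorph0 !mul0r.
rewrite -mulrA; apply: ordMr; apply: ordW il _.
by apply: ordM; exact: ordX.
Qed.

Lemma cmp2_sXM F : cmp2 (sX K * F) g h = g * cmp2 F g h.
Proof.
apply: ord_eq => n; apply: ord_trans (ordW (leqnSn n) (cmp2_trunc n.+1 (sX K * F) g1 h1)) _.
apply: ord_sym.
apply: ord_trans (ordBM (ord_refl n g) (ordW (leqnSn n) (cmp2_trunc n.+1 F g1 h1))) _.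
rewrite mulr_sumr big_ord_recr [X in _ - X]big_ord_recl.
rewrite [X in _ - (X + _)]big1 => [|i _]; last by rewrite cf_sXM0 rmorph0 !mul0r.
rewrite add0r addrAC; apply: ordD; last first.
  rewrite mulr_sumr; apply: ord_sum => i _.
  by rewrite mulrA; apply: ordMl; rewrite mulrCA; apply: ordMr; apply: ordMr; exact: ordX.
apply: ordB_sum => i _; rewrite mulr_sumr; apply: ordB_sum => l _.
by rewrite lift0 cf_sXMS exprS !mulrA [g * _]mulrC subrr.
Qed.

Lemma cmp2_sYM F : cmp2 (sY K * F) g h = h * cmp2 F g h.
Proof.
apply: ord_eq => n; apply: ord_trans (ordW (leqnSn n) (cmp2_trunc n.+1 (sY K * F) g1 h1)) _.
apply: ord_sym.
apply: ord_trans (ordBM (ord_refl n h) (ordW (leqnSn n) (cmp2_trunc n.+1 F g1 h1))) _.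
rewrite mulr_sumr; apply: ordB_sum => i _.
rewrite mulr_sumr big_ord_recr [X in _ - X]big_ord_recl.
rewrite [(sY K * F) _ _]cf_sYM0 rmorph0 !mul0r add0r addrAC; apply: ordD; last first.
  by do 2 apply: ordMr; exact: ordX.
apply: ordB_sum => l _.
rewrite lift0 cf_sYMS exprS.
by move: (sC _) (g ^+ _) (h ^+ _) => x y z; rewrite (_ : _ - _ = 0)//; ring.
Qed.

Lemma cmp2_linM u v F : cmp2 (lin u v * F) g h = (sC u * g + sC v * h) * cmp2 F g h.
Proof.
by rewrite linE mulrDl cmp2D -!mulrA !cmp2_sCM cmp2_sXM cmp2_sYM !mulrDl !mulrA.
Qed.

Lemma cmp2_sC c : cmp2 (sC c) g h = sC c.
Proof.
apply: ord_eq => n; apply: ord_trans (ordW (leqnSn n) (cmp2_trunc n.+1 (sC c) g1 h1)) _.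
rewrite big_ord_recl big_ord_recl /= !expr0 !mulr1.
rewrite big1 ?addr0 => [|i _]; last by rewrite /= /bump /= rmorph0 !mul0r.
rewrite big1 ?addr0 ?subrr// => i _; rewrite big1// => l _.
by rewrite /= /bump /= rmorph0 !mul0r.
Qed.

Lemma cmp2_sum (I : Type) (r : seq I) (P : pred I) (FF : I -> ser K) :
  cmp2 (\sum_(i <- r | P i) FF i) g h = \sum_(i <- r | P i) cmp2 (FF i) g h.
Proof.
apply: (big_morph (fun F => cmp2 F g h)); first exact: cmp2D.
by rewrite -[X in cmp2 X](rmorph0 (@sC K)) cmp2_sC rmorph0.
Qed.

(** Only products of two one-variable series in linear forms are ever
    substituted into, so multiplicativity is stated for them. *)
Lemma cmp2_cmpM a b u v u' v' :
  cmp2 (cmp a (lin u v) * cmp b (lin u' v')) g h =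
  cmp a (sC u * g + sC v * h) * cmp b (sC u' * g + sC v' * h).
Proof.
set l := lin u v; set l' := lin u' v'.
set m := _ + sC v * h; set m' := _ + sC v' * h.
have m1 : ord 1 m by apply: ordD; exact: ordMr.
have m1' : ord 1 m' by apply: ordD; exact: ordMr.
have pw c i j : cmp2 (sC c * l ^+ i * l' ^+ j) g h = sC c * m ^+ i * m' ^+ j.
  rewrite -mulrA cmp2_sCM -mulrA; congr (_ * _).
  elim: i => [|i IH]; last by rewrite !exprS -!mulrA cmp2_linM IH.
  rewrite !mul1r; elim: j => [|j IH]; last by rewrite !exprS cmp2_linM IH.
  by rewrite !expr0 -(rmorph1 (@sC K)) cmp2_sC.
apply: ord_eq => n.
apply: ord_sym; apply: ord_trans (ordBM (cmp_trunc n a m1) (cmp_trunc n b m1')) _.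
apply: ord_sym.
set S := (\sum_(i < n) sC (a i) * l ^+ i) * \sum_(j < n) sC (b j) * l' ^+ j.
apply: (@ord_trans _ _ (cmp2 S g h)).
  rewrite -[cmp a l * _](subrK S) cmp2D addrK.
  by apply: cmp2_ord; apply: ordBM; exact: (cmp_trunc _ _ (lin_ord _ _)).
rewrite /S !mulr_suml cmp2_sum; apply: ordB_sum => i _.
rewrite !mulr_sumr cmp2_sum; apply: ordB_sum => j _.
rewrite (_ : sC (a i) * l ^+ i * _ = sC (a i * b j) * l ^+ i * l' ^+ j); last first.
  by rewrite rmorphM /= !mulrA; congr (_ * _); rewrite mulrAC.
rewrite pw rmorphM /= (_ : _ - _ = 0)//.
by apply/eqP; rewrite subr_eq0 !mulrA; apply/eqP; congr (_ * _); rewrite mulrAC.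
Qed.

End Cmp2.
End Operators.

(** * The equation and its linearisation *)

Section Parity.
Variable K : fieldType.
Implicit Types (g : ser K) (a : fps1 K).

Lemma cmp_even a g : ord 1 g -> (forall n, odd n -> a n = 0) -> cmp a (- g) = cmp a g.
Proof.
move=> g1 a0; apply: ord_eq => n.
apply: ord_trans (cmp_trunc n a (ordN g1)) (ord_sym _).
apply: ord_trans (cmp_trunc n a g1) _; apply: ordB_sum => i _.
have [oi|ei] := boolP (odd i); first by rewrite a0// rmorph0 !mul0r subrr.
by rewrite exprNn -signr_odd (negbTE ei) expr0 mul1r subrr.
Qed.

Lemma cmp_odd a g : ord 1 g -> (forall n, ~~ odd n -> a n = 0) -> cmp a (- g) = - cmp a g.
Proof.
move=> g1 a0; apply: ord_eq => n.
apply: ord_trans (cmp_trunc n a (ordN g1)) (ord_sym _).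
apply: ord_trans (ordBN (cmp_trunc n a g1)) _; rewrite -sumrN; apply: ordB_sum => i _.
have [oi|ei] := boolP (odd i); last by rewrite a0// rmorph0 !mul0r oppr0 addr0.
by rewrite exprNn -signr_odd oi expr1 mulN1r mulrN subrr.
Qed.
End Parity.

Section Billiard.
Variable K : numFieldType.
Variable lam : K.
Hypothesis lam0 : lam != 0.
Implicit Types (f g h : ser K) (a b : fps1 K).

Definition fcos : fps1 K := fps1_cos K.
Definition fsin : fps1 K := fun n => - dfps1 fcos n.

Lemma fcos_odd n : odd n -> fcos n = 0. Proof. by rewrite /fcos /fps1_cos => ->. Qed.
Lemma fsin_even n : ~~ odd n -> fsin n = 0.
Proof. by move=> n0; rewrite /fsin /dfps1 fcos_odd ?mul0rn ?oppr0. Qed.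
Lemma fcos0 : fcos 0 = 1.
Proof. by rewrite /fcos /fps1_cos /= divr1. Qed.
Lemma fsin1 : fsin 1 = 1.
Proof. by rewrite /fsin /dfps1 /fcos /fps1_cos /= expr1 mulN1r mulNrn opprK -(mulr_natr (2%:R)^-1 2) mulVf// pnatr_eq0. Qed.
Lemma dfsin n : dfps1 fsin n = fcos n.
Proof.
rewrite /fsin /dfps1 /fcos /fps1_cos /= negbK; case: ifP => [_|_].
  by rewrite mul0rn oppr0 mul0rn.
rewrite exprS mulN1r mulNr !mulNrn opprK !factS !natrM -(mulr_natr _ n.+2) -(mulr_natr _ n.+1).
by field; rewrite -(natrD _ 1 n) -(natrD _ 2 n) !pnatr_eq0 -lt0n fact_gt0.

Qed.

Definition half : ser K := sC 2^-1.
Definition pl f : ser K := sc lam lam^-1 f.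
Definition mi f : ser K := sc lam^-1 lam f.

Lemma pl_morph : continuous_morphism pl. Proof. exact: sc_morph. Qed.
Lemma mi_morph : continuous_morphism mi. Proof. exact: sc_morph. Qed.
Lemma plD f g : pl (f + g) = pl f + pl g. Proof. exact: (morphD pl_morph). Qed.
Lemma plB f g : pl (f - g) = pl f - pl g. Proof. exact: (morphB pl_morph). Qed.
Lemma plN f : pl (- f) = - pl f. Proof. exact: (morphN pl_morph). Qed.
Lemma plM f g : pl (f * g) = pl f * pl g. Proof. exact: (morphM pl_morph). Qed.
Lemma pl_ord n f : ord n f -> ord n (pl f). Proof. exact: (morph_ord pl_morph). Qed.
Lemma miD f g : mi (f + g) = mi f + mi g. Proof. exact: (morphD mi_morph). Qed.
Lemma miB f g : mi (f - g) = mi f - mi g. Proof. exact: (morphB mi_morph). Qed.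
Lemma miN f : mi (- f) = - mi f. Proof. exact: (morphN mi_morph). Qed.
Lemma miM f g : mi (f * g) = mi f * mi g. Proof. exact: (morphM mi_morph). Qed.
Lemma mi_ord n f : ord n f -> ord n (mi f). Proof. exact: (morph_ord mi_morph). Qed.
Lemma plmi f : pl (mi f) = f.
Proof. by rewrite /pl /mi sc_sc mulfV// mulVf// sc1. Qed.
Lemma mipl f : mi (pl f) = f.
Proof. by rewrite /pl /mi sc_sc mulfV// mulVf// sc1. Qed.

(** EE is the equation with the derivatives of the generating function computed:
    calE_EE identifies the two. *)
Definition MM f := half * (f + pl f).
Definition DD f := half * (f - pl f).
Definition XX a f := cmp (dfps1 a) (MM f) * cmp fcos (DD f).
Definition YY a f := cmp a (MM f) * cmp fsin (DD f).
Definition EE a f := half * (mi (XX a f + YY a f) + XX a f - YY a f).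

Lemma MM_ord n f : ord n f -> ord n (MM f).
Proof. by move=> fn; apply: ordMr; apply: ordD => //; exact: pl_ord. Qed.
Lemma DD_ord n f : ord n f -> ord n (DD f).
Proof. by move=> fn; apply: ordMr; apply: ordB => //; exact: pl_ord. Qed.
Lemma MMD f g : MM (f + g) = MM f + MM g.
Proof. by rewrite /MM plD; ring. Qed.
Lemma DDD f g : DD (f + g) = DD f + DD g.
Proof. by rewrite /DD plD; ring. Qed.
Lemma MMB f g : MM (f - g) = MM f - MM g.
Proof. by rewrite /MM plB; ring. Qed.
Lemma DDB f g : DD (f - g) = DD f - DD g.
Proof. by rewrite /DD plB; ring. Qed.
Lemma MMN f : MM (- f) = - MM f.
Proof. by rewrite /MM plN; ring. Qed.
Lemma DDN f : DD (- f) = - DD f.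
Proof. by rewrite /DD plN; ring. Qed.

Lemma pd2_genS a : pd2 (Ser (genS a)) = half * (cmp (dfps1 a) (lin 2^-1 2^-1) * cmp fcos (lin 2^-1 (- 2^-1))
   + cmp a (lin 2^-1 2^-1) * cmp fsin (lin 2^-1 (- 2^-1))).
Proof.
rewrite -[Ser (genS a)]/(cmp a (lin 2^-1 2^-1) * cmp fcos (lin 2^-1 (- 2^-1))).
rewrite (der_mul (@pd2_der K)) !(der_cmp (@pd2_der K)); try exact: lin_ord.
rewrite !pd2_lin rmorphN /= -/half /fsin cmpN; ring.
Qed.
Lemma pd1_genS a : pd1 (Ser (genS a)) = half * (cmp (dfps1 a) (lin 2^-1 2^-1) * cmp fcos (lin 2^-1 (- 2^-1))
   - cmp a (lin 2^-1 2^-1) * cmp fsin (lin 2^-1 (- 2^-1))).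
Proof.
rewrite -[Ser (genS a)]/(cmp a (lin 2^-1 2^-1) * cmp fcos (lin 2^-1 (- 2^-1))).
rewrite (der_mul (@pd1_der K)) !(der_cmp (@pd1_der K)); try exact: lin_ord.
rewrite !pd1_lin -/half /fsin cmpN; ring.
Qed.

Lemma mi_cmp a g : ord 1 g -> mi (cmp a g) = cmp a (mi g).
Proof. by move=> g1; apply: (morph_cmp mi_morph) => // n; rewrite /mi sc_sC. Qed.
Lemma mi_half : mi half = half. Proof. exact: sc_sC. Qed.
Lemma mi_MM f : mi (MM f) = half * (mi f + f).
Proof. by rewrite miM miD mi_half mipl. Qed.
Lemma mi_DD f : mi (DD f) = half * (mi f - f).
Proof. by rewrite miM miB mi_half mipl. Qed.

Lemma calE_EE a f : ord 1 f -> Ser (calE lam a f) = EE a f.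
Proof.
move=> f1; have f1p : ord 1 (pl f) by exact: pl_ord.
have f1m : ord 1 (mi f) by exact: mi_ord.
rewrite -[Ser _]/(cmp2 (pd2 (Ser (genS a))) (mi f) f + cmp2 (pd1 (Ser (genS a))) f (pl f)).
rewrite pd1_genS pd2_genS !cmp2_sCM// -/half !cmp2D//.
rewrite -[- (cmp a _ * _)]mulN1r -{1}(rmorph1 (@sC K)) -rmorphN cmp2_sCM//.
rewrite !cmp2_cmpM// !rmorphN rmorph1 /= -/half.
rewrite /EE miD /XX /YY !miM.
rewrite !mi_cmp; try by [exact: MM_ord | exact: DD_ord].
rewrite mi_MM mi_DD /MM /DD -!mulrDr -!mulNr.
rewrite (_ : half * mi f + - half * f = half * (mi f - f)); last by ring.
rewrite (_ : half * f + - half * pl f = half * (f - pl f)); last by ring.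
ring.
Qed.

(** ** Linearisation *)

Definition dX a f h := cmp (dfps1 (dfps1 a)) (MM f) * cmp fcos (DD f) * MM h
   - cmp (dfps1 a) (MM f) * cmp fsin (DD f) * DD h.
Definition dY a f h := cmp (dfps1 a) (MM f) * cmp fsin (DD f) * MM h
   + cmp a (MM f) * cmp fcos (DD f) * DD h.
Definition LL a f h := half * (mi (dX a f h + dY a f h) + dX a f h - dY a f h).

(** The coefficients of the linearised equation, seen as a second order
    difference operator (LLE). *)
Definition bet a f := half * half * ((cmp (dfps1 (dfps1 a)) (MM f) + cmp a (MM f)) * cmp fcos (DD f)).
Definition alp a f :=
  let A := half * half * ((cmp (dfps1 (dfps1 a)) (MM f) - cmp a (MM f)) * cmp fcos (DD f)) in
  let B := half * half * (cmp (dfps1 a) (MM f) * cmp fsin (DD f) *+ 2) in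
  mi (A + B) + (A - B).

Lemma LLE a f h : LL a f h = alp a f * h + bet a f * pl h + mi (bet a f * h).
Proof.
rewrite /LL /dX /dY /alp /bet /= /MM -/(MM f) /DD -/(DD f).
move: (cmp _ _) (cmp _ _) (cmp _ _) (cmp _ _) (cmp _ _) => q2 c q1 s q.
rewrite !(miD, miM, miN, mulr2n) !mipl !mi_half.
ring.
Qed.

Lemma EE_taylor a f h m : ord 1 f -> (0 < m)%N -> ord m h ->
  ord (m + m) (EE a (f + h) - EE a f - LL a f h).
Proof.
move=> f1 m0 hm; have h1 : ord 1 h by exact: ordW hm.
have Mh := MM_ord hm; have Dh := DD_ord hm.
have T b := cmp_taylor b (MM_ord f1) (MM_ord h1) Mh.
have T' b := cmp_taylor b (DD_ord f1) (DD_ord h1) Dh.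
rewrite -!MMD -!DDD in T T'.
have prod (q q1 qh c c1 ch : ser K) x y : ord m x -> ord m y ->
    ord (m + m) (qh - q - q1 * x) -> ord (m + m) (ch - c - c1 * y) ->
    ord (m + m) (qh * ch - q * c - (q1 * c * x + q * c1 * y)).
  move=> xm ym a1 a2.
  rewrite (_ : _ - _ = (qh - q - q1 * x) * ch + (q + q1 * x) * (ch - c - c1 * y) + q1 * c1 * (x * y)); last by ring.
  by apply: ordD; [apply: ordD; [exact: ordMl|exact: ordMr]|apply: ordMr; exact: ordM].
have dc : cmp (dfps1 fcos) (DD f) = - cmp fsin (DD f).
  by rewrite -cmpN; apply: eq_cmp => n; rewrite opprK.
have HX : ord (m + m) (XX a (f + h) - XX a f - dX a f h).
  rewrite /XX /dX; have := prod _ _ _ _ _ _ _ _ Mh Dh (T (dfps1 a)) (T' fcos).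
  by rewrite dc mulrN mulNr.
have HY : ord (m + m) (YY a (f + h) - YY a f - dY a f h).
  rewrite /YY /dY; have := prod _ _ _ _ _ _ _ _ Mh Dh (T a) (T' fsin).
  by rewrite (eq_cmp _ dfsin).
rewrite /EE /LL -!mulrBr; apply: ordMr.
rewrite (_ : _ - _ = mi ((XX a (f + h) - XX a f - dX a f h) + (YY a (f + h) - YY a f - dY a f h))
  + (XX a (f + h) - XX a f - dX a f h) - (YY a (f + h) - YY a f - dY a f h)).
  by apply: ordB => //; apply: ordD => //; apply: mi_ord; exact: ordD.
rewrite !(miD, miN); ring.
Qed.

(** Differentiating the equation: a derivation commuting with the rotations maps
    it to the linearised equation at the derivative of phi.  Applied to a
    solution, it produces elements of the kernel of the linearisation. *)
Lemma EE_der D a f : derivation D -> (forall g u v, D (sc u v g) = sc u v (D g)) ->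
  ord 1 f -> D (EE a f) = LL a f (D f).
Proof.
move=> dD Dsc f1; have Dpl g : D (pl g) = pl (D g) by exact: Dsc.
have Dmi g : D (mi g) = mi (D g) by exact: Dsc.
have DM : D (MM f) = MM (D f) by rewrite (der_sCM dD) (derD dD) Dpl.
have DDf : D (DD f) = DD (D f) by rewrite (der_sCM dD) (derB dD) Dpl.
have dc : cmp (dfps1 fcos) (DD f) = - cmp fsin (DD f).
  by rewrite -cmpN; apply: eq_cmp => n; rewrite opprK.
have HX : D (XX a f) = dX a f (D f).
  rewrite /XX /dX (der_mul dD) !(der_cmp dD) ?DM ?DDf ?dc; try by [exact: MM_ord | exact: DD_ord].
  ring.
have HY : D (YY a f) = dY a f (D f).
  rewrite /YY /dY (der_mul dD) !(der_cmp dD) ?DM ?DDf ?(eq_cmp _ dfsin); try by [exact: MM_ord | exact: DD_ord].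
  ring.
by rewrite /EE /LL (der_sCM dD) (derB dD) (derD dD) Dmi (derD dD) HX HY.
Qed.

Lemma EED a b f : EE (fun n => a n + b n) f = EE a f + EE b f.
Proof.
have dD : dfps1 (fun n => a n + b n) =1 (fun n => dfps1 a n + dfps1 b n).
  by move=> n; rewrite /dfps1 mulrnDl.
have HX : XX (fun n => a n + b n) f = XX a f + XX b f.
  by rewrite /XX (eq_cmp _ dD) cmpD mulrDl.
have HY : YY (fun n => a n + b n) f = YY a f + YY b f by rewrite /YY cmpD mulrDl.
rewrite /EE HX HY !miD; ring.
Qed.

Lemma EE_ext a b f : a =1 b -> EE a f = EE b f.
Proof.
move=> ab; have dab : dfps1 a =1 dfps1 b by move=> n; rewrite /dfps1 ab.
by rewrite /EE /XX /YY (eq_cmp _ ab) (eq_cmp _ dab).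
Qed.

Lemma EE_ord b f n : ord 1 f -> (forall i, (i <= n)%N -> b i = 0) -> ord n (EE b f).
Proof.
move=> f1 b0; have HX : ord n (XX b f).
  by apply: ordMl; apply: cmp_ord (MM_ord f1) _ => i ni; rewrite /dfps1 b0 ?mul0rn.
have HY : ord n (YY b f).
  by apply: ordMl; apply: cmp_ord (MM_ord f1) _ => i ni; rewrite b0// ltnW.
apply: ordMr; apply: ordB => //; apply: ordD => //.
by apply: mi_ord; exact: ordD.
Qed.

(** The equation is continuous in phi for the topology of coefficients, which is
    used to pass from truncations to the solution. *)
Lemma EE_cong a f f' n : ord 1 f -> ord 1 f' -> ord n (f - f') -> ord n (EE a f - EE a f').
Proof.
move=> f1 f1' ff'.
have HX : ord n (XX a f - XX a f').
  by apply: ordBM; apply: cmp_cong; rewrite -?MMB -?DDB; try by [exact: MM_ord | exact: DD_ord].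
have HY : ord n (YY a f - YY a f').
  by apply: ordBM; apply: cmp_cong; rewrite -?MMB -?DDB; try by [exact: MM_ord | exact: DD_ord].
apply: ordBM; first exact: ord_refl.
apply: ordBB => //; apply: ordBD => //; rewrite -miB.
by apply: mi_ord; exact: ordBD.
Qed.

(** ** Symmetries *)

Section Symmetry.
Variable T : ser K -> ser K.
Hypothesis cT : continuous_morphism T.

(** A symmetry exchanging the two rotations reverses the orientation of the
    orbit.  The two terms of the equation are exchanged; the parities of cosine
    and sine compensate the sign change of D.  Rational constants have to be fixed
    because they occur in the cosine series. *)
Lemma EE_reverse a f : ord 1 f -> T f = f ->
  (forall g, T (pl g) = mi (T g)) -> (forall g, T (mi g) = pl (T g)) ->
  (forall n, T (sC (a n)) = sC (a n)) -> (forall c : rat, T (sC (ratr c)) = sC (ratr c)) ->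
  T (EE a f) = EE a f.
Proof.
move=> f1 Tf Tpl Tmi Ta Tr.
have Thalf : T half = half.
  by rewrite /half; have := Tr 2^-1; rewrite fmorphV rmorph_nat.
have Tn c n : T (sC c) = sC c -> T (sC (c *+ n)) = sC (c *+ n).
  move=> Tc; elim: n => [|n IH]; first by rewrite mulr0n; have := Tr 0; rewrite rmorph0.
  by rewrite mulrS rmorphD /= (morphD cT) Tc IH.
have Tcos n : T (sC (fcos n)) = sC (fcos n).
  rewrite -[fcos n](_ : ratr (fps1_cos rat n) = _) ?Tr//.
  rewrite /fcos /fps1_cos; case: ifP => _; first by rewrite rmorph0.
  by rewrite fmorph_div rmorphXn rmorphN rmorph1 rmorph_nat.
have Tsin n : T (sC (fsin n)) = sC (fsin n).
  by rewrite /fsin rmorphN /= (morphN cT) Tn.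
have Tda n : T (sC (dfps1 a n)) = sC (dfps1 a n) by rewrite Tn.
have TM : T (MM f) = mi (MM f) by rewrite mi_MM (morphM cT) (morphD cT) Thalf Tf Tpl Tf addrC.
have TD : T (DD f) = - mi (DD f).
  by rewrite mi_DD (morphM cT) (morphB cT) Thalf Tf Tpl Tf -mulrN opprB.
have M1 := MM_ord f1; have D1 := DD_ord f1.
have D1' : ord 1 (mi (DD f)) by exact: mi_ord.
have TX : T (XX a f) = mi (XX a f).
  rewrite /XX (morphM cT) miM !mi_cmp//.
  rewrite (morph_cmp cT M1 Tda) (morph_cmp cT D1 Tcos) TM TD cmp_even//; exact: fcos_odd.
have TY : T (YY a f) = - mi (YY a f).
  rewrite /YY (morphM cT) miM !mi_cmp//.
  rewrite (morph_cmp cT M1 Ta) (morph_cmp cT D1 Tsin) TM TD cmp_odd ?mulrN//; exact: fsin_even.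
rewrite /EE (morphM cT) Thalf (morphB cT) (morphD cT) Tmi (morphD cT) TX TY.
rewrite plB !plmi miD; ring.
Qed.
End Symmetry.

Lemma EE_odd a f : ord 1 f -> (forall n, odd n -> a n = 0) -> EE a (- f) = - EE a f.
Proof.
move=> f1 a0; have M1 := MM_ord f1; have D1 := DD_ord f1.
have HX : XX a (- f) = - XX a f.
  rewrite /XX MMN DDN cmp_odd ?cmp_even ?mulNr//; first exact: fcos_odd.
  by move=> n n0; rewrite /dfps1 a0 ?mul0rn.
have HY : YY a (- f) = - YY a f.
  by rewrite /YY MMN DDN (cmp_even M1 a0) (cmp_odd D1 fsin_even) mulrN.
rewrite /EE HX HY !miD !miN; ring.
Qed.

End Billiard.

(** * The eigenvalues of the linearisation *)

Section LinPow.
Variable K : fieldType.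

Lemma cf_linM (u v : K) f j l : (lin u v * f) j l =
  (if j is j'.+1 then u * f j' l else 0) + (if l is l'.+1 then v * f j l' else 0).
Proof.
rewrite linE mulrDl cfD -!mulrA !cf_sCM.
by case: j l => [|j] [|l]; rewrite ?cf_sXM0 ?cf_sYM0 ?cf_sXMS ?cf_sYMS ?mulr0.
Qed.

Lemma cf_linX (u v : K) n j l : (lin u v ^+ n) j l =
  if (j + l == n)%N then 'C(n, j)%:R * u ^+ j * v ^+ l else 0.
Proof.
elim: n j l => [|n IH] j l; first by case: j l => [|j] [|l]; rewrite ?bin0 ?mulr1.
rewrite exprS cf_linM; case: j l => [|j] [|l].
- by rewrite addr0.
- by rewrite add0r IH !add0n eqSS !bin0; case: ifP => _; rewrite ?mulr0// [v ^+ l.+1]exprS; ring.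
- rewrite addr0 IH !addn0 eqSS; case: ifP => [/eqP ->|_]; rewrite ?mulr0// !binn [u ^+ n.+1]exprS; ring.
- rewrite !IH !addSn !addnS eqSS; case: ifP => _; last by rewrite !mulr0 addr0.
  rewrite binS natrD [u ^+ j.+1]exprS [v ^+ l.+1]exprS; ring.
Qed.

Lemma expX_sub_ord n (f g : ser K) m i : ord m f -> ord m g -> ord (m + i) (f - g) ->
  ord (m * n + i) (f ^+ n - g ^+ n).
Proof.
move=> fm gm fg; elim: n => [|n IH]; first by rewrite subrr.
rewrite !exprS (_ : _ - _ = (f - g) * f ^+ n + g * (f ^+ n - g ^+ n)); last by ring.
apply: ordD; rewrite mulnS; last by rewrite -addnA; apply: ordM.
by rewrite addnAC; apply: ordM => //; apply: ordXM.
Qed.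
End LinPow.

Section Existence.
Variable K : numClosedFieldType.
Variable lam : K.
Hypothesis lam_conj : lam^* = lam^-1.
Hypothesis lam0 : lam != 0.
Hypothesis nonres : forall n, (0 < n)%N -> lam ^+ n != 1.
Implicit Types (f g h : ser K) (a b : fps1 K).

Definition om : K := 2 + lam + lam^-1.

Lemma om_neq0 : om != 0.
Proof.
have l1 : lam + 1 != 0.
  apply/eqP => /eqP; rewrite addr_eq0 => /eqP l1.
  by have := nonres (isT : (0 < 2)%N); rewrite l1 sqrrN expr1n eqxx.
have -> : om = (lam + 1) ^+ 2 * lam^-1 by rewrite /om; field.
by rewrite mulf_neq0 ?expf_neq0 ?invr_neq0.
Qed.

(** The value of the second coefficient of the support function for which the
    linear part of the equation vanishes at z + zb. *)
Definition q2 : K := (2 - lam - lam^-1) / (2 * om).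

Lemma q2_om : q2 *+ 2 + 1 = 4 * om^-1.
Proof.
rewrite -[_ *+ 2]mulr_natr; move: om_neq0; rewrite /q2 /om; move: lam^-1 => y o; field.
by rewrite o ?pnatr_eq0.
Qed.

Lemma two_neq0 : (2 : K) != 0. Proof. by rewrite pnatr_eq0. Qed.

Lemma lam_expI i j : lam ^+ i = lam ^+ j -> i = j.
Proof.
wlog ij : i j / (i <= j)%N => [H|].
  by have [/H//|/ltnW /H + /esym] := leqP i j => /[apply].
move=> e; apply/eqP; rewrite eqn_leq ij /= -subn_eq0 -leqn0 leqNgt.
apply/negP => /nonres /eqP; apply.
have li : lam ^+ i != 0 by rewrite expf_neq0.
by apply: (mulfI li); rewrite -exprD subnKC// mulr1.
Qed.

(** The factor by which the linearisation at z + zb acts on the monomial of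
    bidegree (j, l), to leading order. *)
Definition eigen j l : K :=
  (lam ^+ j * lam^-1 ^+ l + lam^-1 ^+ j * lam ^+ l - lam - lam^-1) / om.

Definition resonant j l := (j == l.+1) || (l == j.+1).

Lemma eigen_res j l : resonant j l -> eigen j l = 0.
Proof.
have ll n : lam ^+ n * lam^-1 ^+ n = 1 by rewrite -exprMn mulfV// expr1n.
have e x y : x * y = 1 -> lam * (x * y) + lam^-1 * (x * y) - lam - lam^-1 = 0.
  by move=> ->; rewrite !mulr1; ring.
rewrite /resonant /eigen => /orP[] /eqP ->; rewrite !exprS.
  by rewrite -[RHS](mul0r om^-1) -(e _ _ (ll l)); congr (_ / _); ring.
by rewrite -[RHS](mul0r om^-1) -(e _ _ (ll j)); congr (_ / _); ring.
Qed.

(** With mu = lam^(j-l) the numerator is (mu - lam)(mu - 1/lam)/mu. *)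
Lemma eigen_neq0 j l : ~~ resonant j l -> eigen j l != 0.
Proof.
rewrite /resonant negb_or => /andP[jl lj].
rewrite /eigen mulf_neq0 ?invr_neq0 ?om_neq0//.
set mu := lam ^+ j * lam^-1 ^+ l.
have -> : lam^-1 ^+ j * lam ^+ l = mu^-1.
  by rewrite /mu invfM -!exprVn invrK.
have mu0 : mu != 0 by rewrite mulf_neq0 ?expf_neq0 ?invr_neq0.
have -> : mu + mu^-1 - lam - lam^-1 = (mu - lam) * (mu - lam^-1) * mu^-1.
  by field; rewrite lam0 mu0.
have lam_l : lam ^+ l != 0 by rewrite expf_neq0.
have mul_l : mu * lam ^+ l = lam ^+ j.
  by rewrite /mu -mulrA -exprMn mulVf// expr1n mulr1.
rewrite !mulf_neq0 ?invr_neq0// subr_eq0; apply/eqP => e.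
  by move: jl => /eqP; apply; apply: lam_expI; rewrite -mul_l e exprS.
move: lj => /eqP; apply; apply: lam_expI.
by rewrite exprS -mul_l e mulrA mulfV// mul1r.
Qed.

Lemma eigenC j l : eigen j l = eigen l j.
Proof. by rewrite /eigen; congr (_ / _); ring. Qed.

Lemma om_conj : om^* = om.
Proof.
by rewrite /om 2!rmorphD fmorphV rmorph_nat /= lam_conj invrK addrAC.
Qed.
Lemma q2_conj : q2^* = q2.
Proof.
rewrite /q2 rmorphM fmorphV rmorphM 2!rmorphB !rmorph_nat fmorphV /= om_conj.
by rewrite lam_conj invrK addrAC.
Qed.
Lemma eigen_conj j l : (eigen j l)^* = eigen j l.
Proof.
rewrite /eigen rmorphM fmorphV /= om_conj !rmorphB rmorphD !rmorphM !rmorphXn /=.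
by rewrite !fmorphV /= lam_conj invrK; congr (_ / _); ring.
Qed.

End Existence.

(** * Leading terms of the equation *)

Section Lead.
Variable K : fieldType.
Implicit Types f g h : ser K.

Lemma cf00M f g : (f * g) 0%N 0%N = f 0%N 0%N * g 0%N 0%N.
Proof. by rewrite cfM !big_ord1. Qed.

Lemma cf_lead A h n j l : ord n h -> (j + l = n)%N -> (A * h) j l = A 0%N 0%N * h j l.
Proof.
move=> hn jl; rewrite -cf_sCM; apply: (@ord_cf _ n.+1); last by rewrite jl.
rewrite -mulrBl -add1n; apply: ordM => //.
by apply/ord1P; rewrite cfB /= subrr.
Qed.

Lemma cmp00 a g : (cmp a g) 0%N 0%N = a 0%N.
Proof. by rewrite /= /fps2_comp1 big_ord1 /= /fps2_one /= mulr1. Qed.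

Definition swap f : ser K := Ser (fun j l => f l j).

Lemma swap_morph : continuous_morphism swap.
Proof.
split; first by move=> f g; apply: serP.
- split; first by apply: serP => -[|j] [|k].
  move=> f g; apply: serP => j l; rewrite -[LHS]/((f * g) l j) cfM exchange_big cfM.
  by apply: eq_bigr => i _; apply: eq_bigr.
- by move=> n f fn j l jl; rewrite /= fn// addnC.
Qed.
Lemma swap_sC c : swap (sC c) = sC c.
Proof. by apply: serP => -[|j] [|k]. Qed.

End Lead.

Section Existence.
Variable K : numClosedFieldType.
Variable lam : K.
Hypothesis lam_conj : lam^* = lam^-1.
Hypothesis lam0 : lam != 0.
Hypothesis nonres : forall n, (0 < n)%N -> lam ^+ n != 1.
Implicit Types (f g h : ser K) (a b : fps1 K).

Local Notation pl := (pl lam).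
Local Notation mi := (mi lam).
Local Notation MM := (MM lam).
Local Notation DD := (DD lam).
Local Notation XX := (XX lam).
Local Notation YY := (YY lam).
Local Notation EE := (EE lam).
Local Notation LL := (LL lam).
Local Notation q2 := (q2 lam).
Local Notation om := (om lam).
Local Notation eigen := (eigen lam).
Local Notation half := (half K).

Lemma cf_pl f j l : pl f j l = f j l * lam ^+ j * lam^-1 ^+ l. Proof. by []. Qed.
Lemma cf_mi f j l : mi f j l = f j l * lam^-1 ^+ j * lam ^+ l. Proof. by []. Qed.

Lemma miMn f n : mi (f *+ n) = mi f *+ n.
Proof. by apply: serP => j l; rewrite cfMn !cf_mi cfMn !mulrnAl. Qed.

Lemma bet00 a f : a 0%N = 1 -> a 2%N = q2 -> (bet lam a f) 0%N 0%N = om^-1.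
Proof.
move=> a0 a2; rewrite /bet !cf00M cfD !cmp00 fcos0 /dfps1 a0 a2 mulr1 /half /=.
rewrite /q2 mulr1n -[_ *+ 2]mulr_natr.
have := om_neq0 lam0 nonres; rewrite /om; move: lam^-1 => y o0.
by field; rewrite ?pnatr_eq0 ?o0.
Qed.

Lemma alp00 a f : a 0%N = 1 -> a 2%N = q2 ->
  (alp lam a f) 0%N 0%N = - (lam + lam^-1) * om^-1.
Proof.
move=> a0 a2; rewrite /alp cfD cf_mi !cfD cfN !cf00M cfMn !cf00M cfD cfN !cmp00 fcos0 /fsin /dfps1 a0 a2 mulr1.
rewrite fcos_odd// mul0rn oppr0 mulr0 mul0rn mulr0 oppr0 !addr0 !mulr1.
rewrite /q2 mulr1n -[_ *+ 2]mulr_natr /half /=.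
have := om_neq0 lam0 nonres; rewrite /om; move: lam^-1 => y o0.
by field; rewrite ?pnatr_eq0 ?o0.
Qed.

Lemma LL_lead a f h n j l : a 0%N = 1 -> a 2%N = q2 -> ord n h -> (j + l = n)%N ->
  LL a f h j l = eigen j l * h j l.
Proof.
move=> a0 a2 hn jl; rewrite LLE// !cfD cf_mi.
rewrite (cf_lead _ hn jl) (cf_lead _ (pl_ord lam hn) jl) cf_pl (cf_lead _ hn jl).
by rewrite alp00// bet00// /eigen; ring.
Qed.

Lemma EEZ c a f : EE (fun n => c * a n) f = sC c * EE a f.
Proof.
have cmpZ b g : cmp (fun n => c * b n) g = sC c * cmp b g.
  apply: serP => j k; rewrite cf_sCM /= /fps2_comp1 mulr_sumr.
  by apply: eq_bigr => i _; rewrite mulrA.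
have HX : XX (fun n => c * a n) f = sC c * XX a f.
  rewrite /XX mulrA -cmpZ; congr (_ * _); apply: eq_cmp => n.
  by rewrite /dfps1 mulrnAr.
have HY : YY (fun n => c * a n) f = sC c * YY a f by rewrite /YY cmpZ mulrA.
rewrite /EE HX HY -mulrDr (miM lam) {1}/mi sc_sC; ring.
Qed.

Definition mono m : fps1 K := fun n => (n == m)%:R.

Lemma cmp_mono m g : ord 1 g -> cmp (mono m) g = g ^+ m.
Proof.
move=> g1; apply: ord_eq => n.
apply: ord_trans (ordW (leq_addr m.+1 n) (cmp_trunc (n + m.+1) (mono m) g1)) _.
have mn : (m < n + m.+1)%N by rewrite ltn_addl.
rewrite (bigD1 (Ordinal mn))//= /mono eqxx rmorph1 mul1r big1 ?addr0 ?subrr// => i im.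
by rewrite (_ : (_ == _) = false) ?rmorph0 ?mul0r//; apply: negbTE; apply: contra im.
Qed.

Lemma cmp_dmono m g : ord 1 g -> cmp (dfps1 (mono m.+1)) g = g ^+ m *+ m.+1.
Proof.
move=> g1; rewrite -cmp_mono// -[RHS]mulr_natl -[m.+1%:R](rmorph_nat (@sC K)).
apply: serP => j k; rewrite cf_sCM /= /fps2_comp1 mulr_sumr; apply: eq_bigr => i _.
by rewrite mulrA /dfps1 /mono eqSS mulr_natl; case: eqP => [->|]; rewrite ?mul0rn.
Qed.

(** The leading term contributed to the equation by the coefficient of t^(m+1)
    in the support function. *)
Definition pure m : ser K := half * (mi (MM (lin 1 1) ^+ m) + MM (lin 1 1) ^+ m) *+ m.+1.

Lemma cmp_cos1 n f g : ord n f -> ord 1 g -> ord n.+1 (f * cmp (fcos K) g - f).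
Proof.
move=> fn g1; rewrite -[X in _ - X]mulr1 -mulrBr -addn1; apply: ordM => //.
by apply/ord1P; rewrite cfB cmp00 fcos0 subrr.
Qed.

Lemma EE_mono m f : ord 1 f -> ord 2 (f - lin 1 1) -> ord m.+1 (EE (mono m.+1) f - pure m).
Proof.
move=> f1 ff; have M1 := MM_ord lam f1; have D1 := DD_ord lam f1.
have MX : ord m.+1 (MM f ^+ m - MM (lin 1 1) ^+ m).
  rewrite -addn1 -{1}(mul1n m); apply: expX_sub_ord => //.
    exact: (MM_ord lam (@lin_ord _ _ _)).
  by rewrite -MMB; exact: MM_ord.
have HX : ord m.+1 (XX (mono m.+1) f - MM (lin 1 1) ^+ m *+ m.+1).
  rewrite /XX cmp_dmono//.
  apply: (@ord_trans _ _ (MM f ^+ m *+ m.+1)).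
    by apply: cmp_cos1 D1; rewrite -mulr_natr; apply: ordMl; exact: ordX.
  by rewrite -mulrnBl -mulr_natr; apply: ordMl.
have HY : ord m.+1 (YY (mono m.+1) f) by rewrite /YY cmp_mono//; apply: ordMl; exact: ordX.
rewrite /EE /pure -mulrnAr -mulrBr; apply: ordMr.
set x := XX _ _ in HX *; set y := YY _ _ in HY *; set z := _ ^+ m in HX *.
rewrite mulrnDl (_ : _ - _ = mi (x - z *+ m.+1) + mi y + (x - z *+ m.+1) - y).
  by apply: ordB => //; apply: ordD => //; apply: ordD; exact: (mi_ord lam).
rewrite !(miD lam) (miN lam) miMn; ring.
Qed.

Lemma MM_lin : MM (lin 1 1) = lin ((1 + lam) / 2) ((1 + lam^-1) / 2).
Proof.
rewrite /MM (_ : pl (lin 1 1) = lin lam lam^-1).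
  rewrite !linE /half !rmorphM !rmorphD !rmorph1 /=; ring.
apply: serP => -[|[|j]] [|[|k]]; rewrite /= /fps2_scale /fps2_lin /= ?mul0r ?mul1r ?mulr1 //.
Qed.

Lemma cf_pure m j l : (j + l = m)%N -> pure m j l =
  2^-1 * ('C(m, j)%:R * ((1 + lam) / 2) ^+ j * ((1 + lam^-1) / 2) ^+ l)
   * (lam^-1 ^+ j * lam ^+ l + 1) *+ m.+1.
Proof.
move=> jl; rewrite /pure cfMn cf_sCM cfD cf_mi MM_lin cf_linX jl eqxx.
by congr (_ *+ _); ring.
Qed.

(** At the resonant monomials this contribution is a central binomial
    coefficient times a power of om/4, in particular it does not vanish. *)
Lemma pure_res k : pure k.*2.+1 k.+1 k = (k.*2.+2 * 'C(k.*2.+1, k))%:R * (om / 4) ^+ k.+1.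
Proof.
rewrite cf_pure; last by rewrite addSn addnn.
have -> : 'C(k.*2.+1, k.+1) = 'C(k.*2.+1, k).
  by rewrite -bin_sub; [congr 'C(_, _)|]; rewrite -addnn; lia.
have lk : lam^-1 ^+ k.+1 * lam ^+ k = lam^-1 by rewrite exprSr -mulrA mulrCA -exprMn mulVf// expr1n mulr1.
rewrite lk natrM -[LHS]mulr_natl -[RHS]mulrA; congr (_ * _).
rewrite (_ : om / 4 = ((1 + lam) / 2) * ((1 + lam^-1) / 2)); last by rewrite /om; field.
rewrite [RHS](congr1 _ (exprMn _ _ _)) [((1 + lam^-1) / 2) ^+ k.+1]exprS.
move: (_ ^+ k) (((1 + lam) / 2) ^+ k.+1) ('C(_,_)%:R) => x y z.
by field.
Qed.

Lemma pure_neq0 k : pure k.*2.+1 k.+1 k != 0.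
Proof.
rewrite pure_res mulf_neq0//.
  by rewrite pnatr_eq0 muln_eq0 negb_or /= -lt0n bin_gt0 -addnn; lia.
by rewrite expf_neq0// mulf_neq0 ?om_neq0// invr_eq0 pnatr_eq0.
Qed.

(** Reality, symmetry and parity of the equation, each by transporting it along
    an automorphism of the ring of series. *)
Lemma EE_swap a f j l : ord 1 f -> (forall j l, f j l = f l j) -> EE a f j l = EE a f l j.
Proof.
move=> f1 fs.
have /(congr1 (fun F : ser K => F l j)) <- // : swap (EE a f) = EE a f.
apply: (EE_reverse lam0 (@swap_morph K)) => //.
- by apply: serP => j' l' /=; rewrite fs.
- by move=> g; apply: serP => j' l' /=; rewrite /fps2_scale mulrAC.
- by move=> g; apply: serP => j' l' /=; rewrite /fps2_scale mulrAC.
- by move=> *; exact: swap_sC.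
- by move=> *; exact: swap_sC.
Qed.

Definition conjs f : ser K := Ser (fun j l => (f j l)^*).

Lemma conjs_morph : continuous_morphism conjs.
Proof.
split; first by move=> f g; apply: serP => j l; rewrite -[LHS]/(((f - g) j l)^*) !cfB rmorphB.
- split; first by apply: serP => -[|j] [|k]; rewrite /= ?rmorph0 ?rmorph1.
  move=> f g; apply: serP => j l; rewrite -[LHS]/(((f * g) j l)^*) !cfM rmorph_sum.
  by apply: eq_bigr => i _; rewrite rmorph_sum; apply: eq_bigr => k _; rewrite rmorphM.
- by move=> n f fn j l jl; rewrite /= fn// rmorph0.
Qed.
Lemma conjs_sC c : conjs (sC c) = sC (c^*).
Proof. by apply: serP => -[|j] [|k]; rewrite //= rmorph0. Qed.

Lemma EE_conj a f j l : ord 1 f -> (forall j l, (f j l)^* = f j l) ->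
  (forall n, (a n)^* = a n) -> (EE a f j l)^* = EE a f j l.
Proof.
move=> f1 fr ar.
have lc : (lam^-1)^* = lam by rewrite fmorphV /= lam_conj invrK.
have /(congr1 (fun F : ser K => F j l)) // : conjs (EE a f) = EE a f.
apply: (EE_reverse lam0 conjs_morph) => //.
- by apply: serP => j' l' /=; rewrite fr.
- by move=> g; apply: serP => j' l' /=; rewrite /fps2_scale /= !rmorphM !rmorphXn /= lc lam_conj.
- by move=> g; apply: serP => j' l' /=; rewrite /fps2_scale /= !rmorphM !rmorphXn /= lc lam_conj.
- by move=> n; rewrite conjs_sC ar.
- by move=> c; rewrite conjs_sC fmorph_rat.
Qed.

Lemma EE_parity a f j l : ord 1 f -> (forall n, odd n -> a n = 0) ->
  (forall j l, ~~ odd (j + l)%N -> f j l = 0) -> ~~ odd (j + l)%N -> EE a f j l = 0.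
Proof.
move=> f1 a0 f0 jl.
pose T := @sc K (-1) (-1).
have cT : continuous_morphism T := sc_morph _ _.
have Tpl g : T (pl g) = pl (T g) by rewrite /T /pl !sc_sc ![-1 * _]mulrC.
have Tmi g : T (mi g) = mi (T g) by rewrite /T /mi !sc_sc ![-1 * _]mulrC.
have TC c : T (sC c) = sC c := sc_sC _ _ c.
have Thalf : T half = half := TC _.
have Tf : T f = - f.
  apply: serP => i k; rewrite cfN cf_sc -mulrA -exprD -signr_odd.
  by have [od|ev] := boolP (odd (i + k)); rewrite ?expr1 ?mulrN1// f0// mul0r oppr0.
have TM : T (MM f) = MM (- f) by rewrite /MM (morphM cT) (morphD cT) Thalf Tpl Tf.
have TD : T (DD f) = DD (- f) by rewrite /DD (morphM cT) (morphB cT) Thalf Tpl Tf.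
have TE : T (EE a f) = - EE a f.
  rewrite -EE_odd// /EE (morphM cT) Thalf (morphB cT) (morphD cT) Tmi (morphD cT).
  rewrite /XX /YY !(morphM cT).
  rewrite !(@morph_cmp _ T cT _ _ (MM f) (MM_ord lam f1) (fun n => TC _)).
  by rewrite !(@morph_cmp _ T cT _ _ (DD f) (DD_ord lam f1) (fun n => TC _)) TM TD.
have /eqP := congr1 (fun F : ser K => F j l) TE.
rewrite cfN /T cf_sc -mulrA -exprD -signr_odd (negbTE jl) mulr1 -subr_eq0 opprK.
by rewrite -mulr2n mulrn_eq0 /= => /eqP.
Qed.

End Existence.

(** * Construction of the formal solution *)

Section Recursion.
Variable K : numClosedFieldType.
Variable lam : K.
Hypothesis lam_conj : lam^* = lam^-1.
Hypothesis lam0 : lam != 0.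
Hypothesis nonres : forall n, (0 < n)%N -> lam ^+ n != 1.
Implicit Types (f g h : ser K) (a b : fps1 K).

Local Notation EE := (EE lam).
Local Notation LL := (LL lam).
Local Notation q2 := (q2 lam).
Local Notation eigen := (eigen lam).
Local Notation mono := (@mono K).

(** The equation is linear in the support function; monoE k is its value on the
    monomial whose coefficient is determined in step k. *)
Definition monoE k : ser K := EE (mono k.*2.+4) (lin 1 1).

Definition next_coef k a f : K := - EE a f k.+2 k.+1 / monoE k k.+2 k.+1.

(** The support function cancels the equation at the resonant monomials, the new
    terms of phi cancel it at the others. *)
Definition next_part k a f : ser K := Ser (fun j l =>
  if (j + l == k.*2.+3)%N && ~~ resonant j l
  then - (EE a f j l + next_coef k a f * monoE k j l) / eigen j l else 0).

Definition next k (p : fps1 K * ser K) : fps1 K * ser K :=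
  (fun i => if i == k.*2.+4 then next_coef k p.1 p.2 else p.1 i,
   p.2 + next_part k p.1 p.2).

Fixpoint approx k : fps1 K * ser K :=
  if k is k'.+1 then next k' (approx k')
  else (fun i => (i == 0%N)%:R + q2 * (i == 2)%:R, lin 1 1).

(** The properties of a solution that the recursion propagates; the last three
    make the next coefficients symmetric and real. *)
Record normal_form a f : Prop := NormalForm {
  nf_a_odd : forall i, odd i -> a i = 0;
  nf_a0 : a 0%N = 1;
  nf_a2 : a 2%N = q2;
  nf_f_even : forall j l, ~~ odd (j + l)%N -> f j l = 0;
  nf_f10 : f 1%N 0%N = 1;
  nf_f01 : f 0%N 1%N = 1;
  nf_f_res : forall i, f i.+2 i.+1 = 0;
  nf_f_sym : forall j l, f j l = f l j;
  nf_f_conj : forall j l, (f j l)^* = f j l;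
  nf_a_conj : forall i, (a i)^* = a i }.

Lemma nf_ord a f : normal_form a f -> ord 1 f.
Proof. by move=> nf; apply/ord1P; rewrite (nf_f_even nf). Qed.

Lemma nf_ord2 a f : normal_form a f -> ord 2 (f - lin 1 1).
Proof.
move=> nf [|[|j]] [|[|l]]; rewrite // => _; rewrite cfB.
- by rewrite (nf_f_even nf)// subrr.
- by rewrite (nf_f01 nf) subrr.
- by rewrite (nf_f10 nf) subrr.
Qed.

Lemma nf_conj_a : forall i, (((i == 0%N)%:R + q2 * (i == 2)%:R : K))^* = (i == 0%N)%:R + q2 * (i == 2)%:R.
Proof. by move=> i; rewrite rmorphD rmorphM /= q2_conj// !rmorph_nat. Qed.

(** The approximations are polynomials with the equation satisfied modulo order
    2k + 2. *)
Record approx_spec k a f : Prop := ApproxSpec {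
  ap_nf : normal_form a f;
  ap_a_top : forall i, (k.*2.+2 < i)%N -> a i = 0;
  ap_f_top : forall j l, (k.*2.+1 < j + l)%N -> f j l = 0;
  ap_E : ord k.*2.+2 (EE a f) }.

Lemma monoE_sym k j l : monoE k j l = monoE k l j.
Proof.
apply: EE_swap => //; first exact: lin_ord.
by move=> [|[|j']] [|[|l']].
Qed.
Lemma monoE_conj k j l : (monoE k j l)^* = monoE k j l.
Proof.
apply: EE_conj => //; first exact: lin_ord.
  by move=> [|[|j']] [|[|l']]; rewrite /= /fps2_lin /= ?rmorph0 ?rmorph1.
by move=> n; rewrite rmorph_nat.
Qed.
Lemma monoE_neq0 k : monoE k k.+2 k.+1 != 0.
Proof.
have H : ord k.+1.*2.+2 (monoE k - pure lam k.+1.*2.+1).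
  by apply: EE_mono; [exact: lin_ord | rewrite subrr].
by rewrite (ord_cf H) ?pure_neq0// addSn addnn.
Qed.

Lemma LL_ord a f h n : ord n h -> ord n (LL a f h).
Proof.
move=> hn; rewrite LLE//; apply: ordD; last by apply: mi_ord; exact: ordMr.
by apply: ordD; apply: ordMr => //; exact: pl_ord.
Qed.

Lemma approx0 : approx_spec 0 (approx 0).1 (approx 0).2.
Proof.
have nf : normal_form (approx 0).1 (approx 0).2.
  split => /=.
  - by move=> [|[|[|i]]] //= _; rewrite !mulr0 addr0.
  - by rewrite mulr0 addr0.
  - by rewrite mulr1 add0r.
  - by move=> [|[|j]] [|[|l]].
  - by [].
  - by [].
  - by [].
  - by move=> [|[|j]] [|[|l]].
  - by move=> [|[|j]] [|[|l]]; rewrite /fps2_lin /= ?rmorph0 ?rmorph1.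
  - exact: nf_conj_a.
split => //.
- by move=> [|[|[|i]]] //= _; rewrite mulr0 addr0.
- by move=> [|[|j]] [|[|l]].
move: (approx 0).1 (approx 0).2 nf (erefl : (approx 0).2 = lin 1 1) => a f nf fE.
have E0 : EE a 0 = 0.
  have := EE_odd lam (@ord_zero K 1) (nf_a_odd nf); rewrite oppr0 => /eqP.
  rewrite -addr_eq0 => /eqP e; apply: serP => j l.
  have /eqP := congr1 (fun F : ser K => F j l) e.
  by rewrite cfD -mulr2n mulrn_eq0 => /eqP.
have /= T := EE_taylor lam a (@ord_zero K 1) (isT : (0 < 1)%N) (nf_ord nf).
rewrite add0r E0 subr0 in T => j l jl; rewrite (ord_cf T jl).
have [jl1|jl0] := ltnP 0 (j + l); last by rewrite (LL_ord a 0 (nf_ord nf)).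
rewrite (LL_lead lam0 nonres _ (nf_a0 nf) (nf_a2 nf) (nf_ord nf)); last by apply/eqP; rewrite eqn_leq jl1 -ltnS jl.
rewrite eigen_res ?mul0r// /resonant.
by case: j l jl jl1 => [|[|j]] [|[|l]].
Qed.

(** In the new degree the equation changes by the eigenvalue times the new part
    of phi plus the multiple of monoE by the new coefficient of the support
    function; the increments are chosen so that this cancels the error.  Even
    degrees need nothing, by parity. *)
Lemma approxS k a f : approx_spec k a f ->
  approx_spec k.+1 (next k (a, f)).1 (next k (a, f)).2.
Proof.
case=> nf at_ ft eE; rewrite /next /=.
set c := next_coef k a f; set h := next_part k a f.
have f1 := nf_ord nf.
have hn : ord k.*2.+3 h by move=> j l jl /=; case: eqP => [e|//]; rewrite e ltnn in jl.
have kn2 : (k.*2.+4 == 2) = false by [].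
have hE j l : h j l = if (j + l == k.*2.+3)%N && ~~ resonant j l
  then - (EE a f j l + c * monoE k j l) / eigen j l else 0 by [].
have h_res j l : resonant j l -> h j l = 0 by rewrite hE => ->; rewrite andbF.
have Esym j l : EE a f j l = EE a f l j := EE_swap lam0 a j l f1 (nf_f_sym nf).
have Econj j l : (EE a f j l)^* = EE a f j l := EE_conj lam_conj lam0 j l f1 (nf_f_conj nf) (nf_a_conj nf).
have cconj : c^* = c by rewrite /c /next_coef rmorphM fmorphV /= rmorphN /= Econj monoE_conj.
have nf' : normal_form (fun i => if i == k.*2.+4 then c else a i) (f + h).
  split.
  - by move=> i oi; case: eqP oi => [->|_ oi]; rewrite ?(nf_a_odd nf)//= odd_double.
  - exact: (nf_a0 nf).
  - exact: (nf_a2 nf).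
  - move=> j l jl; rewrite cfD (nf_f_even nf)// add0r hE; case: eqP => // e.
    by rewrite e /= odd_double in jl.
  - by rewrite cfD (nf_f10 nf) h_res// addr0.
  - by rewrite cfD (nf_f01 nf) h_res// addr0.
  - by move=> i; rewrite cfD (nf_f_res nf) h_res ?addr0// /resonant eqxx.
  - move=> j l; rewrite !cfD (nf_f_sym nf) !hE addnC [resonant j l]orbC.
    by rewrite Esym monoE_sym eigenC.
  - move=> j l; rewrite cfD rmorphD; congr (_ + _); first exact: (nf_f_conj nf).
    rewrite !hE; case: ifP => _; last by rewrite rmorph0.
    by rewrite rmorphM fmorphV /= rmorphN rmorphD rmorphM /= cconj Econj monoE_conj eigen_conj.
  - by move=> i; case: ifP => // _; exact: (nf_a_conj nf).
split => //.
- move=> i; rewrite doubleS => ki; rewrite gtn_eqF//.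
  by apply: at_; rewrite (leq_trans _ ki)// ltnS; lia.
- move=> j l; rewrite doubleS => jl; rewrite cfD ft ?add0r; last by apply: leq_trans jl; lia.
  by rewrite hE gtn_eqF.
have aE : (fun i => if i == k.*2.+4 then c else a i) =1 (fun i => a i + c * mono k.*2.+4 i).
  move=> i; rewrite /mono; case: eqP => [->|_]; rewrite ?mulr0 ?addr0//.
  by rewrite at_ ?add0r ?mulr1.
have H : ord k.*2.+4 (EE (fun i => if i == k.*2.+4 then c else a i) (f + h)
    - (EE a f + LL a f h + sC c * monoE k)).
  rewrite (EE_ext _ _ aE) EED EEZ; apply: ordBD.
    rewrite opprD addrA; apply: ordW (EE_taylor lam a f1 _ hn) => //.
    by rewrite -addnn; lia.
  apply: ordBM; first exact: ord_refl.
  have A := @EE_mono _ lam k.*2.+3 _ (nf_ord nf') (nf_ord2 nf').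
  have B : ord k.*2.+4 (monoE k - pure lam k.*2.+3).
    by apply: EE_mono => //; [exact: lin_ord | rewrite subrr].
  by apply: ord_trans A _; exact: ord_sym.
move=> j l jl; rewrite doubleS in jl; rewrite (ord_cf H jl) !cfD [(sC c * _) j l]cf_sCM.
have [jln|jln] := ltnP (j + l) k.*2.+3.
  rewrite (LL_ord a f hn)// addr0 [EE a f j l](_ : _ = 0); last first.
    move: jln; rewrite ltnS leq_eqVlt => /orP[/eqP jlk|]; last exact: eE.
    by apply: EE_parity => //; [exact: (nf_a_odd nf)|exact: (nf_f_even nf)|rewrite jlk /= negbK odd_double].
  rewrite (_ : monoE k j l = 0) ?mulr0 ?addr0//.
  apply: (@EE_ord _ lam _ _ k.*2.+3) => //; first exact: lin_ord.
  by move=> i ik; rewrite /mono ltn_eqF.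
have {}jl : (j + l = k.*2.+3)%N by apply/eqP; rewrite eqn_leq jln -ltnS jl.
rewrite (LL_lead lam0 nonres _ (nf_a0 nf) (nf_a2 nf) hn jl).
have [r|r] := boolP (resonant j l); last first.
  rewrite hE jl eqxx r /= mulrC divfK ?eigen_neq0//; ring.
rewrite eigen_res// mul0r addr0.
have E1 : EE a f k.+2 k.+1 + c * monoE k k.+2 k.+1 = 0.
  by rewrite /c /next_coef divfK ?monoE_neq0// subrr.
have E2 : EE a f k.+1 k.+2 + c * monoE k k.+1 k.+2 = 0.
  by rewrite [monoE k k.+1 k.+2]monoE_sym [EE a f k.+1 k.+2]Esym.
move: r; rewrite /resonant => /orP[/eqP e|/eqP e].
  by have [-> ->] : l = k.+1 /\ j = k.+2 by lia.
by have [-> ->] : l = k.+2 /\ j = k.+1 by lia.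
Qed.

Lemma approxP k : approx_spec k (approx k).1 (approx k).2.
Proof.
elim: k => [|k IH]; first exact: approx0.
by move: IH => /=; case: (approx k) => a f /= /approxS.
Qed.

Lemma approx_stable k m : (k <= m)%N ->
  (forall i, (i <= k.*2.+2)%N -> (approx m).1 i = (approx k).1 i) /\
  (forall j l, (j + l <= k.*2.+1)%N -> (approx m).2 j l = (approx k).2 j l).
Proof.
elim: m => [|m IH]; first by rewrite leqn0 => /eqP ->.
rewrite leq_eqVlt => /orP[/eqP ->//|]; rewrite ltnS => km.
have [IHa IHf] := IH km; split.
  move=> i ik /=; rewrite ltn_eqF ?IHa//; apply: leq_ltn_trans ik _.
  by rewrite -!addnn; lia.
move=> j l jl; rewrite cfD IHf// /next_part /= ltn_eqF ?addr0//.
by apply: leq_ltn_trans jl _; rewrite -!addnn; lia.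
Qed.

Definition sol_a : fps1 K := fun i => (approx i).1 i.
Definition sol_f : ser K := Ser (fun j l => (approx (j + l)).2 j l).

Lemma sol_aE k i : (i <= k.*2.+2)%N -> sol_a i = (approx k).1 i.
Proof.
move=> ik; have [le|/ltnW le] := leqP i k.
  by rewrite /sol_a -(proj1 (approx_stable le)) // -addnn; lia.
by rewrite /sol_a (proj1 (approx_stable le)).
Qed.

Lemma sol_fE k j l : (j + l <= k.*2.+1)%N -> sol_f j l = (approx k).2 j l.
Proof.
move=> ik; rewrite /sol_f /=; have [le|/ltnW le] := leqP (j + l) k.
  by rewrite -(proj2 (approx_stable le)) // -addnn; lia.
by rewrite (proj2 (approx_stable le)).
Qed.

Lemma formal_solution : normal_form sol_a sol_f /\ EE sol_a sol_f = 0.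
Proof.
have nf : normal_form sol_a sol_f.
  split.
  - by move=> i; exact: (nf_a_odd (ap_nf (approxP i))).
  - exact: (nf_a0 (ap_nf (approxP 0))).
  - exact: (nf_a2 (ap_nf (approxP 2))).
  - by move=> j l; exact: (nf_f_even (ap_nf (approxP (j + l)))).
  - exact: (nf_f10 (ap_nf (approxP 1))).
  - exact: (nf_f01 (ap_nf (approxP 1))).
  - by move=> i; exact: (nf_f_res (ap_nf (approxP (i.+2 + i.+1))) i).
  - by move=> j l; rewrite /sol_f /= addnC; exact: (nf_f_sym (ap_nf (approxP (l + j)))).
  - by move=> j l; exact: (nf_f_conj (ap_nf (approxP (j + l)))).
  - by move=> i; exact: (nf_a_conj (ap_nf (approxP i))).
split => //; apply: serP => j l.
set k := (j + l)%N; have [nfk _ _ Ek] := approxP k.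
have jk : (j + l < k.*2.+2)%N by rewrite -/k -addnn; lia.
rewrite cf0 -[RHS](Ek _ _ jk); apply: (@ord_cf _ k.*2.+2) => //.
have aE : sol_a =1 (fun i => (approx k).1 i + (sol_a i - (approx k).1 i)).
  by move=> i; rewrite addrC subrK.
rewrite (EE_ext _ _ aE) EED addrAC; apply: ordD.
  apply: EE_cong (nf_ord nf) (nf_ord nfk) _ => i m im.
  by rewrite cfB -sol_fE ?subrr.
apply: EE_ord (nf_ord nf) _ => i ik.
by rewrite -sol_aE ?subrr.
Qed.
End Recursion.

(** * The Casoratian identities *)

Section Diag.
Variable K : fieldType.
Implicit Types f g h : ser K.

Definition tr n f : ser K := Ser (fun j l => if (j + l < n)%N then f j l else 0).

Lemma tr_ord n f : ord n (f - tr n f).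
Proof. by move=> j l jl; rewrite cfB /= jl subrr. Qed.
Lemma tr_cf n f j l : (j + l < n)%N -> tr n f j l = f j l.
Proof. by rewrite /= => ->. Qed.
Lemma tr_cf0 n f j l : (n <= j + l)%N -> tr n f j l = 0.
Proof. by rewrite /= ltnNge => ->. Qed.
Lemma ord_tr m n f : ord m f -> ord m (tr n f).
Proof. by move=> fm j l jl /=; rewrite fm// if_same. Qed.

Definition diagonal g := forall j l, j != l -> g j l = 0.

(** A factor depending on the product of the variables only preserves the
    difference of exponents, so of a series without higher resonant terms only
    the linear one contributes. *)
Lemma cfM_diag f g m : (forall i, f i.+2 i.+1 = 0) -> diagonal g ->
  (f * g) m.+1 m = f 1%N 0%N * g m m.
Proof.
move=> f0 gd; have h1 : (1 < m.+2)%N by [].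
rewrite cfM (bigD1 (Ordinal h1))//= (bigD1 ord0)//= subn1 subn0 /=.
rewrite [X in _ + X + _]big1 ?addr0 => [|[[|l] lm] //= _]; last first.
  by rewrite gd ?mulr0// neq_ltn; apply/orP; right; lia.
rewrite big1 ?addr0// => -[i im] /= i1; rewrite big1// => -[l lm] _ /=.
have [e|e] := eqVneq (m.+1 - i)%N (m - l)%N; last by rewrite gd ?mulr0.
have il : i = l.+1 by lia.
rewrite il; case: l {lm e} il => [|l] il; first by move: i1; rewrite -val_eqE /= il eqxx.
by rewrite f0 mul0r.
Qed.

Lemma cfM_diag' f g m : (forall i, f i.+1 i.+2 = 0) -> diagonal g ->
  (f * g) m m.+1 = f 0%N 1%N * g m m.
Proof.
move=> f0 gd; rewrite -[LHS]/(swap (f * g) m.+1 m) (morphM (@swap_morph K)).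
by rewrite cfM_diag// => j l jl; rewrite /= gd// eq_sym.
Qed.
End Diag.

Section Newton.
Variable K : numClosedFieldType.
Variable lam : K.
Hypothesis lam0 : lam != 0.
Hypothesis nonres : forall n, (0 < n)%N -> lam ^+ n != 1.
Implicit Types (f g h : ser K) (a b : fps1 K).

Local Notation EE := (EE lam).
Local Notation LL := (LL lam).
Local Notation bet := (bet lam).
Local Notation pl := (pl lam).
Local Notation mi := (mi lam).

(** In polar coordinates z = r e^(i s), zb = r e^(-i s) these are -i d/ds and
    r d/dr. *)
Definition ang f := eul (fun j l => j%:R - l%:R) f.
Definition rad f := eul (fun j l => j%:R + l%:R) f.

Lemma ang_der : derivation ang.
Proof. by apply: eul_der => *; rewrite !natrD; ring. Qed.
Lemma rad_der : derivation rad.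
Proof. by apply: eul_der => *; rewrite !natrD; ring. Qed.

(** The discrete Wronskian of a second order difference operator with leading
    coefficient b. *)
Definition casoratian (b : ser K) g h : ser K := b * (g * pl h - pl g * h).

(** The discrete Green formula: the zeroth order coefficient of the operator
    drops out by antisymmetry. *)
Lemma green a f g h : casoratian (bet a f) g h - mi (casoratian (bet a f) g h) =
  g * LL a f h - h * LL a f g.
Proof.
rewrite !LLE// /casoratian !(miM lam, miD lam, miN lam) !mipl//.
move: (bet a f) (alp lam a f) => b c; ring.
Qed.

Lemma casoratian_ord (b : ser K) g h m n : ord m g -> ord n h -> ord (m + n) (casoratian b g h).
Proof.
move=> gm hn; apply: ordMr; apply: ordB; apply: ordM => //; exact: pl_ord.
Qed.

Lemma mi_diag f j : (mi f) j j = f j j.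
Proof. by rewrite cf_mi -mulrA -exprMn mulVf// expr1n mulr1. Qed.

Variables (a : fps1 K) (f : ser K).
Hypothesis nf : normal_form lam a f.
Hypothesis E0 : EE a f = 0.
Let f1 : ord 1 f. Proof. exact: nf_ord nf. Qed.

Lemma LL_ang : LL a f (ang f) = 0.
Proof. by rewrite -EE_der ?E0 ?(der0 ang_der)//; [exact: ang_der | move=> *; exact: eul_sc]. Qed.
Lemma LL_rad : LL a f (rad f) = 0.
Proof. by rewrite -EE_der ?E0 ?(der0 rad_der)//; [exact: rad_der | move=> *; exact: eul_sc]. Qed.

Definition wronskian := casoratian (bet a f) (ang f) (rad f).

(** Green's formula makes it invariant under the rotation, and the rotation is
    not a root of unity. *)
Lemma wronskian_diag : diagonal wronskian.
Proof.
move=> j l jl; have : wronskian - mi wronskian = 0.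
  by rewrite green LL_ang LL_rad !mulr0 subrr.
move=> /(congr1 (fun F : ser K => F j l)); rewrite cfB cf_mi => /eqP.
rewrite subr_eq0 => /eqP e.
apply/eqP; apply: contraT => w0; move: jl => /eqP; case.
have {}e : 1 = lam^-1 ^+ j * lam ^+ l.
  by apply: (mulfI w0); rewrite mulr1 {1}e mulrA.
apply: (lam_expI lam0 nonres).
have lj : lam ^+ j != 0 by rewrite expf_neq0.
by rewrite -[LHS]mulr1 e mulrA -exprMn mulfV// expr1n mul1r.
Qed.

(** Variation of constants: three vectors (h, h^+) of a plane are dependent. *)
Lemma wronskianM h : h * wronskian =
  rad f * casoratian (bet a f) (ang f) h - ang f * casoratian (bet a f) (rad f) h.
Proof. by rewrite /wronskian /casoratian; move: (bet a f) (pl h) (pl _) (pl _) => *; ring. Qed.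

(** One step of the estimates, for the terms of degree 2k + 1.  The series lo
    consists of the terms of phi below about half of that degree and hi of the
    others; ft is a truncation at nearly the same degree as lo: what has to be kept
    of phi in factors multiplying a tail. *)

Variable k : nat.
Hypothesis k_gt0 : (0 < k)%N.

Definition lo := tr (uphalf k).*2.+1 f.
Definition hi := f - lo.
Definition ft := tr k./2.*2.+2 f.

Let k_split : (uphalf k + k./2 = k)%N.
Proof. by rewrite uphalf_half -[RHS]odd_double_half -addnn addnA. Qed.

Lemma lo_ord : ord 1 lo. Proof. exact: ord_tr. Qed.
Lemma hi_ord : ord (uphalf k).*2.+1 hi. Proof. exact: tr_ord. Qed.
Lemma ft_ord : ord 1 ft. Proof. exact: ord_tr. Qed.

(** Newton's identity: since the equation vanishes at lo + hi, its value at lo is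
    minus the linearised operator at hi, up to twice the order of hi. *)
Lemma EE_lo : ord k.*2.+2 (EE a lo + LL a f hi).
Proof.
have hN := ordN hi_ord.
have := EE_taylor lam a f1 (isT : (0 < (uphalf k).*2.+1)%N) hN.
have -> : f + - hi = lo by rewrite /hi opprB addrC subrK.
rewrite E0 subr0 => T.
have -> : LL a f hi = - LL a f (- hi).
  rewrite !LLE// (morphN (pl_morph lam)) !mulrN (miN lam); ring.
by apply: ordW T; move: k_split; rewrite -!addnn; lia.
Qed.

Lemma EE_lo_ord : ord (uphalf k).*2.+1 (EE a lo).
Proof.
rewrite -[EE a lo](addrK (LL a f hi)); apply: ordB; last exact: LL_ord hi_ord.
by apply: ordW EE_lo; move: k_split; rewrite -!addnn; lia.
Qed.

Lemma eul_tr w n g : eul w (tr n g) = tr n (eul w g).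
Proof. by apply: serP => j l /=; case: ifP => //; rewrite mulr0. Qed.

Lemma ang_ft : ord k./2.*2.+2 (ang f - ang ft).
Proof. by rewrite /ang eul_tr; exact: tr_ord. Qed.
Lemma rad_ft : ord k./2.*2.+2 (rad f - rad ft).
Proof. by rewrite /rad eul_tr; exact: tr_ord. Qed.
Lemma ang_ord : ord 1 (ang f). Proof. exact: eul_ord. Qed.
Lemma rad_ord : ord 1 (rad f). Proof. exact: eul_ord. Qed.

(** Green's formula for the tail and the two kernel elements, with the linearised
    operator expressed by the equation at lo.  As the latter vanishes to high
    order, the kernel elements in front of it may be truncated. *)
Lemma cas_ang : ord k.*2.+3 (casoratian (bet a f) (ang f) hi
   - mi (casoratian (bet a f) (ang f) hi) + ang ft * EE a lo).
Proof.
rewrite green LL_ang mulr0 subr0.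
rewrite (_ : _ + _ = ang f * (EE a lo + LL a f hi) - (ang f - ang ft) * EE a lo); last by ring.
apply: ordB; first by rewrite -[k.*2.+3]add1n; apply: ordM ang_ord EE_lo.
apply: ordW (ordM ang_ft EE_lo_ord); move: k_split; rewrite -!addnn; lia.
Qed.
Lemma cas_rad : ord k.*2.+3 (casoratian (bet a f) (rad f) hi
   - mi (casoratian (bet a f) (rad f) hi) + rad ft * EE a lo).
Proof.
rewrite green LL_rad mulr0 subr0.
rewrite (_ : _ + _ = rad f * (EE a lo + LL a f hi) - (rad f - rad ft) * EE a lo); last by ring.
apply: ordB; first by rewrite -[k.*2.+3]add1n; apply: ordM rad_ord EE_lo.
apply: ordW (ordM rad_ft EE_lo_ord); move: k_split; rewrite -!addnn; lia.
Qed.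

(** On the diagonal the rotation acts trivially, so the Casoratian, and with it the
    unknown tail, drops out of cas_rad. *)
Lemma rad_EE_diag : (rad ft * EE a lo) k.+1 k.+1 = 0.
Proof.
have := @cas_rad k.+1 k.+1; rewrite cfD cfB mi_diag subrr add0r; apply.
by rewrite addSn addnS addnn.
Qed.

Lemma cas_ang_ord : ord (uphalf k).*2.+2 (casoratian (bet a f) (ang f) hi).
Proof. by rewrite -[(_).+2]add1n; apply: casoratian_ord ang_ord hi_ord. Qed.
Lemma cas_rad_ord : ord (uphalf k).*2.+2 (casoratian (bet a f) (rad f) hi).
Proof. by rewrite -[(_).+2]add1n; apply: casoratian_ord rad_ord hi_ord. Qed.

Lemma wronskian_ft : ord k./2.*2.+3
  (wronskian - casoratian (bet a ft) (ang ft) (rad ft)).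
Proof.
have a1 : ord 1 (ang ft) by apply: eul_ord; exact: ft_ord.
have r1 : ord 1 (rad ft) by apply: eul_ord; exact: ft_ord.
set u := ang f; set v := rad f; set u' := ang ft; set v' := rad ft.
have bb : ord k./2.*2.+2 (bet a f - bet a ft).
  have ff := @tr_ord K k./2.*2.+2 f.
  apply: ordBM; first exact: ord_refl.
  apply: ordBM; [apply: ordBD|]; apply: cmp_cong; rewrite -?MMB -?DDB;
    solve [exact: MM_ord | exact: DD_ord | exact: MM_ord ft_ord | exact: DD_ord ft_ord].
rewrite /wronskian /casoratian -/u -/v.
rewrite (_ : _ - _ = (bet a f - bet a ft) * (u * pl v - pl u * v) +
   bet a ft * ((u - u') * pl v + u' * pl (v - v') - pl (u - u') * v - pl u' * (v - v'))).
  apply: ordD; first by rewrite -[_.+3]addn1; apply: ordM bb _;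
     apply: ordB; apply: ordMl => //; [exact: ang_ord | exact: pl_ord ang_ord].
  apply: ordMr; rewrite -[_.+3]addn1; apply: ordB; [apply: ordB; [apply: ordD|]|].
  - by apply: ordM ang_ft _; exact: pl_ord rad_ord.
  - by rewrite addnC; apply: ordM => //; apply: pl_ord; exact: rad_ft.
  - by apply: ordM rad_ord; apply: pl_ord; exact: ang_ft.
  - by rewrite addnC; apply: ordM rad_ft; exact: pl_ord.
by rewrite !(plB lam); move: (bet a f) (bet a ft) (pl _) (pl _) (pl _) (pl _) => *; ring.
Qed.

(** The identity wronskianM for the tail, where now every factor multiplying an
    unknown series is computed from low degrees.  One division by the Wronskian
    replaces the repeated divisions by the eigenvalues. *)
Lemma tail_identity : ord k.*2.+4
  (hi * casoratian (bet a ft) (ang ft) (rad ft) -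
   (rad ft * casoratian (bet a f) (ang f) hi - ang ft * casoratian (bet a f) (rad f) hi)).
Proof.
set B := casoratian _ (ang f) hi; set A := casoratian _ (rad f) hi.
set Wt := casoratian _ _ _.
rewrite (_ : _ - _ = (rad f - rad ft) * B - (ang f - ang ft) * A - hi * (wronskian - Wt)).
  apply: ordB; first apply: ordB.
  - apply: ordW (ordM rad_ft cas_ang_ord); move: k_split; rewrite -!addnn; lia.
  - apply: ordW (ordM ang_ft cas_rad_ord); move: k_split; rewrite -!addnn; lia.
  - apply: ordW (ordM hi_ord wronskian_ft); move: k_split; rewrite -!addnn; lia.
rewrite mulrBr wronskianM -/A -/B; ring.
Qed.

Lemma hi_res i : hi i.+1 i = 0.
Proof.
rewrite cfB /lo; case: i => [|i].
  by rewrite tr_cf ?subrr//; move: k_gt0; rewrite uphalf_half; move: k_split; rewrite -addnn; lia.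
by rewrite /= (nf_f_res nf) if_same subrr.
Qed.

Lemma sym_res i : f i.+1 i.+2 = 0.
Proof. by rewrite (nf_f_sym nf) (nf_f_res nf). Qed.

Lemma hi_res' i : hi i i.+1 = 0.
Proof.
rewrite -(hi_res i) !cfB /lo /= (nf_f_sym nf) addnC.
by case: ifP.
Qed.

Lemma tail_res_exact m :
  (hi * wronskian) m.+1 m = 0 /\ (hi * wronskian) m m.+1 = 0.
Proof.
split; first by rewrite (cfM_diag _ (fun i => hi_res i.+1) wronskian_diag) hi_res mul0r.
by rewrite (cfM_diag' _ (fun i => hi_res' i.+1) wronskian_diag) hi_res' mul0r.
Qed.

(** By the normalisation the tail has no resonant terms, which yields two linear
    relations between the diagonal parts of the two Casoratians and the rest. *)
Lemma tail_res m : (m <= k.+1)%N ->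
  let T := rad ft * casoratian (bet a f) (ang f) hi - ang ft * casoratian (bet a f) (rad f) hi in
  T m.+1 m = 0 /\ T m m.+1 = 0.
Proof.
move=> mk T; have [w1 w2] := tail_res_exact m.
have H : ord k.*2.+4 (hi * wronskian - T).
  rewrite -[T](subrKA 0) -[hi * _](subrK (hi * casoratian (bet a ft) (ang ft) (rad ft))).
  rewrite subr0 add0r -addrA; apply: ordD; last exact: tail_identity.
  rewrite -mulrBr; apply: ordW (ordM hi_ord wronskian_ft); move: k_split; rewrite -!addnn; lia.
by split; [rewrite -[RHS]w1 | rewrite -[RHS]w2]; apply/esym; apply: (ord_cf H); rewrite -addnn; lia.
Qed.

End Newton.

(** * Norms of power series *)

Lemma ler_of_eq (R : realFieldType) (x y : R) : x = y -> x <= y.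
Proof. by move=> ->. Qed.

Section Sums.
Variable R : realFieldType.
Implicit Types (x y : nat -> R) (F : nat -> nat -> R).

Lemma triangle_sum (V : nmodType) (F : nat -> nat -> V) N :
  \sum_(n < N) \sum_(i < n.+1) F i (n - i)%N = \sum_(i < N) \sum_(b < N - i) F i b.
Proof.
elim: N => [|N IH]; first by rewrite !big_ord0.
rewrite big_ord_recr /= IH [RHS]big_ord_recr /= subSnn big_ord1.
rewrite [X in _ + X]big_ord_recr /= subnn addrA; congr (_ + _).
rewrite -big_split; apply: eq_bigr => -[i iN] _ /=.
by rewrite subSn 1?ltnW// big_ord_recr.
Qed.

Lemma ler_sum_widen x n m : (forall i, 0 <= x i) -> (n <= m)%N ->
  \sum_(i < n) x i <= \sum_(i < m) x i.
Proof.
move=> x0 nm; rewrite -(subnKC nm) big_split_ord /= lerDl.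
by apply: sumr_ge0.
Qed.

Lemma cauchy_product x y N : (forall i, 0 <= x i) -> (forall i, 0 <= y i) ->
  \sum_(n < N) \sum_(i < n.+1) x i * y (n - i)%N <= (\sum_(i < N) x i) * \sum_(i < N) y i.
Proof.
move=> x0 y0; rewrite (triangle_sum (fun i b => x i * y b)) mulr_suml.
apply: ler_sum => i _; rewrite -mulr_sumr ler_wpM2l//.
by apply: ler_sum_widen => //; exact: leq_subr.
Qed.

End Sums.

(** The norm of a complex number is itself a complex number; estimates are made
    with the modulus as an element of the real field. *)
Record absval (K : fieldType) (R : realFieldType) := AbsVal {
  av :> K -> R;
  av_ge0 : forall x, 0 <= av x;
  av_nat : forall n : nat, av n%:R = n%:R;
  avN : forall x, av (- x) = av x;
  avM : forall x y, av (x * y) = av x * av y;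
  avD : forall x y, av (x + y) <= av x + av y }.

Section Norm.
Variables (K : fieldType) (R : realFieldType) (A : absval K R).
Implicit Types f g h : ser K.

Lemma av0 : A 0 = 0. Proof. exact: (av_nat A 0). Qed.
Lemma av1 : A 1 = 1. Proof. exact: (av_nat A 1). Qed.
Lemma avX x n : A (x ^+ n) = A x ^+ n.
Proof. by elim: n => [|n IH]; rewrite ?av1// !exprS avM IH. Qed.
Lemma av_sum (I : Type) (r : seq I) (P : pred I) (F : I -> K) :
  A (\sum_(i <- r | P i) F i) <= \sum_(i <- r | P i) A (F i).
Proof.
elim/big_rec2: _ => [|i y x _ IH]; first by rewrite av0.
by apply: le_trans (avD _ _ _) _; rewrite lerD2l.
Qed.
Lemma avMn x n : A (x *+ n) = A x *+ n.
Proof. by rewrite -mulr_natr avM av_nat mulr_natr. Qed.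
Lemma avV x : x != 0 -> A x^-1 = (A x)^-1.
Proof.
move=> x0; have e : A x * A x^-1 = 1 by rewrite -avM mulfV// av1.
have Ax : A x != 0 by apply/eqP => e0; move: e; rewrite e0 mul0r => /eqP; rewrite eq_sym oner_eq0.
by apply: (mulfI Ax); rewrite e mulfV.
Qed.

Definition degN n f := \sum_(j < n.+1) A (f j (n - j)%N).
(** The l1 norm of the terms of degree at most n, at the radius t.  Cutting off the
    degree makes it finite for divergent series, and it stays submultiplicative. *)
Definition nrm n t f := \sum_(i < n.+1) degN i f * t ^+ i.

Lemma nrmE n t f : nrm n t f = \sum_(i < n.+1) degN i f * t ^+ i.
Proof. by []. Qed.

Lemma degN_ge0 n f : 0 <= degN n f.
Proof. by apply: sumr_ge0 => i _; exact: av_ge0. Qed.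
Lemma degND n f g : degN n (f + g) <= degN n f + degN n g.
Proof. by rewrite -big_split; apply: ler_sum => i _; exact: avD. Qed.
Lemma degNN n f : degN n (- f) = degN n f.
Proof. by apply: eq_bigr => i _; rewrite cfN avN. Qed.
Lemma degNB n f g : degN n (f - g) <= degN n f + degN n g.
Proof. by apply: le_trans (degND _ _ _) _; rewrite degNN. Qed.
Lemma degNC c n f : degN n (sC c * f) = A c * degN n f.
Proof. by rewrite mulr_sumr; apply: eq_bigr => i _; rewrite cf_sCM avM. Qed.
Lemma eq_degN n f g : (forall j l, (j + l = n)%N -> f j l = g j l) -> degN n f = degN n g.
Proof. by move=> fg; apply: eq_bigr => i _; rewrite fg// subnKC// -ltnS. Qed.
Lemma degN_ord m n f : ord m f -> (n < m)%N -> degN n f = 0.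
Proof. by move=> fm nm; apply: big1 => -[i /= ni] _; rewrite fm ?av0// subnKC. Qed.
Lemma degN_cong m n f g : ord m (f - g) -> (n < m)%N -> degN n f = degN n g.
Proof. by move=> fg nm; apply: eq_degN => j l jl; apply: (ord_cf fg); rewrite jl. Qed.
Lemma av_le_degN j l f : A (f j l) <= degN (j + l) f.
Proof.
have jl : (j < (j + l).+1)%N by rewrite ltnS leq_addr.
rewrite /degN (bigD1 (Ordinal jl))//= addKn lerDl.
by apply: sumr_ge0 => i _; exact: av_ge0.
Qed.
Lemma av2_le_degN j l f : j != l -> A (f j l) + A (f l j) <= degN (j + l) f.
Proof.
move=> jl; have jn : (j < (j + l).+1)%N by rewrite ltnS leq_addr.
have ln : (l < (j + l).+1)%N by rewrite ltnS leq_addl.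
rewrite /degN (bigD1 (Ordinal jn))//= (bigD1 (Ordinal ln)) /=; last first.
  by rewrite -val_eqE /= eq_sym.
rewrite addKn addnK addrA lerDl.
by apply: sumr_ge0 => i _; exact: av_ge0.
Qed.

Section Radius.
Variable t : R.
Hypothesis t0 : 0 <= t.

Lemma nrm_ge0 n f : 0 <= nrm n t f.
Proof. by apply: sumr_ge0 => i _; rewrite mulr_ge0 ?degN_ge0 ?exprn_ge0. Qed.
Lemma nrmD n f g : nrm n t (f + g) <= nrm n t f + nrm n t g.
Proof.
rewrite -big_split; apply: ler_sum => i _.
by rewrite /= -mulrDl ler_wpM2r ?exprn_ge0 ?degND.
Qed.
Lemma nrmN n f : nrm n t (- f) = nrm n t f.
Proof. by apply: eq_bigr => i _; rewrite degNN. Qed.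
Lemma nrmB n f g : nrm n t (f - g) <= nrm n t f + nrm n t g.
Proof. by apply: le_trans (nrmD _ _ _) _; rewrite nrmN. Qed.
Lemma nrmC c n f : nrm n t (sC c * f) = A c * nrm n t f.
Proof. by rewrite mulr_sumr; apply: eq_bigr => i _; rewrite degNC mulrA. Qed.
Lemma nrm_cong n f g : ord n.+1 (f - g) -> nrm n t f = nrm n t g.
Proof. by move=> fg; apply: eq_bigr => -[i ni] _; rewrite (degN_cong fg). Qed.
Lemma nrm_widen m n f : (m <= n)%N -> nrm m t f <= nrm n t f.
Proof.
move=> mn; apply: (@ler_sum_widen _ (fun i => degN i f * t ^+ i)) => // i.
by rewrite mulr_ge0 ?degN_ge0 ?exprn_ge0.
Qed.
Lemma degN_le_nrm m n f : (m <= n)%N -> degN m f * t ^+ m <= nrm n t f.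
Proof.
move=> mn; rewrite /nrm (bigD1 (Ordinal (mn : (m < n.+1)%N)))//= lerDl.
by apply: sumr_ge0 => i _; rewrite mulr_ge0 ?degN_ge0 ?exprn_ge0.
Qed.
Lemma nrm_ord0 n f : ord n.+1 f -> nrm n t f = 0.
Proof. by move=> fn; apply: big1 => -[i ni] _; rewrite (degN_ord fn)// mul0r. Qed.
Lemma nrm_sum n (I : Type) (r : seq I) (P : pred I) (F : I -> ser K) :
  nrm n t (\sum_(i <- r | P i) F i) <= \sum_(i <- r | P i) nrm n t (F i).
Proof.
elim/big_rec2: _ => [|i y x _ IH].
  by rewrite nrm_ord0//; exact: ord_zero.
by apply: le_trans (nrmD _ _ _) _; rewrite lerD2l.
Qed.

Lemma nrm_tri n f : nrm n t f =
  \sum_(j < n.+1) \sum_(l < n.+1 - j) A (f j l) * t ^+ j * t ^+ l.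
Proof.
rewrite -(triangle_sum (fun j l => A (f j l) * t ^+ j * t ^+ l)); apply: eq_bigr => i _.
rewrite mulr_suml; apply: eq_bigr => -[j ji] _ /=.
by rewrite -mulrA -exprD subnKC.
Qed.

Lemma nrmM n f g : nrm n t (f * g) <= nrm n t f * nrm n t g.
Proof.
pose x (h : ser K) j l := A (h j l) * t ^+ j * t ^+ l.
have x0 h j l : 0 <= x h j l by rewrite !mulr_ge0 ?av_ge0 ?exprn_ge0.
pose X h j := \sum_(l < n.+1 - j) x h j l.
have X0 h j : 0 <= X h j by apply: sumr_ge0.
rewrite !nrm_tri; apply: le_trans (@cauchy_product _ (X f) (X g) n.+1 _ _) => //.
apply: ler_sum => j _.
apply: (@le_trans _ _ (\sum_(l < n.+1 - j) \sum_(i < j.+1) \sum_(m < l.+1) x f i m * x g (j - i)%N (l - m)%N)).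
  apply: ler_sum => l _; rewrite -mulrA cfM.
  apply: le_trans (ler_wpM2r _ (av_sum _ _ _)) _; first by rewrite mulr_ge0 ?exprn_ge0.
  rewrite mulr_suml; apply: ler_sum => i _.
  apply: le_trans (ler_wpM2r _ (av_sum _ _ _)) _; first by rewrite mulr_ge0 ?exprn_ge0.
  rewrite mulr_suml; apply: ler_sum => m _.
  rewrite avM /x -[in t ^+ j](@subnKC i j) -1?ltnS// -[in t ^+ l](@subnKC m l) -1?ltnS// !exprD.
  apply: ler_of_eq.
  by move: (A _) (A _) (t ^+ _) (t ^+ _) (t ^+ _) (t ^+ _) => *; ring.
rewrite exchange_big; apply: ler_sum => i _.
apply: le_trans (@cauchy_product _ (x f i) (x g (j - i)%N) (n.+1 - j) _ _) _ => //.
apply: ler_pM; try by apply: sumr_ge0.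
  by apply: ler_sum_widen => //; apply: leq_sub2l; rewrite -ltnS.
by apply: ler_sum_widen => //; apply: leq_sub2l; exact: leq_subr.
Qed.

Lemma nrm_sC n c : nrm n t (sC c) = A c.
Proof.
rewrite /nrm big_ord_recl [X in _ + X]big1 => [|i _]; last first.
  rewrite lift0 [degN _ _](_ : _ = 0) ?mul0r//; apply: big1 => -[j ji] _ /=.
  case: ifP => [/andP[/eqP -> //]|_]; last by rewrite av0.
by rewrite addr0 /= expr0 mulr1 /degN big_ord1.
Qed.
Lemma nrm1 n : nrm n t 1 = 1.
Proof. by rewrite -(rmorph1 (@sC K)) nrm_sC av1. Qed.

Lemma nrmX n f m : nrm n t (f ^+ m) <= nrm n t f ^+ m.
Proof.
elim: m => [|m IH]; first by rewrite !expr0 nrm1.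
rewrite !exprS; apply: le_trans (nrmM _ _ _) _.
by rewrite ler_wpM2l ?nrm_ge0.
Qed.

Lemma nrm_sc n u v f : A u = 1 -> A v = 1 -> nrm n t (sc u v f) = nrm n t f.
Proof.
move=> u1 v1; apply: eq_bigr => i _; congr (_ * _); apply: eq_bigr => j _.
by rewrite cf_sc !avM !avX u1 v1 !expr1n !mulr1.
Qed.

(** Powers are compared with the difference of the corresponding powers of
    numbers, which keeps a factor d that the triangle inequality would lose. *)
Lemma nrmXB n f g m y d : nrm n t g <= y -> nrm n t (f - g) <= d ->
  nrm n t (f ^+ m - g ^+ m) <= (y + d) ^+ m - y ^+ m.
Proof.
move=> gy fd; have y0 : 0 <= y by apply: le_trans gy; exact: nrm_ge0.
have d0 : 0 <= d by apply: le_trans fd; exact: nrm_ge0.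
elim: m => [|m IH]; first by rewrite !expr0 !subrr nrm_ord0//; exact: ord_zero.
rewrite !exprS (_ : f * _ - _ = (f - g) * f ^+ m + g * (f ^+ m - g ^+ m)); last by ring.
apply: le_trans (nrmD _ _ _) _.
apply: (@le_trans _ _ (d * (y + d) ^+ m + y * ((y + d) ^+ m - y ^+ m))); last first.
  by apply: ler_of_eq; ring.
apply: lerD; apply: le_trans (nrmM _ _ _) _; apply: ler_pM; rewrite ?nrm_ge0//.
apply: le_trans (nrmX _ _ _) _; apply: lerXn2r; rewrite ?nnegrE ?nrm_ge0 ?addr_ge0//.
by rewrite -(subrK g f) addrC; apply: le_trans (nrmD _ _ _) _; exact: lerD.
Qed.

End Radius.
End Norm.

Section CmpNorm.
Variables (K : numFieldType) (R : realFieldType) (A : absval K R).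
Implicit Types (f g : ser K) (b : fps1 K).
Local Notation nrm := (nrm A).

Lemma nrm_cmp n t b g G : 0 <= t -> ord 1 g -> nrm n t g <= G ->
  nrm n t (cmp b g) <= \sum_(i < n.+1) A (b i) * G ^+ i.
Proof.
move=> t0 g1 gG; rewrite (nrm_cong _ _ (cmp_trunc n.+1 b g1)).
apply: le_trans (nrm_sum _ t0 _ _ _ _) _; apply: ler_sum => i _.
rewrite nrmC ler_wpM2l ?av_ge0//; apply: le_trans (nrmX _ t0 _ _ _) _.
by apply: lerXn2r; rewrite ?nnegrE ?nrm_ge0// (le_trans _ gG) ?nrm_ge0.
Qed.

Lemma av_fcos i : A (fcos K i) <= i`!%:R^-1.
Proof.
rewrite /fcos /fps1_cos; case: ifP => _; first by rewrite av0 invr_ge0 ler0n.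
by rewrite avM avX avN av1 expr1n mul1r avV ?av_nat// pnatr_eq0 -lt0n fact_gt0.
Qed.

Lemma av_fsin i : A (fsin K i) <= i`!%:R^-1.
Proof.
rewrite /fsin avN /dfps1 avMn -[_ *+ i.+1]mulr_natr.
apply: le_trans (ler_wpM2r _ (av_fcos i.+1)) _ => //.
by rewrite factS natrM invfM mulrAC mulVf ?mul1r// pnatr_eq0.
Qed.

Lemma sum_invfact n : \sum_(i < n) (i.+2`!%:R)^-1 <= 1 :> R.
Proof.
suff H : \sum_(i < n) (i.+2`!%:R)^-1 <= 1 - 2 ^- n :> R.
  by apply: le_trans H _; rewrite gerBl invr_ge0 exprn_ge0.
elim: n => [|n IH]; first by rewrite big_ord0 expr0 invr1 subrr.
rewrite big_ord_recr /=; apply: le_trans (lerD IH (_ : _ <= 2 ^- n.+1)) _.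
  rewrite lef_pV2 ?posrE ?ltr0n ?fact_gt0 ?exprn_gt0// -natrX ler_nat.
  by elim: (n) => // m IHm; rewrite expnS factS; apply: leq_mul.
by rewrite exprS invfM; lra.
Qed.

(** The coefficients of cosine and sine are summable, so compositions with small
    inner series are as small as their first term. *)
Lemma nrm_cmp_tail n t b g eta p : 0 <= t -> ord 1 g -> nrm n t g <= eta -> eta <= 1 ->
  (forall i, A (b i) <= i`!%:R^-1) -> (1 < p)%N -> (forall i, (i < p)%N -> b i = 0) ->
  nrm n t (cmp b g) <= eta ^+ p.
Proof.
move=> t0 g1 ge e1 bi p1 b0; have e0 : 0 <= eta by apply: le_trans ge; exact: nrm_ge0.
apply: le_trans (nrm_cmp b t0 g1 ge) _.
apply: (@le_trans _ _ (eta ^+ p * \sum_(i < n.+1 | (1 < i)%N) i`!%:R^-1)).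
  rewrite mulr_sumr big_mkcond [X in _ <= X]big_mkcond /=; apply: ler_sum => i _.
  have [ip|ip] := ltnP i p.
    by rewrite b0// av0 mul0r; case: ifP => // _; rewrite mulr_ge0 ?exprn_ge0 ?invr_ge0.
  rewrite (leq_trans p1 ip) mulrC; apply: ler_pM; rewrite ?exprn_ge0 ?av_ge0//.
  by rewrite -(subnKC ip) exprD ler_piMr ?exprn_ge0// exprn_ile1.
rewrite ler_piMr ?exprn_ge0//.
case: n {ge} => [|n]; first by rewrite big_mkcond big_ord1 ler01.
rewrite big_mkcond !big_ord_recl /= !add0r.
by apply: le_trans (sum_invfact n); apply: ler_sum.
Qed.
End CmpNorm.

Section NormMore.
Variables (K : fieldType) (R : realFieldType) (A : absval K R).
Implicit Types (f g : ser K) (b : fps1 K).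
Local Notation nrm := (nrm A).
Local Notation degN := (degN A).

Lemma degN_lin i (u v : K) : degN i (lin u v) = if i == 1%N then A u + A v else 0.
Proof.
case: i => [|[|i]]; rewrite /degN.
- by rewrite big_ord1 /= av0.
- by rewrite big_ord_recl big_ord1 /= addrC.
- by apply: big1 => -[[|[|j]] ji] _; rewrite /= /fps2_lin /= ?subn0 ?subSS ?subn0 ?av0.
Qed.

Lemma nrm_lin n t (u v : K) : 0 <= t -> nrm n t (lin u v) <= (A u + A v) * t.
Proof.
move=> t0; case: n => [|n].
  by rewrite /nrm big_ord1 degN_lin mul0r mulr_ge0 ?addr_ge0 ?av_ge0.
rewrite /nrm big_ord_recl big_ord_recl !degN_lin /= expr1 mul0r add0r.
rewrite big1 ?addr0// => i _; rewrite degN_lin /= mul0r//.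
Qed.

Lemma degN_cmp_lin b (u v : K) d : degN d (cmp b (lin u v)) <= A (b d) * (A u + A v) ^+ d.
Proof.
apply: (@le_trans _ _ (A (b d) * degN d (lin u v ^+ d))).
  rewrite mulr_sumr; apply: ler_sum => -[j jd] _ /=.
  rewrite -avM /fps2_comp1 subnKC -1?ltnS// (bigD1 ord_max)//= big1 ?addr0 ?cfX// => i ne.
  rewrite -(cfX (lin u v)) cf_linX subnKC -1?ltnS// ifF ?mulr0//.
  by apply/negbTE; apply: contra ne => /eqP e; apply/eqP/val_inj.
rewrite ler_wpM2l ?av_ge0//.
have := degN_le_nrm A (@ler01 R) (lin u v ^+ d) (leqnn d); rewrite expr1n mulr1 => H.
apply: le_trans H _; apply: le_trans (nrmX _ (@ler01 R) _ _ _) _.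
by apply: lerXn2r; rewrite ?nnegrE ?nrm_ge0 ?addr_ge0 ?av_ge0// (le_trans (nrm_lin _ _ _ (@ler01 R))) ?mulr1.
Qed.

Lemma degN_tr m n f : degN n (tr m f) = if (n < m)%N then degN n f else 0.
Proof.
case: ifP => nm; first by apply: eq_degN => j l jl; rewrite tr_cf ?jl.
by apply: big1 => -[j jn] _ /=; rewrite subnKC ?nm ?av0// -ltnS.
Qed.

Lemma nrm_tr t m n f : 0 <= t -> nrm n t (tr m.+1 f) <= nrm m t f.
Proof.
move=> t0; have x0 i : 0 <= degN i (tr m.+1 f) * t ^+ i by rewrite mulr_ge0 ?degN_ge0 ?exprn_ge0.
apply: le_trans (@ler_sum_widen _ _ _ (n + m).+1 x0 _) _; first by rewrite ltnS leq_addr.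
have -> : (n + m).+1 = (m.+1 + n)%N by lia.
rewrite big_split_ord /= [X in _ + X]big1 ?addr0 => [|i _].
  by apply: ler_sum => i _; rewrite degN_tr ltn_ord.
by rewrite degN_tr /= ltnNge leq_addr mul0r.
Qed.

(** If one factor vanishes to high order, only low degrees of the other factor
    contribute.  This is what keeps unknown high degrees out of the estimates. *)
Lemma nrmM_ord n p q t f g : 0 <= t -> ord p f -> ord q g -> (p <= n)%N -> (q <= n)%N ->
  nrm n t (f * g) <= nrm (n - q) t f * nrm (n - p) t g.
Proof.
move=> t0 fp gq pn qn.
rewrite (@nrm_cong _ _ A t n _ (tr (n - q).+1 f * tr (n - p).+1 g)); last first.
  rewrite (_ : _ - _ = (f - tr (n - q).+1 f) * g + tr (n - q).+1 f * (g - tr (n - p).+1 g)); last by ring.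
  apply: ordD.
    by apply: ordW (ordM (@tr_ord _ _ _) gq); lia.
  by apply: ordW (ordM (ord_tr _ fp) (@tr_ord _ _ _)); lia.
apply: le_trans (nrmM _ t0 _ _ _) _.
by apply: ler_pM; rewrite ?nrm_ge0 ?nrm_tr.
Qed.

Lemma degN_sXM n f : degN n.+1 (sX K * f) = degN n f.
Proof.
rewrite /degN big_ord_recl cf_sXM0 av0 add0r; apply: eq_bigr => i _.
by rewrite lift0 subSS cf_sXMS.
Qed.
Lemma degN_sYM n f : degN n.+1 (sY K * f) = degN n f.
Proof.
rewrite /degN big_ord_recr [nat_of_ord ord_max]/= subnn cf_sYM0 av0 [LHS]addr0; apply: eq_bigr => i _.
rewrite -[nat_of_ord (widen_ord _ i)]/(nat_of_ord i) subSn; last by rewrite -ltnS.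
by rewrite cf_sYMS.
Qed.

End NormMore.

Section RealLemmas.
Variable R : realFieldType.
Implicit Types e x : R.

(** For m e <= 1/2 the power behaves linearly; the first bound follows from
    (1 + e)^m (1 - m e) <= 1. *)
Lemma exp1De e m : 0 <= e -> m%:R * e <= 2^-1 ->
  (1 + e) ^+ m <= 2 /\ (1 + e) ^+ m - 1 <= 2 * (m%:R * e).
Proof.
move=> e0 me.
have H : (1 + e) ^+ m * (1 - m%:R * e) <= 1.
  elim: m {me} => [|m IH]; first by rewrite expr0 mul1r mul0r subr0.
  apply: le_trans IH; rewrite exprS -mulrA mulrCA ler_wpM2l ?exprn_ge0 ?addr_ge0//.
  rewrite -natr1; have m0 : 0 <= m%:R :> R by [].
  have h1 := mulr_ge0 (mulr_ge0 m0 e0) e0; have h2 := mulr_ge0 e0 e0; nra.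
have x0 : 0 <= (1 + e) ^+ m by rewrite exprn_ge0 ?addr_ge0.
have me0 : 0 <= m%:R * e by rewrite mulr_ge0.
move: ((1 + e) ^+ m) (m%:R * e) H x0 me me0 => x y H x0 y2 y0.
have h : 0 <= x * (2^-1 - y) by rewrite mulr_ge0// subr_ge0.
have x2 : x <= 2 by nra.
split => //; have h' : 0 <= (2 - x) * y by rewrite mulr_ge0// subr_ge0.
nra.
Qed.

Lemma sum_odd (V : nmodType) (F : nat -> V) k : (forall i, ~~ odd i -> F i = 0) ->
  \sum_(i < k.*2) F i = \sum_(j < k) F j.*2.+1.
Proof.
move=> F0; elim: k => [|k IH]; first by rewrite !big_ord0.
by rewrite doubleS !big_ord_recr /= IH F0 ?odd_double// addr0.
Qed.

Lemma sum_even (V : nmodType) (F : nat -> V) k : (forall i, odd i -> F i = 0) ->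
  \sum_(i < k.*2) F i = \sum_(j < k) F j.*2.
Proof.
move=> F0; elim: k => [|k IH]; first by rewrite !big_ord0.
by rewrite doubleS !big_ord_recr /= IH [F _.+1]F0 ?addr0//= odd_double.
Qed.
End RealLemmas.

(** * Estimates for the equation at a truncated solution *)

Section Moduli.
Variable K : numClosedFieldType.
Variable lam : K.
Hypothesis lam0 : lam != 0.
Hypothesis nonres : forall n, (0 < n)%N -> lam ^+ n != 1.
Variables (R : realFieldType) (A : absval K R).
Hypothesis Alam : A lam = 1.
Implicit Types (f g : ser K) (b : fps1 K).
Local Notation nrm := (nrm A).
Local Notation degN := (degN A).
Local Notation MM := (MM lam).
Local Notation DD := (DD lam).
Local Notation mi := (mi lam).
Local Notation pl := (pl lam).
Local Notation q2 := (q2 lam).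
Local Notation om := (om lam).

(** The natural scale of the coefficients of the support function: M(z + zb) has
    coefficients of modulus wt/2.  It can be small when theta is near pi. *)
Definition wt : R := A (1 + lam).

Lemma av_gt0 x : x != 0 -> 0 < A x.
Proof.
move=> x0; rewrite lt_neqAle av_ge0 andbT eq_sym; apply/eqP => e.
have := av1 A; rewrite -(mulfV x0) avM e mul0r => /eqP; rewrite eq_sym oner_eq0//.
Qed.
Lemma AlamV : A lam^-1 = 1. Proof. by rewrite avV// Alam invr1. Qed.
Lemma A_half : A 2^-1 = 2^-1. Proof. by rewrite avV ?av_nat// pnatr_eq0. Qed.
Lemma wtV : A (1 + lam^-1) = wt.
Proof.
rewrite (_ : 1 + lam^-1 = lam^-1 * (1 + lam)) ?avM ?AlamV ?mul1r//.
by rewrite mulrDr mulr1 mulVf// addrC.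
Qed.
Lemma A_om : A om = wt ^+ 2.
Proof.
by rewrite expr2 -{2}wtV /wt -avM; congr (A _); rewrite /om; field.
Qed.
Lemma wt_gt0 : 0 < wt.
Proof.
have := av_gt0 (om_neq0 lam0 nonres); rewrite A_om => h.
by rewrite lt_neqAle av_ge0 andbT eq_sym; apply/eqP => e; move: h; rewrite e expr0n ltxx.
Qed.
Lemma wt_le2 : wt <= 2.
Proof. by apply: le_trans (avD _ _ _) _; rewrite av1 Alam; lra. Qed.
Lemma A_q2 : A q2 * wt ^+ 2 <= 2.
Proof.
rewrite /q2 avM avV ?mulf_neq0 ?two_neq0 ?om_neq0// avM av_nat A_om.
have h : A (2 - lam - lam^-1) <= 4.
  apply: le_trans (avD _ _ _) _; rewrite avN AlamV.
  by apply: le_trans (lerD (avD _ _ _) (lexx _)) _; rewrite avN Alam av_nat; lra.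
move: (A _) h => x h; rewrite (_ : _ * wt ^+ 2 = x / 2); first by lra.
by field; rewrite gt_eqF ?wt_gt0.
Qed.

Section Radius.
Variable t : R.
Hypothesis t0 : 0 <= t.

Lemma nrm_mi n f : nrm n t (mi f) = nrm n t f.
Proof. by apply: nrm_sc; [exact: AlamV | exact: Alam]. Qed.
Lemma nrm_pl n f : nrm n t (pl f) = nrm n t f.
Proof. by apply: nrm_sc; [exact: Alam | exact: AlamV]. Qed.
Lemma degN_mi n f : degN n (mi f) = degN n f.
Proof.
apply: eq_bigr => j _; rewrite cf_mi !avM !avX Alam AlamV !expr1n !mulr1//.
Qed.
Lemma nrm_half n f : nrm n t (half K * f) = 2^-1 * nrm n t f.
Proof. by rewrite nrmC A_half. Qed.
Lemma nrm_MM n f : nrm n t (MM f) <= nrm n t f.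
Proof.
rewrite nrm_half; have := nrmD A t0 n f (pl f); rewrite nrm_pl; lra.
Qed.
Lemma nrm_DD n f : nrm n t (DD f) <= nrm n t f.
Proof.
rewrite nrm_half; have := nrmB A t0 n f (pl f); rewrite nrm_pl; lra.
Qed.
Lemma nrm_MM0 n : nrm n t (MM (lin 1 1)) <= wt * t.
Proof.
rewrite MM_lin; apply: le_trans (nrm_lin _ _ _ _ t0) _.
by rewrite !avM A_half wtV -/wt -mulrDr (_ : 2^-1 + 2^-1 = 1 :> R) ?mulr1//; lra.
Qed.

Lemma nrm_sym2 n X Y :
  nrm n t (half K * (mi (X + Y) + X - Y)) <= nrm n t X + nrm n t Y.
Proof.
rewrite nrm_half.
have h1 := nrmB A t0 n (mi (X + Y) + X) Y.
have h2 := nrmD A t0 n (mi (X + Y)) X.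
have h3 := nrmD A t0 n X Y.
rewrite nrm_mi in h2; lra.
Qed.
End Radius.

(** The part of EE a g that comes from the linear part of g. *)
Definition pure_part (a : fps1 K) : ser K :=
  let q0 := cmp (dfps1 a) (MM (lin 1 1)) in half K * (mi q0 + q0).

Lemma degN_pure_part a d : degN d (pure_part a) <= A (dfps1 a d) * wt ^+ d.
Proof.
rewrite /pure_part MM_lin degNC A_half; set q0 := cmp _ _.
have h : degN d q0 <= A (dfps1 a d) * wt ^+ d.
  apply: le_trans (degN_cmp_lin _ _ _ _ _) _.
  by rewrite !avM A_half wtV -/wt -mulrDr (_ : 2^-1 + 2^-1 = 1 :> R) ?mulr1//; lra.
have := degND A d (mi q0) q0; rewrite degN_mi; lra.
Qed.

Lemma cmp_sub_mono b m g : ord 1 g ->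
  cmp (fun i => b i - mono K m i) g = cmp b g - g ^+ m.
Proof. by move=> g1; rewrite (cmpD b (fun i => - mono K m i)) (cmpN (mono K m)) cmp_mono. Qed.

(** In this section g stands for a truncation of phi, t is the radius, s measures
    the distance of g to its linear part relatively to t, e = s/wt is the same
    distance relatively to M, and Rs bounds the size of q' beyond its first
    coefficient. *)
Section Low.
Variables (a : fps1 K) (g : ser K) (p : nat) (t s e Rs : R).
Hypothesis t_gt0 : 0 < t.
Hypothesis t3 : 3 * t <= 1.
Hypothesis s_le1 : s <= 1.
Hypothesis e0 : 0 <= e.
Hypothesis se : s <= wt * e.
Hypothesis pe : p.*2.+2%:R * e <= 2^-1.
Hypothesis a_odd : forall i, odd i -> a i = 0.
Hypothesis a0 : a 0%N = 1.
Hypothesis a2 : a 2%N = q2.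
Hypothesis g1 : ord 1 g.
Hypothesis g2 : ord 2 (g - lin 1 1).
Hypothesis gs : forall n, nrm n t (g - lin 1 1) <= t * s.

Definition rr j : R := A (a j.*2.+2) * wt ^+ j.*2.+2.
Hypothesis HR : \sum_(j < p) j.*2.+4%:R * (rr j.+1 * (t ^+ 2) ^+ j.+1) <= Rs.

Let t0 : 0 <= t. Proof. exact: ltW. Qed.
Let tt0 : 0 <= t ^+ 2. Proof. exact: sqr_ge0. Qed.
Let w0 : 0 < wt. Proof. exact: wt_gt0. Qed.
Let M1 := MM_ord lam g1.
Let D1 := DD_ord lam g1.

Lemma rr_ge0 j : 0 <= rr j.
Proof. by rewrite mulr_ge0 ?av_ge0 ?exprn_ge0// ltW. Qed.

Lemma rr0 : rr 0 = A q2 * wt ^+ 2.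
Proof. by rewrite /rr a2. Qed.

Lemma rr_term_ge0 m j i : 0 <= m%:R * (rr j * (t ^+ 2) ^+ i).
Proof.
by apply: mulr_ge0 => //; apply: mulr_ge0; [exact: rr_ge0 | exact: exprn_ge0].
Qed.

Lemma tw_ge0 : 0 <= t * wt^-1.
Proof. by apply: mulr_ge0 => //; rewrite invr_ge0; exact: ltW. Qed.

Lemma Rs_ge0 : 0 <= Rs.
Proof. by apply: le_trans HR; apply: sumr_ge0 => j _; exact: rr_term_ge0. Qed.

Lemma nrm_M n : nrm n t (MM g) <= wt * t * (1 + e).
Proof.
rewrite -{1}(subrK (lin 1 1) g) MMD; apply: le_trans (nrmD _ t0 _ _ _) _.
apply: le_trans (lerD (nrm_MM t0 _ _) (nrm_MM0 t0 _)) _.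
apply: le_trans (lerD (gs _) (lexx _)) _.
have := ler_wpM2l t0 se; nra.
Qed.

Lemma nrm_g n : nrm n t g <= 3 * t.
Proof.
rewrite -{1}(subrK (lin 1 1) g); apply: le_trans (nrmD _ t0 _ _ _) _.
apply: le_trans (lerD (gs _) (nrm_lin _ _ _ _ t0)) _.
by rewrite av1; have := ler_wpM2l t0 s_le1; lra.
Qed.

Lemma nrm_D n : nrm n t (DD g) <= 3 * t.
Proof. by apply: le_trans (nrm_DD t0 _ _) _; exact: nrm_g. Qed.

Lemma av_dfps1 j : A (dfps1 a j.*2.+1) * (wt * t) ^+ j.*2.+1 =
  t * wt^-1 * (j.*2.+2%:R * (rr j * (t ^+ 2) ^+ j)).
Proof.
rewrite /dfps1 avMn -(mulr_natr (A _)) /rr -exprM mul2n exprMn.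
rewrite [wt ^+ j.*2.+2]exprS [t ^+ j.*2.+1]exprS.
move: (A _) (j.*2.+2%:R) (t ^+ _) (wt ^+ _) => x y z u; field.
by rewrite gt_eqF.
Qed.

Lemma dfps1_even i : ~~ odd i -> dfps1 a i = 0.
Proof. by move=> i0; rewrite /dfps1 a_odd ?mul0rn. Qed.

Lemma expe m : (m <= p.*2.+2)%N ->
  (1 + e) ^+ m <= 2 /\ (1 + e) ^+ m - 1 <= 2 * (p.*2.+2%:R * e).
Proof.
move=> mp; have [h1 h2] := exp1De e0 pe.
have h : (1 + e) ^+ m <= (1 + e) ^+ p.*2.+2 by apply: ler_weXn2l => //; rewrite lerDl.
by split; lra.
Qed.

(** All degrees of q' but the first, compared at M(g) and at M(z + zb); the
    difference gains the factor e. *)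
Lemma nrm_dq_diff : nrm p.*2.+3 t
  (cmp (dfps1 a) (MM g) - cmp (dfps1 a) (MM (lin 1 1))
    - sC (q2 *+ 2) * (MM g - MM (lin 1 1))) <=
  t * wt^-1 * (Rs * (2 * (p.*2.+2%:R * e))).
Proof.
set M := MM g; set M0 := MM (lin 1 1).
have M01 : ord 1 M0 by apply: MM_ord; exact: lin_ord.
have MM2 : ord 2 (M - M0) by rewrite /M /M0 -MMB; exact: MM_ord.
pose T j := sC (dfps1 a j.*2.+1) * (M ^+ j.*2.+1 - M0 ^+ j.*2.+1).
rewrite (@nrm_cong _ _ A t _ _ (\sum_(j < p) T j.+1)); last first.
  apply: (@ord_trans _ _ (\sum_(i < p.+2.*2) sC (dfps1 a i) * M ^+ i
    - \sum_(i < p.+2.*2) sC (dfps1 a i) * M0 ^+ i - sC (q2 *+ 2) * (M - M0))).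
    by apply: ordBB; [apply: ordBB; exact: cmp_trunc | exact: ord_refl].
  rewrite -sumrB (eq_bigr (fun i : 'I_ _ => sC (dfps1 a i) * (M ^+ i - M0 ^+ i))); last first.
    by move=> i _; rewrite mulrBr.
  rewrite (@sum_odd _ (fun i => sC (dfps1 a i) * (M ^+ i - M0 ^+ i))); last first.
    by move=> i io; rewrite dfps1_even// rmorph0 mul0r.
  rewrite big_ord_recl big_ord_recr /=.
  rewrite (_ : sC (dfps1 a 1) * _ = sC (q2 *+ 2) * (M - M0)); last first.
    by rewrite /dfps1 a2 !expr1.
  rewrite [X in _ + (X + _)](_ : _ = \sum_(j < p) T j.+1); last by apply: eq_bigr.
  rewrite (_ : forall x y z : ser K, x + (y + z) - x - y = z); last by move=> *; ring.
  apply: ordMr; rewrite /bump add1n -[_.*2.+1]mul1n doubleS.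
  have := @expX_sub_ord _ p.*2.+3 M M0 1 1 M1 M01 MM2; rewrite mul1n addn1.
  by rewrite mul1n.
apply: le_trans (nrm_sum _ t0 _ _ _ _) _.
apply: (@le_trans _ _ (\sum_(j < p) t * wt^-1 * (j.*2.+4%:R * (rr j.+1 * (t ^+ 2) ^+ j.+1)) * (2 * (p.*2.+2%:R * e)))); last first.
  rewrite -mulr_suml -mulr_sumr -mulrA; apply: ler_wpM2l; first exact: tw_ge0.
  by apply: ler_wpM2r => //; rewrite !mulr_ge0.
apply: ler_sum => -[j jp] _ /=; rewrite nrmC.
apply: le_trans (ler_wpM2l (av_ge0 _ _) (nrmXB t0 _ (nrm_MM0 t0 _) (_ : _ <= wt * t * e))) _.
  rewrite /M -MMB; apply: le_trans (nrm_MM t0 _ _) _; apply: le_trans (gs _) _.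
  by have := ler_wpM2l t0 se; nra.
rewrite -[X in (X + _) ^+ _]mulr1 -mulrDr exprMn -[X in _ - X]mulr1 -mulrBr [X in X <= _]mulrA (av_dfps1 j.+1).
rewrite doubleS; apply: ler_wpM2l.
  by apply: mulr_ge0; [exact: tw_ge0 | exact: rr_term_ge0].
by apply: (proj2 (expe _)); rewrite !ltnS ltn_double.
Qed.

Lemma nrm_cos n : nrm n t (cmp (fcos K) (DD g) - 1) <= 9 * t ^+ 2.
Proof.
have -> : cmp (fcos K) (DD g) - 1 = cmp (fun i => fcos K i - mono K 0 i) (DD g).
  by rewrite cmp_sub_mono.
apply: le_trans (nrm_cmp_tail (p := 2) t0 D1 (nrm_D _) t3 _ _ _) _ => //.
- move=> [|i]; first by rewrite fcos0 /mono eqxx subrr av0 invr_ge0 ler0n.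
  by rewrite /mono /= subr0; exact: av_fcos.
- by move=> [|[|i]]// _; rewrite ?fcos0 /mono ?eqxx ?subrr// fcos_odd// subr0.
by rewrite exprMn; lra.
Qed.

Lemma nrm_sin n : nrm n t (cmp (fsin K) (DD g) - DD g) <= 27 * (t * t ^+ 2).
Proof.
have -> : cmp (fsin K) (DD g) - DD g = cmp (fun i => fsin K i - mono K 1 i) (DD g).
  by rewrite cmp_sub_mono// expr1.
apply: le_trans (nrm_cmp_tail (p := 3) t0 D1 (nrm_D _) t3 _ _ _) _ => //.
- move=> i; rewrite /mono; case: eqP => [->|_]; first by rewrite fsin1 subrr av0 invr_ge0 ler0n.
  by rewrite subr0; exact: av_fsin.
- move=> [|[|[|i]]]// _; first by rewrite fsin_even// subr0.
    by rewrite fsin1 /mono eqxx subrr.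
  by rewrite fsin_even// subr0.
by rewrite exprMn -exprS; lra.
Qed.

Lemma nrm_sin1 n : nrm n t (cmp (fsin K) (DD g)) <= 6 * t.
Proof.
rewrite -[cmp _ _](subrK (DD g)); apply: le_trans (nrmD _ t0 _ _ _) _.
apply: le_trans (lerD (nrm_sin _) (nrm_D _)) _.
have h : t ^+ 2 * 9 <= 1 by rewrite (_ : _ * 9 = (3 * t) ^+ 2) ?exprn_ile1// ?mulr_ge0//; ring.
by have := ler_wpM2l t0 h; lra.
Qed.

Lemma nrm_dq : nrm p.*2.+1 t (cmp (dfps1 a) (MM g)) <= t * wt^-1 * (4 + Rs) * 2.
Proof.
apply: le_trans (nrm_cmp _ t0 M1 (nrm_M _)) _.
rewrite -doubleS (@sum_odd _ (fun i => A (dfps1 a i) * (wt * t * (1 + e)) ^+ i)); last first.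
  by move=> i io; rewrite dfps1_even// av0 mul0r.
apply: (@le_trans _ _ (\sum_(j < p.+1) t * wt^-1 * (j.*2.+2%:R * (rr j * (t ^+ 2) ^+ j)) * 2)).
  apply: ler_sum => -[j jp] _ /=; rewrite exprMn [X in X <= _]mulrA (av_dfps1 j); apply: ler_wpM2l.
    by apply: mulr_ge0; [exact: tw_ge0 | exact: rr_term_ge0].
  by apply: (proj1 (expe _)); rewrite ltnS leqW// leq_double -ltnS.
rewrite -mulr_suml; apply: ler_wpM2r => //; rewrite -mulr_sumr.
apply: ler_wpM2l; first exact: tw_ge0.
rewrite big_ord_recl /= expr0 mulr1; apply: lerD; last exact: HR.
by rewrite rr0 -[0.*2.+2%:R]/(2%:R); have := A_q2; lra.
Qed.

Lemma nrm_q : nrm p.*2.+2 t (cmp a (MM g) - 1) <= 2 * t ^+ 2 * (2 + Rs).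
Proof.
have -> : cmp a (MM g) - 1 = cmp (fun i => a i - mono K 0 i) (MM g).
  by rewrite cmp_sub_mono.
apply: le_trans (nrm_cmp _ t0 M1 (nrm_M _)) _.
set b := fun i => a i - mono K 0 i.
have x0 i : 0 <= A (b i) * (wt * t * (1 + e)) ^+ i.
  rewrite mulr_ge0 ?av_ge0 ?exprn_ge0// mulr_ge0 ?addr_ge0// mulr_ge0//; exact: ltW.
apply: le_trans (ler_sum_widen x0 (leqnSn _)) _; rewrite -2!doubleS.
rewrite (@sum_even _ (fun i => A (b i) * (wt * t * (1 + e)) ^+ i)); last first.
  by move=> [|i] // io; rewrite /b a_odd// /mono subr0 av0 mul0r.
rewrite big_ord_recl {1}/b a0 /mono eqxx subrr av0 mul0r add0r.
apply: (@le_trans _ _ (\sum_(j < p.+1) 2 * t ^+ 2 * (rr j * (t ^+ 2) ^+ j))).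
  apply: ler_sum => -[j jp] _; rewrite lift0 [nat_of_ord _]/= /b /mono subr0 exprMn.
  apply: (@le_trans _ _ (A (a j.+1.*2) * ((wt * t) ^+ j.+1.*2 * 2))).
    rewrite ler_wpM2l ?av_ge0// ler_wpM2l ?exprn_ge0 ?mulr_ge0//; first exact: ltW.
    by apply: (proj1 (expe _)); rewrite -[p.*2.+2]/(p.+1.*2) leq_double.
  have te : t ^+ j.+1.*2 = t ^+ 2 * (t ^+ 2) ^+ j by rewrite -exprS -exprM mul2n.
  rewrite exprMn te /rr -[j.*2.+2]doubleS; apply: ler_of_eq.
  move: (A _) (wt ^+ _) (t ^+ 2) (_ ^+ j) => *; ring.
rewrite -mulr_sumr; apply: ler_wpM2l; first by rewrite mulr_ge0// exprn_ge0.
rewrite big_ord_recl expr0 mulr1; apply: lerD.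
  by rewrite rr0; exact: A_q2.
apply: le_trans HR; apply: ler_sum => j _; rewrite lift0.
rewrite ler_peMl ?ler1n//; apply: mulr_ge0; [exact: rr_ge0 | exact: exprn_ge0].
Qed.

(** What remains of the equation at g after removal of the part of q' at the
    linear part of phi and of the terms linear in g.  The latter are supported
    below the degree of truncation, hence invisible in the error (EE_split). *)
Definition nonlin : ser K :=
  let X := cmp (dfps1 a) (MM g) * cmp (fcos K) (DD g) - cmp (dfps1 a) (MM (lin 1 1))
    - sC (q2 *+ 2) * (MM g - MM (lin 1 1)) in
  let Y := cmp a (MM g) * cmp (fsin K) (DD g) - DD g in
  half K * (mi (X + Y) + X - Y).

Definition Gam : R := wt^-1 * (Rs * (2 * (p.*2.+2%:R * e)) + (4 + Rs) * (18 * t ^+ 2))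
  + t ^+ 2 * (2 + Rs) * 12 + 27 * t ^+ 2.

Lemma Gam_ge0 : 0 <= Gam.
Proof.
have := Rs_ge0; have t2 : 0 <= t ^+ 2 by rewrite exprn_ge0.
by move=> R0; rewrite !addr_ge0 ?mulr_ge0 ?addr_ge0 ?mulr_ge0 ?invr_ge0 ?addr_ge0// ltW.
Qed.

Lemma nrm_nonlin : nrm p.*2.+3 t nonlin <= t * Gam.
Proof.
apply: le_trans (nrm_sym2 t0 _ _ _) _.
set X := _ - _ - _; set Y := _ - DD g.
have hX : nrm p.*2.+3 t X <= t * wt^-1 * (Rs * (2 * (p.*2.+2%:R * e)))
    + t * wt^-1 * (4 + Rs) * 2 * (9 * t ^+ 2).
  rewrite (_ : X = (cmp (dfps1 a) (MM g) - cmp (dfps1 a) (MM (lin 1 1))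
    - sC (q2 *+ 2) * (MM g - MM (lin 1 1))) + cmp (dfps1 a) (MM g) * (cmp (fcos K) (DD g) - 1)); last by rewrite /X; ring.
  apply: le_trans (nrmD _ t0 _ _ _) _; apply: lerD; first exact: nrm_dq_diff.
  have c2 : ord 2 (cmp (fcos K) (DD g) - 1).
    have -> : cmp (fcos K) (DD g) - 1 = cmp (fun i => fcos K i - mono K 0 i) (DD g).
      by rewrite cmp_sub_mono.
    apply: cmp_ord D1 _ => -[|[|i]]// _; first by rewrite fcos0 /mono eqxx subrr.
    by rewrite fcos_odd// subr0.
  apply: le_trans (nrmM_ord A (n := p.*2.+3) (p := 0) (q := 2) t0 _ c2 _ _) _ => //.
  rewrite subn0 !subSS subn0; apply: ler_pM; rewrite ?nrm_ge0 ?nrm_dq ?nrm_cos//.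
have hY : nrm p.*2.+3 t Y <= 2 * t ^+ 2 * (2 + Rs) * (6 * t) + 27 * (t * t ^+ 2).
  rewrite (_ : Y = (cmp a (MM g) - 1) * cmp (fsin K) (DD g) + (cmp (fsin K) (DD g) - DD g)); last by rewrite /Y; ring.
  apply: le_trans (nrmD _ t0 _ _ _) _; apply: lerD; last exact: nrm_sin.
  have q1 : ord 1 (cmp a (MM g) - 1).
    by apply/ord1P; rewrite cfB cmp00 a0 subrr.
  have s1 : ord 1 (cmp (fsin K) (DD g)).
    by apply/ord1P; rewrite cmp00 fsin_even.
  apply: le_trans (nrmM_ord A (n := p.*2.+3) (p := 1) (q := 1) t0 q1 s1 _ _) _ => //.
  rewrite subn1; apply: ler_pM; rewrite ?nrm_ge0 ?nrm_q ?nrm_sin1//.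
apply: le_trans (lerD hX hY) _; rewrite /Gam; apply: ler_of_eq; ring.
Qed.

Lemma EE_split m j l : (forall j l, (m <= j + l)%N -> g j l = 0) -> (1 < m)%N -> (m <= j + l)%N ->
  EE lam a g j l = pure_part a j l + nonlin j l.
Proof.
move=> g0 m1 mjl.
set S := sC (q2 *+ 2) * (MM g - MM (lin 1 1)).
have EEs : EE lam a g = pure_part a + nonlin + half K * (mi (S + DD g) + S - DD g).
  rewrite /EE /XX /YY /pure_part /nonlin -/S !(miD lam, miN lam).
  ring.
have M0 : MM g j l = 0.
  by rewrite /MM cf_sCM cfD cf_pl !g0// !mul0r addr0 mulr0.
have D0 : DD g j l = 0.
  by rewrite /DD cf_sCM cfB cf_pl !g0// !mul0r subr0 mulr0.
have L0 : MM (lin 1 1) j l = 0.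
  by rewrite MM_lin /= /fps2_lin; case: (j) (l) mjl => [|[|j']] [|[|l']]//=; case: (m) m1 => [|[|]].
have S0 : S j l = 0 by rewrite cf_sCM cfB M0 L0 subr0 mulr0.
have H0 : (half K * (mi (S + DD g) + S - DD g)) j l = 0.
  by rewrite cf_sCM cfB cfD cf_mi cfD S0 D0 !(addr0, subr0, mul0r, mulr0).
by rewrite EEs cfD H0 addr0 cfD.
Qed.

Lemma nrm_EE m n : (forall j l, (m <= j + l)%N -> g j l = 0) -> (1 < m)%N ->
  ord m (EE lam a g) -> (n <= p.*2.+3)%N ->
  nrm n t (EE lam a g) <= \sum_(d < n.+1 | (1 < d)%N) A (dfps1 a d) * (wt * t) ^+ d + t * Gam.
Proof.
move=> g0 m1 gm np.
apply: le_trans _ (lerD (lexx _) (le_trans (nrm_widen A t0 _ np) nrm_nonlin)).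
rewrite big_mkcond -big_split; apply: ler_sum => -[d dn] _ /=.
have [dm|dm] := ltnP d m.
  rewrite (degN_ord _ gm dm) mul0r addr_ge0 ?mulr_ge0 ?degN_ge0 ?exprn_ge0//.
  by case: ifP => // _; rewrite mulr_ge0 ?av_ge0 ?exprn_ge0 ?mulr_ge0// ltW.
rewrite (leq_trans m1 dm) exprMn mulrA -mulrDl ler_wpM2r ?exprn_ge0//.
rewrite (@eq_degN _ _ A d _ (pure_part a + nonlin)).
  by apply: le_trans (degND _ _ _ _) _; rewrite lerD2r; exact: degN_pure_part.
by move=> j l jl; apply: (EE_split g0 m1); rewrite jl.
Qed.

Lemma pure_sum_even : \sum_(d < p.*2.+3 | (1 < d)%N) A (dfps1 a d) * (wt * t) ^+ d <= t * wt^-1 * Rs.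
Proof.
rewrite big_mkcond /=.
have x0 i : 0 <= (if (1 < i)%N then A (dfps1 a i) * (wt * t) ^+ i else 0).
  by case: ifP => // _; rewrite mulr_ge0 ?av_ge0 ?exprn_ge0 ?mulr_ge0// ltW.
rewrite big_ord_recr /= (@dfps1_even p.*2.+2); last by rewrite /= negbK odd_double.
rewrite av0 mul0r addr0 -doubleS.
rewrite (@sum_odd _ (fun i => if (1 < i)%N then A (dfps1 a i) * (wt * t) ^+ i else 0)); last first.
  by move=> i io; rewrite dfps1_even// av0 mul0r if_same.
rewrite big_ord_recl /= add0r.
apply: (@le_trans _ _ (\sum_(j < p) t * wt^-1 * (j.*2.+4%:R * (rr j.+1 * (t ^+ 2) ^+ j.+1)))).
  by apply: ler_sum => j _; rewrite /bump add1n av_dfps1.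
by rewrite -mulr_sumr; apply: ler_wpM2l => //; exact: tw_ge0.
Qed.

Lemma pure_sum_odd : \sum_(d < p.*2.+4 | (1 < d)%N) A (dfps1 a d) * (wt * t) ^+ d <=
  t * wt^-1 * (Rs + p.*2.+4%:R * (rr p.+1 * (t ^+ 2) ^+ p.+1)).
Proof.
rewrite big_mkcond big_ord_recr -big_mkcond /= mulrDr; apply: lerD; first exact: pure_sum_even.
by have := av_dfps1 p.+1; rewrite doubleS => ->.
Qed.

End Low.
End Moduli.

(** The factor k + 1 is available in pure_res, so that no power of k is lost when
    the contribution of the support function is inverted. *)
Lemma central_bin k : (4 ^ k <= k.+1 * 'C(k.*2.+1, k))%N.
Proof.
elim: k => [//|k IH].
have e1 : 'C(k.*2.+3, k.+1) = 'C(k.*2.+3, k.+2).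
  by rewrite -bin_sub; [congr 'C(_, _)|]; lia.
have e2 : 'C(k.*2.+2, k.+1) = (2 * 'C(k.*2.+1, k))%N.
  rewrite binS (_ : 'C(k.*2.+1, k.+1) = 'C(k.*2.+1, k)) ?mul2n ?addnn//.
  by rewrite -bin_sub; [congr 'C(_, _)|]; lia.
rewrite doubleS e1 -mul_bin_diag e2 expnS.
apply: leq_trans (leq_mul (leqnn 4) IH) _; nia.
Qed.

(** The leading coefficient bet of the linearisation is close to its constant term
    1/om.  Second derivatives of q enter here, and R2 bounds them. *)
Section BetEstimate.
Variable K : numClosedFieldType.
Variable lam : K.
Hypothesis lam0 : lam != 0.
Hypothesis nonres : forall n, (0 < n)%N -> lam ^+ n != 1.
Variables (R : realFieldType) (A : absval K R).
Hypothesis Alam : A lam = 1.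
Local Notation nrm := (nrm A).
Local Notation MM := (MM lam).
Local Notation DD := (DD lam).
Local Notation q2 := (q2 lam).
Local Notation om := (om lam).
Local Notation wt := (wt lam A).
Local Notation rr := (rr lam A).

Variables (a : fps1 K) (g : ser K) (p kk : nat) (t s e R2 : R).
Hypothesis t_gt0 : 0 < t.
Hypothesis t3 : 3 * t <= 1.
Hypothesis s_le1 : s <= 1.
Hypothesis e0 : 0 <= e.
Hypothesis se : s <= wt * e.
Hypothesis pe : p.*2.+2%:R * e <= 2^-1.
Hypothesis a_odd : forall i, odd i -> a i = 0.
Hypothesis a0 : a 0%N = 1.
Hypothesis a2 : a 2%N = q2.
Hypothesis g1 : ord 1 g.
Hypothesis g2 : ord 2 (g - lin 1 1).
Hypothesis gs : forall n, nrm n t (g - lin 1 1) <= t * s.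
Hypothesis kp : (kk <= p.+1)%N.
Hypothesis HR2 : \sum_(j < kk) j.*2.+4%:R ^+ 2 * (rr a j.+1 * (t ^+ 2) ^+ j.+1) <= R2.

Let t0 : 0 <= t. Proof. exact: ltW. Qed.
Let tt0 : 0 <= t ^+ 2. Proof. exact: sqr_ge0. Qed.
Let w0 : 0 < wt. Proof. exact: wt_gt0. Qed.
Let M1 := MM_ord lam g1.
Let G0 : 0 <= wt * t * (1 + e).
Proof. by apply: mulr_ge0; [apply: mulr_ge0 => //; exact: ltW | exact: addr_ge0]. Qed.

Let rp0 j : 0 <= rr a j.+1 * (t ^+ 2) ^+ j.+1.
Proof. by apply: mulr_ge0; [exact: rr_ge0 | exact: exprn_ge0]. Qed.

Lemma R2_ge0 : 0 <= R2.
Proof. by apply: le_trans HR2; apply: sumr_ge0 => j _; apply: mulr_ge0; rewrite ?sqr_ge0. Qed.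

Let expG j : (j.+1.*2 <= p.*2.+2)%N -> (wt * t * (1 + e)) ^+ j.+1.*2 <= 2 * (wt ^+ j.+1.*2 * (t ^+ 2 * (t ^+ 2) ^+ j)).
Proof.
move=> jp; have te : t ^+ j.+1.*2 = t ^+ 2 * (t ^+ 2) ^+ j by rewrite -exprS -exprM mul2n.
rewrite exprMn exprMn te [2 * _]mulrC; apply: ler_wpM2l.
  by apply: mulr_ge0; rewrite ?exprn_ge0 ?mulr_ge0 ?exprn_ge0// ltW.
exact: (proj1 (expe e0 pe jp)).
Qed.

Lemma nrm_ddq : nrm kk.*2 t (cmp (dfps1 (dfps1 a)) (MM g) - sC (q2 *+ 2)) <= 2 * wt^-1 ^+ 2 * R2.
Proof.
pose b i := dfps1 (dfps1 a) i - q2 *+ 2 * mono K 0 i.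
have -> : cmp (dfps1 (dfps1 a)) (MM g) - sC (q2 *+ 2) = cmp b (MM g).
  rewrite /b (cmpD _ (fun i => - (q2 *+ 2 * mono K 0 i))) (cmpN (fun i => q2 *+ 2 * mono K 0 i)).
  congr (_ - _); apply: serP => j k; rewrite -[sC _]mulr1 -(expr0 (MM g)) -cmp_mono// cf_sCM.
  by rewrite /= /fps2_comp1 mulr_sumr; apply: eq_bigr => i _; rewrite mulrA.
apply: le_trans (nrm_cmp _ t0 M1 (nrm_M lam0 Alam t_gt0 se gs _)) _.
have x0 i : 0 <= A (b i) * (wt * t * (1 + e)) ^+ i by rewrite mulr_ge0 ?av_ge0 ?exprn_ge0.
apply: le_trans (ler_sum_widen x0 (leqnSn _)) _; rewrite -doubleS.
rewrite (@sum_even _ (fun i => A (b i) * (wt * t * (1 + e)) ^+ i)); last first.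
  by move=> [|i] // io; rewrite /b /dfps1 a_odd/= ?negbK// !mul0rn mulr0 subr0 av0 mul0r.
have b0 : b 0%N = 0 by rewrite /b /dfps1 a2 /mono eqxx mulr1 mulr1n subrr.
rewrite big_ord_recl [b _]b0 av0 mul0r add0r.
rewrite [2 * _ * R2]mulrC; apply: le_trans (ler_wpM2r _ HR2); last first.
  by rewrite mulr_ge0 ?exprn_ge0 ?invr_ge0// ltW.
rewrite mulr_suml; apply: ler_sum => -[j jk] _; rewrite lift0 [nat_of_ord _]/=.
apply: (@le_trans _ _ (A (b j.+1.*2) * (2 * (wt ^+ j.+1.*2 * (t ^+ 2 * (t ^+ 2) ^+ j))))).
  by rewrite ler_wpM2l ?av_ge0//; apply: expG; rewrite -[p.*2.+2]/(p.+1.*2) leq_double (leq_trans jk).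
rewrite /b /mono mulr0 subr0 /dfps1 !avMn /rr.
rewrite [in wt ^+ j.+1.*2.+2]exprS [wt ^+ _.+1]exprS [(t ^+ 2) ^+ j.+1]exprS.
rewrite -(mulr_natr (_ *+ _)) -(mulr_natr (A _)) doubleS.
have n34 : j.*2.+3%:R <= j.*2.+4%:R :> R by rewrite ler_nat.
move: (j.*2.+3%:R) (j.*2.+4%:R) (ler0n R j.*2.+3) (ler0n R j.*2.+4) n34 (A _) (av_ge0 A (a j.*2.+4)) (wt ^+ _) (exprn_ge0 j.*2.+2 (ltW w0)) (t ^+ 2 * _) (mulr_ge0 tt0 (exprn_ge0 j tt0)).
move=> x y x0' y0 xy z z0 u u0 v v0.
have -> : y ^+ 2 * (z * (wt * (wt * u)) * v) * (2 * wt^-1 ^+ 2) = 2 * (z * u * v) * (y * y).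
  by field; rewrite gt_eqF.
rewrite (_ : z * y * x * _ = 2 * (z * u * v) * (y * x)); last by ring.
by rewrite ler_wpM2l ?mulr_ge0// ler_wpM2l.
Qed.

Lemma nrm_q' : nrm kk.*2 t (cmp a (MM g) - 1) <= 2 * t ^+ 2 * (2 + R2).
Proof.
rewrite -(expr0 (MM g)) -cmp_sub_mono//.
apply: le_trans (nrm_cmp _ t0 M1 (nrm_M lam0 Alam t_gt0 se gs _)) _.
set b := fun i => a i - mono K 0 i.
have x0 i : 0 <= A (b i) * (wt * t * (1 + e)) ^+ i by rewrite mulr_ge0 ?av_ge0 ?exprn_ge0.
apply: le_trans (ler_sum_widen x0 (leqnSn _)) _; rewrite -doubleS.
rewrite (@sum_even _ (fun i => A (b i) * (wt * t * (1 + e)) ^+ i)); last first.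
  by move=> [|i] // io; rewrite /b a_odd// /mono subr0 av0 mul0r.
rewrite big_ord_recl {1}/b a0 /mono eqxx subrr av0 mul0r add0r.
apply: (@le_trans _ _ (\sum_(j < kk) 2 * t ^+ 2 * (rr a j * (t ^+ 2) ^+ j))).
  apply: ler_sum => -[j jp] _; rewrite lift0 [nat_of_ord _]/= /b /mono subr0.
  apply: le_trans (ler_wpM2l (av_ge0 _ _) (expG _)) _; first by rewrite -[p.*2.+2]/(p.+1.*2) leq_double (leq_trans jp).
  rewrite /rr -[j.*2.+2]doubleS; apply: ler_of_eq.
  move: (A _) (wt ^+ _) (t ^+ 2) (_ ^+ j) => *; ring.
rewrite -mulr_sumr; apply: ler_wpM2l; first by rewrite mulr_ge0// exprn_ge0.
have R20 := R2_ge0.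
case: kk kp HR2 => [|k'] k'p HR2'; first by rewrite big_ord0 addr_ge0.
rewrite big_ord_recl expr0 mulr1; apply: lerD.
  by rewrite rr0//; exact: A_q2.
apply: le_trans HR2'; rewrite [X in _ <= X]big_ord_recr /=.
apply: (@le_trans _ _ (\sum_(i < k') i.*2.+4%:R ^+ 2 * (rr a i.+1 * t ^+ 2 ^+ i.+1))).
  apply: ler_sum => j _; rewrite /bump add1n ler_peMl//.
  by rewrite -natrX ler1n expn_gt0.
by rewrite lerDl; apply: mulr_ge0 => //; exact: sqr_ge0.
Qed.

Definition betd := wt^-1 ^+ 2 * R2 + t ^+ 2 * (2 + R2) + 9 * (wt^-1 ^+ 2 * t ^+ 2).

Lemma nrm_bet : nrm kk.*2 t (bet lam a g - sC om^-1) <= betd.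
Proof.
have om0 := om_neq0 lam0 nonres.
have q2om : q2 *+ 2 + 1 = 4 * om^-1 := q2_om lam0 nonres.
set c := cmp (fcos K) (DD g); set q'' := cmp (dfps1 (dfps1 a)) (MM g); set q := cmp a (MM g).
have -> : bet lam a g - sC om^-1 = sC 4^-1 * (((q'' - sC (q2 *+ 2)) + (q - 1)) * c + sC (4 * om^-1) * (c - 1)).
  rewrite /bet -/c -/q'' -/q -q2om.
  have -> : half K * half K = sC 4^-1.
    by rewrite -rmorphM /=; congr sC; field.
  have -> : sC om^-1 = sC 4^-1 * sC (q2 *+ 2 + 1).
    by rewrite q2om -rmorphM /=; congr sC; field.
  rewrite rmorphD rmorph1; ring.
rewrite nrmC avV ?pnatr_eq0// av_nat.
have c1 : nrm kk.*2 t (c - 1) <= 9 * t ^+ 2 by exact: (nrm_cos lam0 Alam t_gt0 t3 s_le1 g1 gs).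
have t2 : 9 * t ^+ 2 <= 1 by rewrite (_ : 9 * _ = (3 * t) ^+ 2) ?exprn_ile1// ?mulr_ge0//; ring.
have c2 : nrm kk.*2 t c <= 2.
  rewrite -(subrK 1 c); apply: le_trans (nrmD _ t0 _ _ _) _; rewrite nrm1; lra.
have h1 := nrm_ddq; have h2 := nrm_q'.
rewrite -/q'' in h1; rewrite -/q in h2.
have h3 : nrm kk.*2 t (((q'' - sC (q2 *+ 2)) + (q - 1)) * c + sC (4 * om^-1) * (c - 1)) <=
  (2 * wt^-1 ^+ 2 * R2 + 2 * t ^+ 2 * (2 + R2)) * 2 + 4 * wt^-1 ^+ 2 * (9 * t ^+ 2).
  apply: le_trans (nrmD _ t0 _ _ _) _; apply: lerD.
    apply: le_trans (nrmM _ t0 _ _ _) _; apply: ler_pM; rewrite ?nrm_ge0//.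
    by apply: le_trans (nrmD _ t0 _ _ _) _; exact: lerD.
  rewrite nrmC avM av_nat avV// A_om// exprVn; apply: ler_wpM2l => //.
  by rewrite mulr_ge0// invr_ge0 exprn_ge0// ltW.
rewrite /betd; lra.
Qed.

End BetEstimate.

(** * One step of the estimates *)

Section Step.
Variable K : numClosedFieldType.
Variable lam : K.
Hypothesis lam0 : lam != 0.
Hypothesis nonres : forall n, (0 < n)%N -> lam ^+ n != 1.
Variables (R : realFieldType) (A : absval K R).
Hypothesis Alam : A lam = 1.
Local Notation nrm := (nrm A).
Local Notation degN := (degN A).
Local Notation MM := (MM lam).
Local Notation mi := (mi lam).
Local Notation pl := (pl lam).
Local Notation EE := (EE lam).
Local Notation om := (om lam).
Local Notation wt := (wt lam A).
Local Notation rr := (rr lam A).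

(** The leading coefficient of the Casoratian of the two derivatives is bounded
    below by the Diophantine condition at the index 2. *)
Lemma casoratian_lead_ge (cd : R) sg : 0 < cd ->
  (forall i, (0 < i)%N -> cd <= A (lam ^+ i - 1) * i%:R ^+ sg) ->
  2^-1 * (cd / 2 ^+ sg) <= A (om^-1 * (2 * (lam^-1 - lam))).
Proof.
move=> cd0 dio.
have -> : om^-1 * (2 * (lam^-1 - lam)) = om^-1 * (2 * (lam^-1 * - (lam ^+ 2 - 1))).
  by congr (_ * _); field.
have h2 := dio 2%N isT.
have h : cd / 2 ^+ sg <= A (lam ^+ 2 - 1) by rewrite ler_pdivrMr ?exprn_gt0.
have w0 := wt_gt0 lam0 nonres Alam.
rewrite avM avV ?om_neq0// A_om// !avM avN AlamV// av_nat mul1r.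
have h4 : 4^-1 <= (wt ^+ 2)^-1.
  have w2 := wt_le2 Alam; rewrite lef_pV2 ?posrE ?exprn_gt0//.
  by rewrite (_ : 4 = 2 ^+ 2 :> R) ?lerXn2r ?nnegrE// ?ltW//; ring.
have cs : 0 <= cd / 2 ^+ sg by rewrite divr_ge0 ?exprn_ge0// ltW.
have := ler_pM (_ : 0 <= 4^-1) (mulr_ge0 (ler0n R 2) cs) h4 (ler_wpM2l (ler0n R 2) h).
rewrite invr_ge0 => /(_ (ler0n R 4)); lra.
Qed.

Variables (a : fps1 K) (f : ser K).
Hypothesis nf : normal_form lam a f.
Hypothesis E0 : EE a f = 0.

Variables (p : nat) (t nu e Rs : R).
Let k := p.+1.
Local Notation lo := (lo f k).
Local Notation hi := (hi f k).
Local Notation ft := (ft f k).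
Local Notation Gam := (Gam lam A p t e Rs).
Hypothesis t_gt0 : 0 < t.
Hypothesis t3 : 3 * t <= 1.
Hypothesis nu_le1 : nu <= 1.
Hypothesis e0 : 0 <= e.
Hypothesis nue : nu <= wt * e.
Hypothesis pe : p.*2.+2%:R * e <= 2^-1.
Hypothesis lo_nu : forall n, nrm n t (lo - lin 1 1) <= t * nu.
Hypothesis ft_nu : forall n, nrm n t (ft - lin 1 1) <= t * nu.
Hypothesis ang_nu : forall n, nrm n t (ang ft - lin 1 (- 1)) <= t * nu.
Hypothesis rad_nu : forall n, nrm n t (rad ft - lin 1 1) <= t * nu.
Hypothesis HR : \sum_(j < p) j.*2.+4%:R * (rr a j.+1 * (t ^+ 2) ^+ j.+1) <= Rs.

Let t0 : 0 <= t. Proof. exact: ltW. Qed.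
Let k0 : (0 < k)%N. Proof. by []. Qed.
Let k_split : (uphalf k + k./2 = k)%N.
Proof. by rewrite uphalf_half -[RHS]odd_double_half -addnn addnA. Qed.
Let i0 : (0 < uphalf k)%N. Proof. by []. Qed.
Let w0 : 0 < wt. Proof. exact: wt_gt0. Qed.

Lemma lo_top j l : ((uphalf k).*2.+1 <= j + l)%N -> lo j l = 0.
Proof. exact: tr_cf0. Qed.

Lemma lo_ord2 : ord 2 (lo - lin 1 1).
Proof.
apply: ord_trans (nf_ord2 nf) => j l jl; rewrite cfB /= ifT ?subrr//.
by apply: leq_trans jl _; rewrite ltnS double_gt0.
Qed.

Lemma ft_ord2 : ord 2 (ft - lin 1 1).
Proof.
apply: ord_trans (nf_ord2 nf) => j l jl; rewrite cfB /= ifT ?subrr//.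
by apply: leq_trans jl _.
Qed.

Lemma lo_sym j l : lo j l = lo l j.
Proof. by rewrite /= addnC (nf_f_sym nf). Qed.

Lemma pure_partE j l d : (j + l = d)%N -> pure_part lam a j l = a d.+1 * pure lam d j l.
Proof.
move=> jl; rewrite /pure_part /pure cf_sCM cfMn cf_sCM !cfD !cf_mi.
have -> : (cmp (dfps1 a) (MM (lin 1 1))) j l = dfps1 a d * (MM (lin 1 1) ^+ d) j l.
  rewrite MM_lin /= /fps2_comp1 jl (bigD1 ord_max)//= big1 ?addr0 ?cfX// => i ne.
  rewrite -(cfX (lin _ _)) cf_linX jl ifF ?mulr0//.
  by apply/negbTE; apply: contra ne => /eqP ei; apply/eqP/val_inj.
rewrite /dfps1; move: ((MM _ ^+ d) j l) (a _) => x y; ring.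
Qed.

Lemma A_pure : wt ^+ k.*2.+2 <= 2 * A (pure lam k.*2.+1 k.+1 k).
Proof.
rewrite pure_res// avM avX avM av_nat A_om// avV ?pnatr_eq0// av_nat.
set N := (_ * 'C(_, _))%N.
have c1 : 1 <= 2 * N%:R * 4^-1 ^+ k.+1 :> R.
  rewrite exprVn ler_pdivlMr ?exprn_gt0// mul1r -natrX -natrM ler_nat /N.
  by rewrite -doubleS -mul2n !mulnA -(mulnA (2 * 2)%N) expnS leq_mul ?central_bin.
have we : (wt ^+ 2) ^+ k.+1 = wt ^+ k.*2.+2 by rewrite -exprM mul2n doubleS.
rewrite exprMn we (_ : 2 * _ = (2 * N%:R * 4^-1 ^+ k.+1) * wt ^+ k.*2.+2); last by ring.
by apply: ler_peMl => //; rewrite exprn_ge0// ltW.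
Qed.

Lemma nrm_rad n : nrm n t (rad ft) <= 3 * t.
Proof.
rewrite -(subrK (lin 1 1) (rad ft)); apply: le_trans (nrmD _ t0 _ _ _) _.
apply: le_trans (lerD (rad_nu _) (nrm_lin _ _ _ _ t0)) _.
by rewrite av1; have := ler_wpM2l t0 nu_le1; lra.
Qed.
Lemma nrm_ang n : nrm n t (ang ft) <= 3 * t.
Proof.
rewrite -(subrK (lin 1 (- 1)) (ang ft)); apply: le_trans (nrmD _ t0 _ _ _) _.
apply: le_trans (lerD (ang_nu _) (nrm_lin _ _ _ _ t0)) _.
by rewrite avN av1; have := ler_wpM2l t0 nu_le1; lra.
Qed.

Lemma rad_ord2 : ord 2 (rad ft - lin 1 1).
Proof.
move=> j l jl; rewrite cfB /rad /=.
have := ft_ord2 jl; rewrite cfB /= => /eqP; rewrite subr_eq0 => /eqP ->.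
by case: j l jl => [|[|j]] [|[|l]]//= _; rewrite /fps2_lin /= ?mulr0 ?subrr ?mulr1 ?addr0 ?add0r ?subrr.
Qed.
Lemma ang_ord2 : ord 2 (ang ft - lin 1 (- 1)).
Proof.
move=> j l jl; rewrite cfB /ang /=.
have := ft_ord2 jl; rewrite cfB /= => /eqP; rewrite subr_eq0 => /eqP ->.
by case: j l jl => [|[|j]] [|[|l]]//= _; rewrite /fps2_lin /= ?mulr0 ?subrr ?mulr1 ?subr0 ?sub0r ?subrr.
Qed.

Let F := EE a lo.
Let m := (uphalf k).*2.+1.
Let Fm : ord m F. Proof. exact: (EE_lo_ord lam0 nf E0 k0). Qed.
Let m1 : (1 < m)%N. Proof. by rewrite /m ltnS double_gt0. Qed.
Let mk : (m <= k.*2.+1)%N.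
Proof. by rewrite /m ltnS leq_double -[X in (_ <= X)%N]k_split leq_addr. Qed.

Lemma nrm_F_even : nrm k.*2 t F <= t * wt^-1 * Rs + t * Gam.
Proof.
have np : (k.*2 <= p.*2.+3)%N by rewrite /k doubleS.
have H := nrm_EE lam0 nonres Alam t_gt0 t3 nu_le1 e0 nue pe (nf_a_odd nf) (nf_a0 nf)
  (nf_a2 nf) (lo_ord nf k) lo_ord2 lo_nu HR lo_top m1 Fm np.
apply: le_trans H _; apply: lerD; last exact: lexx.
exact: (pure_sum_even lam0 nonres Alam t_gt0 (nf_a_odd nf) HR).
Qed.

Definition Gam2 := wt^-1 * (Rs + p.*2.+4%:R * (rr a p.+1 * (t ^+ 2) ^+ p.+1)) + Gam.

Lemma nrm_F_odd : nrm k.*2.+1 t F <= t * Gam2.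
Proof.
have np : (k.*2.+1 <= p.*2.+3)%N by rewrite /k doubleS.
have H := nrm_EE lam0 nonres Alam t_gt0 t3 nu_le1 e0 nue pe (nf_a_odd nf) (nf_a0 nf)
  (nf_a2 nf) (lo_ord nf k) lo_ord2 lo_nu HR lo_top m1 Fm np.
apply: le_trans H _; rewrite [t * Gam2]mulrDr [t * (wt^-1 * _)]mulrA; apply: lerD; last exact: lexx.
exact: (pure_sum_odd lam0 nonres Alam t_gt0 (nf_a_odd nf) HR).
Qed.

(** In the diagonal relation rad_EE_diag the linear part of rad ft picks out twice
    the entry of the equation at z^(k+1) zb^k, where the coefficient of t^(2k+2)
    of the support function enters with the factor pure_res.  Everything else is
    of lower degree, and no small divisor enters. *)
Lemma coefficient_step : rr a k * (t ^+ 2) ^+ k <=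
  2 * Gam + nu * (wt^-1 * Rs + Gam).
Proof.
set v' := rad ft - lin 1 1.
have D : (rad ft * F) k.+1 k.+1 = 0 := rad_EE_diag lam0 nf E0 k0.
have Fs : F k k.+1 = F k.+1 k.
  exact: (EE_swap lam0 a k k.+1 (lo_ord nf k) lo_sym).
have e2 : 2 * F k.+1 k = - (v' * F) k.+1 k.+1.
  have e1 : (lin 1 1 * F) k.+1 k.+1 + (v' * F) k.+1 k.+1 = 0.
    by rewrite -D -cfD -mulrDl addrC subrK.
  by move/eqP: e1; rewrite addr_eq0 cf_linM Fs !mul1r => /eqP <-; rewrite mulr_natl mulr2n.
have kk1 : (k.+1 + k = k.*2.+1)%N by rewrite addSn addnn.
have e3 : 2 * (a k.*2.+2 * pure lam k.*2.+1 k.+1 k) =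
    - (2 * nonlin lam a lo k.+1 k) - (v' * F) k.+1 k.+1.
  rewrite -e2 /F (EE_split lam a lo_top m1) ?kk1// (pure_partE kk1).
  move: (a _ * _) (nonlin _ _ _ _ _) => x y; ring.
have h1 : rr a k <= A (2 * (a k.*2.+2 * pure lam k.*2.+1 k.+1 k)).
  rewrite avM av_nat avM mulrCA; apply: ler_wpM2l; first exact: av_ge0.
  exact: A_pure.
have h2 : rr a k <= 2 * degN k.*2.+1 (nonlin lam a lo) + degN k.*2.+2 (v' * F).
  apply: le_trans h1 _; rewrite e3; apply: le_trans (avD _ _ _) _; rewrite !avN.
  apply: lerD.
    rewrite avM av_nat ler_wpM2l//; rewrite -kk1; exact: av_le_degN.
  rewrite (_ : k.*2.+2 = (k.+1 + k.+1)%N); first exact: av_le_degN.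
  by rewrite addSn addnS addnn.
have h3 : degN k.*2.+1 (nonlin lam a lo) * t ^+ k.*2.+1 <= t * Gam.
  apply: le_trans (degN_le_nrm A t0 _ (leqnn _)) _.
  exact: (nrm_nonlin lam0 nonres Alam t_gt0 t3 nu_le1 e0 nue pe (nf_a_odd nf) (nf_a0 nf)
    (nf_a2 nf) (lo_ord nf k) lo_ord2 lo_nu HR).
have h4 : degN k.*2.+2 (v' * F) * t ^+ k.*2.+2 <= (t * nu) * (t * wt^-1 * Rs + t * Gam).
  apply: le_trans (degN_le_nrm A t0 _ (leqnn _)) _.
  apply: le_trans (nrmM_ord A t0 rad_ord2 Fm _ (leqW mk)) _ => //.
  rewrite (_ : (k.*2.+2 - 2)%N = k.*2); last by rewrite 2!subSS subn0.
  apply: ler_pM; [exact: nrm_ge0 | exact: nrm_ge0 | exact: rad_nu | exact: nrm_F_even].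
have te : t ^+ k.*2.+2 = (t ^+ 2) ^+ k * t ^+ 2 by rewrite -exprSr -exprM mul2n doubleS.
have te' : t ^+ k.*2.+2 = t ^+ k.*2.+1 * t by rewrite exprSr.
have tp : 0 <= t ^+ k.*2.+2 by rewrite exprn_ge0.
have h5 := ler_wpM2r tp h2.
have t2 : 0 < t ^+ 2 by rewrite exprn_gt0.
rewrite -(ler_pM2r t2) -mulrA -te; apply: le_trans h5 _.
rewrite mulrDl; apply: le_trans (lerD (lexx _) h4) _.
rewrite te' -mulrA mulrA [2 * _ * _]mulrA -mulrA.
have h6 := ler_wpM2r t0 h3.
move: (degN _ _) (t ^+ _.+1) (Gam) h6 => x y z h6; nra.
Qed.

(** ** The tail of phi: a single small divisor *)

Variables (cd : R) (sg : nat) (R2 H : R).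
Hypothesis cd0 : 0 < cd.
Hypothesis dio : forall i, (0 < i)%N -> cd <= A (lam ^+ i - 1) * i%:R ^+ sg.
Hypothesis HR2 : \sum_(j < k./2) j.*2.+4%:R ^+ 2 * (rr a j.+1 * (t ^+ 2) ^+ j.+1) <= R2.
Hypothesis hiH : nrm k.*2 t hi <= t * H.

(** A Casoratian splits into the part off the diagonal, where it is recovered from
    B - B^- by division, and the diagonal part, which B - B^- does not see. *)
Definition offd (B : ser K) : ser K := Ser (fun j l => if j == l then 0 else B j l).
Definition dgd (B : ser K) : ser K := Ser (fun j l => if j == l then B j l else 0).

Lemma offd_dgd B : B = offd B + dgd B.
Proof. by apply: serP => j l; rewrite cfD /=; case: eqP; rewrite ?addr0 ?add0r. Qed.
Lemma dgd_diag B : diagonal (dgd B).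
Proof. by move=> j l /= /negbTE ->. Qed.

Lemma dio_mi j l : j != l -> cd <= A (1 - lam^-1 ^+ j * lam ^+ l) * (j + l)%:R ^+ sg.
Proof.
wlog jl : j l / (j < l)%N => [W|_].
  move=> ne; have [jl|lj] := ltnP j l; first exact: W.
  have lj' : (l < j)%N by rewrite ltn_neqAle eq_sym ne.
  rewrite addnC (_ : A _ = A (1 - lam^-1 ^+ l * lam ^+ j)); first by apply: W => //; rewrite eq_sym.
  have e1 : 1 - lam^-1 ^+ j * lam ^+ l = - (lam^-1 ^+ j * lam ^+ l) * (1 - lam^-1 ^+ l * lam ^+ j).
    have x1 : lam^-1 ^+ j * lam ^+ j = 1 by rewrite -exprMn mulVf// expr1n.
    have x2 : lam^-1 ^+ l * lam ^+ l = 1 by rewrite -exprMn mulVf// expr1n.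
    rewrite mulrBr mulr1 mulNr opprK.
    rewrite (_ : _ * (_ * _) = (lam^-1 ^+ j * lam ^+ j) * (lam^-1 ^+ l * lam ^+ l)); last by move: (_ ^+ _) (_ ^+ _) (_ ^+ _) (_ ^+ _) => *; ring.
    by rewrite x1 x2 mulr1 addrC.
  by rewrite e1 avM avN avM !avX AlamV// Alam !expr1n !mul1r.
have -> : 1 - lam^-1 ^+ j * lam ^+ l = - (lam ^+ (l - j) - 1).
  rewrite opprB -[in lam ^+ l](subnKC (ltnW jl)) exprD mulrA -exprMn mulVf// expr1n mul1r//.
rewrite avN; have lj : (0 < l - j)%N by rewrite subn_gt0.
apply: le_trans (dio lj) _; rewrite ler_wpM2l ?av_ge0//.
by apply: lerXn2r; rewrite ?nnegrE// ler_nat (leq_trans (leq_subr _ _))// leq_addl.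
Qed.

(** The only division by small divisors in a step. *)
Lemma nrm_offd n B Z : ord n.+1 (B - mi B - Z) -> nrm n t (offd B) * cd <= n%:R ^+ sg * nrm n t Z.
Proof.
move=> BZ; rewrite mulr_suml mulr_sumr; apply: ler_sum => -[d dn] _ /=.
rewrite mulrAC mulrA; apply: ler_wpM2r; first by rewrite exprn_ge0.
rewrite mulr_suml mulr_sumr; apply: ler_sum => -[j jd] _ /=.
have jdd : (j + (d - j) = d)%N by rewrite subnKC.
case: eqP => [_|/eqP ne]; first by rewrite av0 mul0r mulr_ge0 ?av_ge0 ?exprn_ge0.
have <- : B j (d - j)%N * (1 - lam^-1 ^+ j * lam ^+ (d - j)) = Z j (d - j)%N.
  rewrite -(ord_cf BZ) ?jdd// cfB cf_mi; ring.
rewrite avM mulrCA; apply: ler_wpM2l; first exact: av_ge0.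
apply: le_trans (dio_mi ne) _; rewrite jdd mulrC; apply: ler_wpM2r; first exact: av_ge0.
by apply: lerXn2r; rewrite ?nnegrE// ler_nat -ltnS.
Qed.

Let BB := casoratian lam (bet lam a f) (ang f) hi.
Let AA := casoratian lam (bet lam a f) (rad f) hi.
Let TT := rad ft * BB - ang ft * AA.
Let OO := rad ft * offd BB - ang ft * offd AA.

Let rad_ord1 : ord 1 (rad ft). Proof. exact: (eul_ord _ (ft_ord nf k)). Qed.
Let ang_ord1 : ord 1 (ang ft). Proof. exact: (eul_ord _ (ft_ord nf k)). Qed.

Lemma nrm_gF (u : ser K) : ord 1 u -> (forall n, nrm n t u <= 3 * t) ->
  nrm k.*2.+2 t (u * F) <= 3 * t * (t * Gam2).
Proof.
move=> u1 un; apply: le_trans (nrmM_ord A t0 u1 Fm _ (leqW mk)) _ => //.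
rewrite (_ : (k.*2.+2 - 1)%N = k.*2.+1); last by rewrite subn1.
by apply: ler_pM; [exact: nrm_ge0 | exact: nrm_ge0 | exact: un | exact: nrm_F_odd].
Qed.

Lemma nrm_offBB : nrm k.*2.+2 t (offd BB) * cd <= k.*2.+2%:R ^+ sg * (3 * t * (t * Gam2)).
Proof.
apply: le_trans (@nrm_offd _ _ (- (ang ft * F)) _) _.
  by rewrite opprK; exact: (cas_ang lam0 nf E0 k0).
rewrite nrmN; apply: ler_wpM2l; first by rewrite exprn_ge0.
by apply: nrm_gF => //; exact: nrm_ang.
Qed.
Lemma nrm_offAA : nrm k.*2.+2 t (offd AA) * cd <= k.*2.+2%:R ^+ sg * (3 * t * (t * Gam2)).
Proof.
apply: le_trans (@nrm_offd _ _ (- (rad ft * F)) _) _.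
  by rewrite opprK; exact: (cas_rad lam0 nf E0 k0).
rewrite nrmN; apply: ler_wpM2l; first by rewrite exprn_ge0.
by apply: nrm_gF => //; exact: nrm_rad.
Qed.

Lemma nrm_mul1 (u B : ser K) : ord 1 u -> (forall n, nrm n t u <= 3 * t) ->
  nrm k.*2.+3 t (u * B) <= 3 * t * nrm k.*2.+2 t B.
Proof.
move=> u1 un; apply: le_trans (nrmM_ord A (q := 0) t0 u1 (fun _ _ => _) _ _) _ => //.
rewrite subn1 subn0; apply: ler_pM; [exact: nrm_ge0 | exact: nrm_ge0 | exact: un | exact: lexx].
Qed.

Lemma nrm_OO : nrm k.*2.+3 t OO * cd <= 18 * t ^+ 3 * k.*2.+2%:R ^+ sg * Gam2.
Proof.
have h1 := nrm_mul1 (offd BB) rad_ord1 nrm_rad.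
have h2 := nrm_mul1 (offd AA) ang_ord1 nrm_ang.
have h3 := nrmB A t0 k.*2.+3 (rad ft * offd BB) (ang ft * offd AA).
have t3' : 0 <= 3 * t by rewrite mulr_ge0.
have h4 := ler_wpM2l t3' nrm_offBB.
have h5 := ler_wpM2l t3' nrm_offAA.
have h6 : nrm k.*2.+3 t OO <= 3 * t * (nrm k.*2.+2 t (offd BB) + nrm k.*2.+2 t (offd AA)).
  by apply: le_trans h3 _; rewrite mulrDr; exact: lerD.
apply: le_trans (ler_wpM2r (ltW cd0) h6) _.
have h7 := lerD h4 h5; apply: le_trans (le_trans _ h7) _.
  by apply: ler_of_eq; ring.
apply: ler_of_eq.
move: (_ ^+ sg) Gam2 => x y; ring.
Qed.

Lemma ft_res i : ft i.+2 i.+1 = 0.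
Proof. by rewrite /= (nf_f_res nf) if_same. Qed.
Lemma ft_res' i : ft i.+1 i.+2 = 0.
Proof. by rewrite /= (sym_res nf) if_same. Qed.

(** The diagonal entries of the two Casoratians: the relations tail_res at the
    monomials of bidegree (i+1, i) and (i, i+1) form a linear system with
    determinant 2, because ang has opposite and rad equal signs on the two
    linear monomials. *)
Lemma diag_bound i : (i <= k.+1)%N ->
  2 * A (BB i i) <= degN i.*2.+1 OO /\ 2 * A (AA i i) <= degN i.*2.+1 OO.
Proof.
move=> ik; have [T1 T2] : TT i.+1 i = 0 /\ TT i i.+1 = 0 := tail_res lam0 nonres nf E0 k0 ik.
have TE : TT = OO + (rad ft * dgd BB - ang ft * dgd AA).
  by rewrite /TT {1}(offd_dgd BB) {1}(offd_dgd AA) /OO; ring.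
have f10 : ft 1%N 0%N = 1 by rewrite tr_cf ?(nf_f10 nf)//.
have f01 : ft 0%N 1%N = 1 by rewrite tr_cf ?(nf_f01 nf)//.
have r10 : rad ft 1%N 0%N = 1 by rewrite -[LHS]/((1 + 0) * ft 1%N 0%N) f10 addr0 mulr1.
have r01 : rad ft 0%N 1%N = 1 by rewrite -[LHS]/((0 + 1) * ft 0%N 1%N) f01 add0r mulr1.
have a10 : ang ft 1%N 0%N = 1 by rewrite -[LHS]/((1 - 0) * ft 1%N 0%N) f10 subr0 mulr1.
have a01 : ang ft 0%N 1%N = -1 by rewrite -[LHS]/((0 - 1) * ft 0%N 1%N) f01 sub0r mulr1.
have rr1 j : rad ft j.+2 j.+1 = 0 by rewrite -[LHS]/((_ + _) * ft j.+2 j.+1) ft_res mulr0.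
have rr2 j : rad ft j.+1 j.+2 = 0 by rewrite -[LHS]/((_ + _) * ft j.+1 j.+2) ft_res' mulr0.
have aa1 j : ang ft j.+2 j.+1 = 0 by rewrite -[LHS]/((_ - _) * ft j.+2 j.+1) ft_res mulr0.
have aa2 j : ang ft j.+1 j.+2 = 0 by rewrite -[LHS]/((_ - _) * ft j.+1 j.+2) ft_res' mulr0.
have dB : dgd BB i i = BB i i by rewrite /= eqxx.
have dA : dgd AA i i = AA i i by rewrite /= eqxx.
have e1 : OO i.+1 i + (BB i i - AA i i) = 0.
  rewrite -[RHS]T1 TE [RHS]cfD [X in _ = _ + X]cfB; congr (_ + (_ - _)).
    by rewrite (cfM_diag _ rr1 (@dgd_diag _)) r10 mul1r dB.
  by rewrite (cfM_diag _ aa1 (@dgd_diag _)) a10 mul1r dA.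
have e2 : OO i i.+1 + (BB i i + AA i i) = 0.
  rewrite -[RHS]T2 TE [RHS]cfD [X in _ = _ + X]cfB; congr (_ + (_ + _)).
    by rewrite (cfM_diag' _ rr2 (@dgd_diag _)) r01 mul1r dB.
  by rewrite (cfM_diag' _ aa2 (@dgd_diag _)) a01 mulN1r opprK dA.
have ii : (i.+1 + i = i.*2.+1)%N by rewrite addSn addnn.
have N2 : A (OO i.+1 i) + A (OO i i.+1) <= degN i.*2.+1 OO.
  by rewrite -ii; apply: av2_le_degN; rewrite gtn_eqF.
split; apply: le_trans _ N2; rewrite -[X in X * _](av_nat A 2) -avM.
  rewrite (_ : 2%:R * BB i i = - OO i.+1 i - OO i i.+1).
    by apply: le_trans (avD _ _ _) _; rewrite !avN.
  move/eqP: e1; rewrite addr_eq0 => /eqP ->; move/eqP: e2; rewrite addr_eq0 => /eqP ->; ring.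
rewrite (_ : 2%:R * AA i i = OO i.+1 i - OO i i.+1).
  by apply: le_trans (avD _ _ _) _; rewrite !avN.
move/eqP: e1; rewrite addr_eq0 => /eqP ->; move/eqP: e2; rewrite addr_eq0 => /eqP ->; ring.
Qed.

Lemma degN_dgd d (B : ser K) : degN d (dgd B) = if odd d then 0 else A (B d./2 d./2).
Proof.
case: ifP => od.
  apply: big1 => -[j jd] _ /=; case: eqP => [ej|]; rewrite ?av0//.
  have jd2 : (j + j = d)%N by rewrite {2}ej subnKC// -ltnS.
  by move: od; rewrite -jd2 addnn odd_double.
have dd : (d./2.*2 = d)%N by rewrite -[RHS]odd_double_half od.
have hd : (d./2 < d.+1)%N by rewrite -[X in (_ < X.+1)%N]dd ltnS -addnn leq_addr.
rewrite /degN (bigD1 (Ordinal hd))//= big1 ?addr0 => [|[j jd] /= ne].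
  by rewrite (_ : (d - d./2)%N = d./2) ?eqxx// -{1}dd -addnn addnK.
case: eqP => [ej|]; rewrite ?av0//; move: ne; rewrite -val_eqE /= => /eqP[].
have jd2 : (j + j = d)%N by rewrite {2}ej subnKC// -ltnS.
by rewrite -jd2 addnn doubleK.
Qed.

Lemma nrm_dgd (B : ser K) : (forall i, (i <= k.+1)%N -> 2 * A (B i i) <= degN i.*2.+1 OO) ->
  2 * t * nrm k.*2.+2 t (dgd B) <= nrm k.*2.+3 t OO.
Proof.
move=> HB; rewrite mulr_sumr [X in _ <= X]big_ord_recl.
apply: le_trans _ (lerD (_ : 0 <= _) (lexx _)); last by rewrite mulr_ge0 ?degN_ge0 ?exprn_ge0.
rewrite add0r; apply: ler_sum => -[d dk] _; rewrite lift0 [nat_of_ord _]/= exprS.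
rewrite (_ : 2 * t * _ = 2 * degN d (dgd B) * (t * t ^+ d)); last by move: (degN _ _) (t ^+ d) => *; ring.
apply: ler_wpM2r; first by rewrite mulr_ge0 ?exprn_ge0.
rewrite degN_dgd; case: ifP => od; first by rewrite mulr0 degN_ge0.
have dd : (d./2.*2 = d)%N by rewrite -[RHS]odd_double_half od.
have := HB d./2; rewrite dd; apply.
by rewrite -leq_double dd doubleS -ltnS.
Qed.

Lemma nrm_TT : nrm k.*2.+3 t TT * cd <= 72 * t ^+ 3 * k.*2.+2%:R ^+ sg * Gam2.
Proof.
have TE : TT = OO + (rad ft * dgd BB - ang ft * dgd AA).
  by rewrite /TT {1}(offd_dgd BB) {1}(offd_dgd AA) /OO; ring.
have h1 := nrm_mul1 (dgd BB) rad_ord1 nrm_rad.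
have h2 := nrm_mul1 (dgd AA) ang_ord1 nrm_ang.
have h3 := nrm_dgd (fun i ik => proj1 (diag_bound ik)).
have h4 := nrm_dgd (fun i ik => proj2 (diag_bound ik)).
have h5 := nrmD A t0 k.*2.+3 OO (rad ft * dgd BB - ang ft * dgd AA).
have h6 := nrmB A t0 k.*2.+3 (rad ft * dgd BB) (ang ft * dgd AA).
have h7 : nrm k.*2.+3 t TT <= 4 * nrm k.*2.+3 t OO by rewrite TE; lra.
apply: le_trans (ler_wpM2r (ltW cd0) h7) _.
have := nrm_OO; rewrite -mulrA; lra.
Qed.

(* c1 z zb is the leading term of the Casoratian of ang ft and rad ft, and WW the
   remainder, of order 3 and small in norm. *)
Let bb := bet lam a ft.
Let JJ (u v : ser K) := u * pl v - pl u * v.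
Let c1 : K := om^-1 * (2 * (lam^-1 - lam)).
Let WW := casoratian lam bb (ang ft) (rad ft) - sC c1 * (sX K * sY K).
Definition betd2 := betd lam A t R2.

Lemma JJ_lin : JJ (lin 1 (- 1)) (lin 1 1) = sC (2 * (lam^-1 - lam)) * (sX K * sY K).
Proof.
have plX : pl (sX K) = sC lam * sX K.
  apply: serP => j l; rewrite cf_sCM cf_pl.
  by case: j l => [|[|j]] [|[|l]]; rewrite /= /fps2_lin /= ?mul0r ?mulr0 ?mulr1 ?mul1r.
have plY : pl (sY K) = sC lam^-1 * sY K.
  apply: serP => j l; rewrite cf_sCM cf_pl.
  by case: j l => [|[|j]] [|[|l]]; rewrite /= /fps2_lin /= ?mul0r ?mulr0 ?mulr1 ?mul1r.
rewrite /JJ !linE !(plD lam) !(plM lam) plX plY {1 2 3 4}/pl !sc_sC.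
rewrite !rmorphM rmorphB rmorphN rmorph1 rmorph_nat /=; ring.
Qed.

Lemma WW_E : WW = (bb - sC om^-1) * JJ (ang ft) (rad ft) +
  sC om^-1 * (JJ (ang ft) (rad ft) - JJ (lin 1 (- 1)) (lin 1 1)).
Proof. by rewrite JJ_lin /WW /c1 rmorphM /casoratian -/JJ /JJ; ring. Qed.

Lemma JJ_diff (u u' v v' : ser K) : JJ u v - JJ u' v' =
  (u - u') * pl v + u' * pl (v - v') - pl (u - u') * v - pl u' * (v - v').
Proof. by rewrite /JJ !(plB lam); ring. Qed.

Let lin1 (x y : K) : ord 1 (lin x y). Proof. exact: lin_ord. Qed.

Lemma WW_ord : ord 3 WW.
Proof.
rewrite WW_E; apply: ordD.
  apply: (@ordM _ 1 2).
    by apply/ord1P; rewrite cfB (bet00 lam0 nonres _ (nf_a0 nf) (nf_a2 nf)) /= subrr.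
  by apply: (@ordB _ 2); apply: (@ordM _ 1 1) => //; exact: pl_ord.
apply: ordMr; rewrite JJ_diff; apply: ordB; first apply: ordB; first apply: ordD.
- by apply: (@ordM _ 2 1); [exact: ang_ord2 | exact: pl_ord].
- by apply: (@ordM _ 1 2) => //; apply: pl_ord; exact: rad_ord2.
- by apply: (@ordM _ 2 1) => //; apply: pl_ord; exact: ang_ord2.
- by apply: (@ordM _ 1 2); [exact: pl_ord | exact: rad_ord2].
Qed.

Lemma nrm_JJ n (u v : ser K) x y : nrm n t u <= x -> nrm n t v <= y -> nrm n t (JJ u v) <= 2 * (x * y).
Proof.
move=> ux vy; apply: le_trans (nrmB _ t0 _ _ _) _.
have h1 : nrm n t (u * pl v) <= x * y.
  apply: le_trans (nrmM _ t0 _ _ _) _.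
  by rewrite nrm_pl//; apply: ler_pM; rewrite ?nrm_ge0.
have h2 : nrm n t (pl u * v) <= x * y.
  apply: le_trans (nrmM _ t0 _ _ _) _.
  by rewrite nrm_pl//; apply: ler_pM; rewrite ?nrm_ge0.
lra.
Qed.

Lemma nrm_WW : nrm k./2.*2.+2 t WW <= t ^+ 2 * (18 * betd2 + 10 * (wt^-1 ^+ 2 * nu)).
Proof.
set n := k./2.*2.+2.
have ru := nrm_ang n. have rv := nrm_rad n.
have l1 : nrm n t (lin 1 (- 1)) <= 2 * t.
  by apply: le_trans (nrm_lin _ _ _ _ t0) _; rewrite avN av1.
have kk : (k./2 <= p.+1)%N by rewrite -[X in (_ <= X)%N]k_split leq_addl.
have hb : nrm k./2.*2 t (bb - sC om^-1) <= betd2.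
  exact: (nrm_bet lam0 nonres Alam t_gt0 t3 nu_le1 e0 nue pe (nf_a_odd nf) (nf_a0 nf)
    (nf_a2 nf) (ft_ord nf k) ft_nu kk HR2).
have b1 : ord 1 (bb - sC om^-1).
  by apply/ord1P; rewrite cfB (bet00 lam0 nonres _ (nf_a0 nf) (nf_a2 nf)) /= subrr.
have J2 : ord 2 (JJ (ang ft) (rad ft)).
  by apply: ordB; apply: (@ordM _ 1 1) => //; exact: pl_ord.
have h1 : nrm n t ((bb - sC om^-1) * JJ (ang ft) (rad ft)) <= betd2 * (2 * (3 * t * (3 * t))).
  apply: le_trans (nrmM_ord A (n := n) (p := 0) t0 _ J2 _ _) _ => //.
  rewrite (_ : (n - 2)%N = k./2.*2) ?subn0; last by rewrite /n 2!subSS subn0.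
  by apply: ler_pM; [exact: nrm_ge0 | exact: nrm_ge0 | exact: hb | exact: nrm_JJ].
have h2 : nrm n t (JJ (ang ft) (rad ft) - JJ (lin 1 (- 1)) (lin 1 1)) <= 10 * (t ^+ 2 * nu).
  have -> : JJ (ang ft) (rad ft) - JJ (lin 1 (- 1)) (lin 1 1) =
     JJ (ang ft - lin 1 (- 1)) (rad ft) + JJ (lin 1 (- 1)) (rad ft - lin 1 1).
    by rewrite JJ_diff /JJ; ring.
  apply: le_trans (nrmD _ t0 _ _ _) _.
  apply: le_trans (lerD (nrm_JJ (ang_nu n) rv) (nrm_JJ l1 (rad_nu n))) _.
  by apply: ler_of_eq; ring.
rewrite WW_E; apply: le_trans (nrmD _ t0 _ _ _) _.
rewrite nrmC avV ?om_neq0// A_om//.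
have w2 : 0 <= (wt ^+ 2)^-1 by rewrite invr_ge0 exprn_ge0// ltW.
have h3 := ler_wpM2l w2 h2.
apply: le_trans (lerD h1 h3) _; rewrite exprVn; apply: ler_of_eq.
by move: (_^-1) => x; ring.
Qed.

(** The leading coefficient c1 of the Casoratian is inverted; the remainder WW times
    the tail is small because both are evaluated below their full degree. *)
Lemma tail_step : A c1 * cd * (degN k.*2.+1 f * (t ^+ 2) ^+ k) <=
  72 * k.*2.+2%:R ^+ sg * Gam2 + cd * (H * (18 * betd2 + 10 * (wt^-1 ^+ 2 * nu))).
Proof.
have tid : ord k.*2.+4 (hi * casoratian lam bb (ang ft) (rad ft) - TT) := tail_identity lam0 nf k0.
have hd : degN k.*2.+1 f = degN k.*2.+1 hi.
  apply: eq_degN => j l jl; rewrite cfB tr_cf0 ?subr0// jl; exact: mk.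
have h1 : degN k.*2.+3 (sC c1 * (sX K * (sY K * hi))) = A c1 * degN k.*2.+1 f.
  by rewrite degNC degN_sXM degN_sYM hd.
have h2 : A c1 * degN k.*2.+1 f <= degN k.*2.+3 TT + degN k.*2.+3 (hi * WW).
  rewrite -h1 (_ : sC c1 * _ = hi * casoratian lam bb (ang ft) (rad ft) - hi * WW); last by rewrite /WW; ring.
  apply: le_trans (degNB _ _ _ _) _; apply: lerD; last exact: lexx.
  by rewrite (degN_cong A tid).
have h3 : degN k.*2.+3 TT * t ^+ k.*2.+3 <= nrm k.*2.+3 t TT by exact: degN_le_nrm.
have h4 : degN k.*2.+3 (hi * WW) * t ^+ k.*2.+3 <= (t * H) * (t ^+ 2 * (18 * betd2 + 10 * (wt^-1 ^+ 2 * nu))).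
  apply: le_trans (degN_le_nrm A t0 _ (leqnn _)) _.
  apply: le_trans (nrmM_ord A t0 (@hi_ord K f k) WW_ord (leqW (leqW mk)) _) _ => //.
  rewrite (_ : (k.*2.+3 - 3)%N = k.*2); last by rewrite !subSS subn0.
  rewrite (_ : (k.*2.+3 - (uphalf k).*2.+1)%N = k./2.*2.+2); last first.
    by rewrite subSS -{1}k_split doubleD -addn2 -addnA addKn addn2.
  by apply: ler_pM; [exact: nrm_ge0 | exact: nrm_ge0 | exact: hiH | exact: nrm_WW].
have tp : 0 <= t ^+ k.*2.+3 by rewrite exprn_ge0.
have te : t ^+ k.*2.+3 = (t ^+ 2) ^+ k * t ^+ 3 by rewrite -exprM mul2n -exprD addn3.
have h5 := ler_wpM2r tp h2; rewrite mulrDl in h5.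
have h6 := le_trans h5 (lerD h3 h4).
have h7 := ler_wpM2r (ltW cd0) h6; rewrite mulrDl in h7.
have h8 := le_trans h7 (lerD nrm_TT (lexx _)).
have t3p : 0 < t ^+ 3 by rewrite exprn_gt0.
rewrite -(ler_pM2r t3p); move: h8; rewrite te.
move: (A c1) (degN _ f) (_ ^+ k) (_ ^+ sg) Gam2 betd2 (wt^-1 ^+ 2) => x1 x2 x3 x4 x5 x6 x7 h8.
apply: le_trans (le_trans _ h8) _; apply: ler_of_eq; ring.
Qed.
End Step.

(** * Sums of weights *)

Section Weights.
Variable R : realFieldType.

Lemma bernoulli (x : R) n : 0 <= x -> 1 + n%:R * x <= (1 + x) ^+ n.
Proof.
move=> x0; elim: n => [|n IH]; first by rewrite mul0r addr0 expr0.
rewrite exprS; apply: le_trans (ler_wpM2l (_ : 0 <= 1 + x) IH); last by rewrite addr_ge0.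
have n0 : 0 <= n%:R :> R by []; rewrite -natr1; have := mulr_ge0 n0 (mulr_ge0 x0 x0); nra.
Qed.

(** From (1 + x)^q <= 2 with x = 1/(2q), and Bernoulli's inequality. *)
Lemma pow_le_exp2 q i : (0 < q)%N -> i.+1%:R ^+ q <= (2 * q)%:R ^+ q * 2 ^+ i :> R.
Proof.
move=> q0; set x : R := (2 * q)%:R^-1.
have q20 : 0 < (2 * q)%:R :> R by rewrite ltr0n muln_gt0.
have x0 : 0 <= x by rewrite invr_ge0 ltW.
have qx : q%:R * x <= 2^-1.
  rewrite /x natrM invfM mulrCA mulfV ?mulr1// pnatr_eq0 -lt0n//.
have [h1 _] := exp1De x0 qx.
have h2 : i.+1%:R <= (2 * q)%:R * (1 + x) ^+ i.
  apply: le_trans (ler_wpM2l (ltW q20) (bernoulli i x0)).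
  rewrite mulrDr mulr1 mulrCA mulfV ?gt_eqF// mulr1 -natrD ler_nat -[i.+1]add1n.
  by rewrite leq_add2r muln_gt0.
have h3 : i.+1%:R ^+ q <= ((2 * q)%:R * (1 + x) ^+ i) ^+ q.
  by apply: lerXn2r; rewrite ?nnegrE// mulr_ge0 ?exprn_ge0 ?addr_ge0// ltW.
apply: le_trans h3 _; rewrite exprMn; apply: ler_wpM2l; first by rewrite exprn_ge0 ?ltW.
rewrite -exprM mulnC exprM; apply: lerXn2r; rewrite ?nnegrE ?exprn_ge0 ?addr_ge0//.
Qed.

Definition Zc q : R := 2 * (2 * q)%:R ^+ q.

Lemma Zc_ge1 q : (0 < q)%N -> 1 <= Zc q.
Proof.
move=> q0; rewrite /Zc -natrX -natrM ler1n muln_gt0 expn_gt0 muln_gt0 q0//.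
Qed.

Lemma sum_poly_geom q N : (0 < q)%N -> \sum_(i < N) i.+1%:R ^+ q * 4^-1 ^+ i <= Zc q.
Proof.
move=> q0.
apply: (@le_trans _ _ (\sum_(i < N) (2 * q)%:R ^+ q * 2^-1 ^+ i)).
  apply: ler_sum => i _; apply: le_trans (ler_wpM2r _ (pow_le_exp2 i q0)) _.
    by rewrite exprn_ge0.
  rewrite -mulrA -exprMn (_ : 2 * 4^-1 = 2^-1 :> R)//; lra.
rewrite -mulr_sumr /Zc mulrC; apply: ler_wpM2r; first by rewrite exprn_ge0.
suff H : \sum_(i < N) 2^-1 ^+ i <= 2 - 2 * 2^-1 ^+ N :> R.
  apply: le_trans H _; have : 0 <= 2^-1 ^+ N :> R by rewrite exprn_ge0.
  lra.
elim: N => [|N IH]; first by rewrite big_ord0 expr0; lra.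
rewrite big_ord_recr /= exprS; lra.
Qed.

Lemma sum_inv_sqr N : \sum_(r < N) (r.+2%:R ^+ 2)^-1 <= 1 :> R.
Proof.
suff H : \sum_(r < N) (r.+2%:R ^+ 2)^-1 <= 1 - N.+1%:R^-1 :> R.
  by apply: le_trans H _; rewrite gerBl invr_ge0.
elim: N => [|N IH]; first by rewrite big_ord0 invr1 subrr.
rewrite big_ord_recr /=; apply: le_trans (lerD IH (lexx _)) _.
suff h : (N.+2%:R ^+ 2)^-1 <= N.+1%:R^-1 - N.+2%:R^-1 :> R.
  by apply: le_trans (lerD (lexx _) h) _; rewrite addrA subrK.
have n1 : 0 < N.+1%:R :> R by rewrite ltr0n.
have n2 : 0 < N.+2%:R :> R by rewrite ltr0n.
have -> : N.+1%:R^-1 - N.+2%:R^-1 = (N.+1%:R * N.+2%:R)^-1 :> R.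
  rewrite -[N.+2]addn1 natrD; field.
  by rewrite gt_eqF//= -natrD addn1 pnatr_eq0.
rewrite expr2 lef_pV2 ?posrE ?mulr_gt0//; apply: ler_wpM2r; first exact: ltW.
by rewrite ler_nat.
Qed.

(** The weight carried by the j-th coefficient at the radius adapted to degree k. *)
Definition wgt k j : R := (j.+1%:R / k%:R) ^+ j.+1.*2.

Lemma wgt_ge0 k j : 0 <= wgt k j.
Proof. by rewrite exprn_ge0// divr_ge0. Qed.

(** Bernoulli's inequality for (p+1)/(j+1) = 1 + (p-j)/(j+1). *)
Lemma wgt_near p j : (j < p.+1)%N -> wgt p.+1 j <= ((p.+1 - j)%:R ^+ 2)^-1.
Proof.
move=> jp; rewrite /wgt -mul2n mulnC exprM.
have pj : (p.+1 - j.+1 + j.+1)%N = p.+1 by rewrite subnK.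
have r0 : 0 < j.+1%:R :> R by rewrite ltr0n.
have k0 : 0 < p.+1%:R :> R by rewrite ltr0n.
have B := bernoulli j.+1 (_ : 0 <= (p.+1 - j.+1)%:R / j.+1%:R :> R).
have {}B : (p.+1 - j)%:R <= (p.+1%:R / j.+1%:R) ^+ j.+1 :> R.
  have -> : p.+1%:R / j.+1%:R = 1 + (p.+1 - j.+1)%:R / j.+1%:R :> R.
    by rewrite -{1}pj natrD mulrDl mulfV ?gt_eqF// addrC.
  apply: le_trans (B _); last by rewrite divr_ge0.
  rewrite mulrCA mulfV ?gt_eqF// mulr1 -[1]/(1%:R) -natrD ler_nat; lia.
have n0 : 0 < (p.+1 - j)%:R :> R by rewrite ltr0n subn_gt0.
rewrite -[X in X <= _]invrK lef_pV2 ?posrE ?invr_gt0 ?exprn_gt0 ?divr_gt0//.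
rewrite -!exprVn invf_div; apply: lerXn2r; rewrite ?nnegrE ?exprn_ge0 ?divr_ge0//.
Qed.

Lemma wgt_far k j : (j.+1 <= k./2)%N -> wgt k j <= 4^-1 ^+ j.+1.
Proof.
move=> jk; rewrite /wgt -mul2n exprM; apply: lerXn2r; rewrite ?nnegrE ?exprn_ge0 ?divr_ge0//.
have k0 : (0 < k)%N by case: k jk.
rewrite (_ : 4^-1 = 2^-1 ^+ 2 :> R); last by lra.
apply: lerXn2r; rewrite ?nnegrE ?divr_ge0//.
rewrite ler_pdivrMr ?ltr0n// mulrC ler_pdivlMr// -natrM ler_nat muln2.
by rewrite -geq_half_double.
Qed.

Lemma sum_wgt_near p : \sum_(j < p) wgt p.+1 j <= 1.
Proof.
apply: le_trans (sum_inv_sqr p); rewrite [X in _ <= X](reindex_inj rev_ord_inj) /=.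
apply: ler_sum => -[j jp] _ /=; apply: le_trans (wgt_near _) _; first exact: ltnW.
by rewrite (_ : (p.+1 - j)%N = (p - j.+1).+2)//; lia.
Qed.
End Weights.

(** * Arithmetic of the constants *)

(** In this part x is the index k of the step, ci = 1/C, F0 and F are the constants in
    the bounds of q and phi, y bounds 1/wt and Z bounds the sums over low
    degrees.  The powers of x cancel against those gained from the radius, and
    the factor ci, or ci^2, is left over to absorb the constants. *)
Section Arith.
Variable R : realFieldType.

Lemma gam_arith (Rs nu rho w y ci x F0 F Z : R) :
  0 <= Rs -> 0 <= nu -> 0 <= rho -> 0 <= w -> 0 <= ci -> 0 <= F0 -> 0 <= F -> 0 <= Z ->
  Rs <= 2 * F0 * ci * x ^+ 3 -> nu * x ^+ 2 <= 3 * F * Z * ci -> rho * x ^+ 2 = ci ->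
  w <= y -> 1 <= y -> 1 <= x ->
  x * (Rs * nu) <= 6 * F0 * F * Z * ci ^+ 2 * x ^+ 2 /\
  w * (Rs * (2 * (2 * x * (nu * w))) + (4 + Rs) * (18 * rho)) + rho * (2 + Rs) * 12 + 27 * rho
  <= 123 * y * ci + ci ^+ 2 * F0 * x ^+ 2 * (24 * F * Z * y ^+ 2 + 60 * y).
Proof.
move=> R0 n0 r0 w0 c0 F00 Fp Zp hR hn hr wy y1 x1.
have x0 : 0 <= x by lra. have y0 : 0 <= y by lra.
have x12 : 1 <= x ^+ 2 by rewrite exprn_ege1.
have h1 : x * (Rs * nu) <= 6 * F0 * F * Z * ci ^+ 2 * x ^+ 2.
  have a1 : x * (Rs * nu) <= (2 * F0 * ci * x ^+ 2) * (nu * x ^+ 2).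
    rewrite (_ : _ * _ * (nu * _) = x * ((2 * F0 * ci * x ^+ 3) * nu)); last by ring.
    by rewrite ler_wpM2l// ler_wpM2r.
  apply: le_trans a1 _.
  apply: le_trans (ler_wpM2l _ hn) _; first by rewrite !mulr_ge0 ?exprn_ge0.
  by apply: ler_of_eq; ring.
have h2 : Rs * rho <= 2 * F0 * ci ^+ 2 * x ^+ 2.
  have a1 : Rs * rho <= 2 * F0 * ci * x * (rho * x ^+ 2).
    rewrite (_ : _ * (rho * _) = (2 * F0 * ci * x ^+ 3) * rho); last by ring.
    by rewrite ler_wpM2r.
  apply: le_trans a1 _; rewrite hr.
  rewrite (_ : 2 * F0 * ci * x * ci = 2 * F0 * ci ^+ 2 * x); last by ring.
  by rewrite ler_wpM2l ?mulr_ge0 ?exprn_ge0// expr2 ler_peMl.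
have h3 : rho <= ci by rewrite -hr ler_peMr.
split=> //.
have h4 : w * w * (x * (Rs * nu)) <= y * y * (6 * F0 * F * Z * ci ^+ 2 * x ^+ 2).
  by apply: ler_pM; rewrite ?mulr_ge0//; apply: ler_pM.
have h5 : w * (Rs * rho) <= y * (2 * F0 * ci ^+ 2 * x ^+ 2) by apply: ler_pM; rewrite ?mulr_ge0.
have h6 : w * rho <= y * ci by apply: ler_pM.
have h7 : ci <= y * ci by rewrite ler_peMl.
have p0 : 0 <= 2 * F0 * ci ^+ 2 * x ^+ 2 by rewrite !mulr_ge0 ?exprn_ge0.
have h8 : 2 * F0 * ci ^+ 2 * x ^+ 2 <= y * (2 * F0 * ci ^+ 2 * x ^+ 2) by rewrite ler_peMl.
rewrite (_ : w * _ + _ + _ = 4 * (w * w * (x * (Rs * nu))) + 72 * (w * rho) + 18 * (w * (Rs * rho)) + 51 * rho + 12 * (Rs * rho)); last by ring.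
rewrite (_ : _ + _ * (_ + _) = 4 * (y * y * (6 * F0 * F * Z * ci ^+ 2 * x ^+ 2)) + 72 * (y * ci) + 18 * (y * (2 * F0 * ci ^+ 2 * x ^+ 2)) + 51 * (y * ci) + 12 * (y * (2 * F0 * ci ^+ 2 * x ^+ 2))); last by ring.
lra.
Qed.

Lemma coef_arith (G nu Rs w y ci x F0 F Z : R) :
  0 <= Rs -> 0 <= nu -> 0 <= w -> 0 <= ci -> 0 <= F0 -> 0 <= F -> 0 <= Z -> 0 <= G ->
  nu <= 1 -> w <= y -> 1 <= y -> 1 <= x ->
  x * (Rs * nu) <= 6 * F0 * F * Z * ci ^+ 2 * x ^+ 2 ->
  G <= 123 * y * ci + ci ^+ 2 * F0 * x ^+ 2 * (24 * F * Z * y ^+ 2 + 60 * y) ->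
  738 * y <= F0 -> 2 * (72 * F * Z * y ^+ 2 + 180 * y + 6 * F * Z * y) * ci <= 1 ->
  G <= F0 * ci * x ^+ 2 /\ 2 * G + nu * (w * Rs + G) <= F0 * ci * x ^+ 2.
Proof.
move=> R0 n0 w0 c0 F00 Fp Zp G0 n1 wy y1 x1 h1 hG hF hC.
have x0 : 0 <= x by lra. have y0 : 0 <= y by lra.
have x12 : 1 <= x ^+ 2 by rewrite exprn_ege1.
have a1 : nu * G <= G by rewrite ler_piMl.
have a2 : nu * (w * Rs) <= y * (6 * F0 * F * Z * ci ^+ 2 * x ^+ 2).
  rewrite (_ : _ * _ = w * (1 * (Rs * nu))); last by ring.
  apply: ler_pM; rewrite ?mulr_ge0//; apply: le_trans _ h1.
  by apply: ler_wpM2r => //; rewrite mulr_ge0.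
have fcx : 0 <= F0 * ci * x ^+ 2 by rewrite !mulr_ge0 ?exprn_ge0.
have a3 : 369 * y * ci <= 2^-1 * (F0 * ci * x ^+ 2).
  apply: (@le_trans _ _ (2^-1 * (F0 * ci))).
    by rewrite mulrA; apply: ler_wpM2r => //; lra.
  by rewrite ler_wpM2l// ler_peMr// mulr_ge0.
have a4 := ler_wpM2l fcx hC.
have a5 : F0 * ci * x ^+ 2 * ((72 * F * Z * y ^+ 2 + 180 * y + 6 * F * Z * y) * ci) <= 2^-1 * (F0 * ci * x ^+ 2) by lra.
have key : 3 * G + y * (6 * F0 * F * Z * ci ^+ 2 * x ^+ 2) <= F0 * ci * x ^+ 2.
  apply: le_trans (lerD (ler_wpM2l _ hG) (lexx _)) _ => //.
  rewrite [X in X <= _](_ : _ = 369 * y * ci + F0 * ci * x ^+ 2 * ((72 * F * Z * y ^+ 2 + 180 * y + 6 * F * Z * y) * ci)); last by ring.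
  lra.
have p0 : 0 <= y * (6 * F0 * F * Z * ci ^+ 2 * x ^+ 2) by rewrite !mulr_ge0 ?exprn_ge0.
by split; lra.
Qed.

Lemma tail_arith (k1 ff c1cd sgx Gam2 cd H betd w nu R2 rho y ci x F0 F Z s4 xs : R) :
  0 <= ff -> k1 <= c1cd -> 0 < k1 -> 0 <= nu -> 0 <= w -> 0 <= ci -> ci <= 1 -> 0 <= F0 -> 0 <= F -> 0 <= Z ->
  0 <= R2 -> 0 <= rho -> 0 < cd -> 0 <= H -> 0 <= xs -> 0 <= s4 -> 0 <= Gam2 ->
  w <= y -> 1 <= y -> 1 <= x -> rho <= ci -> R2 <= 4 * F0 * Z * ci -> nu <= 3 * F * Z * ci ->
  H <= F * ci * (xs * x ^+ 3) -> Gam2 <= 7 * y * F0 * ci * x ^+ 3 -> sgx <= s4 * xs ->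
  betd = w ^+ 2 * R2 + rho * (2 + R2) + 9 * (w ^+ 2 * rho) ->
  1008 * s4 * y * F0 <= k1 * F ->
  2 * cd * (18 * (4 * F0 * Z * y ^+ 2 + 2 + 4 * F0 * Z + 9 * y ^+ 2) + 30 * y ^+ 2 * F * Z) * ci <= k1 ->
  c1cd * ff <= 72 * sgx * Gam2 + cd * (H * (18 * betd + 10 * (w ^+ 2 * nu))) ->
  ff <= F * ci * (xs * x ^+ 3).
Proof.
move=> f0 kc k0 n0 w0 c0 c1 F00 Fp Zp R20 r0 cd0 H0 xs0 s40 g0 wy y1 x1 hrho hR2 hnu hH hG hs hb hF hC main.
have x0 : 0 <= x by lra. have y0 : 0 <= y by lra.
have ww : w ^+ 2 <= y ^+ 2 by apply: lerXn2r; rewrite ?nnegrE.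
have w20 : 0 <= w ^+ 2 by rewrite exprn_ge0. have y20 : 0 <= y ^+ 2 by rewrite exprn_ge0.
have b1 : w ^+ 2 * R2 <= y ^+ 2 * (4 * F0 * Z * ci) by apply: ler_pM.
have b2 : w ^+ 2 * rho <= y ^+ 2 * ci by apply: ler_pM.
have b3 : rho * R2 <= ci * (4 * F0 * Z).
  apply: ler_pM => //; apply: le_trans hR2 _.
  by rewrite ler_piMr// !mulr_ge0.
have b4 : w ^+ 2 * nu <= y ^+ 2 * (3 * F * Z * ci) by apply: ler_pM.
have hB : 18 * betd + 10 * (w ^+ 2 * nu) <=
  (18 * (4 * F0 * Z * y ^+ 2 + 2 + 4 * F0 * Z + 9 * y ^+ 2) + 30 * y ^+ 2 * F * Z) * ci.
  by rewrite hb; lra.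
have B0 : 0 <= 18 * betd + 10 * (w ^+ 2 * nu).
  by rewrite hb !addr_ge0 ?mulr_ge0 ?addr_ge0 ?mulr_ge0 ?addr_ge0.
set X := xs * x ^+ 3 in hH *.
have X0 : 0 <= X by rewrite mulr_ge0 ?exprn_ge0.
have m1 : 72 * sgx * Gam2 <= 504 * s4 * y * F0 * ci * X.
  apply: le_trans (ler_wpM2r g0 (ler_wpM2l (_ : 0 <= 72) hs)) _ => //.
  apply: le_trans (ler_wpM2l _ hG) _; first by rewrite !mulr_ge0.
  by rewrite /X; apply: ler_of_eq; ring.
have fcX : 0 <= F * ci * X by rewrite !mulr_ge0.
have m2 : cd * (H * (18 * betd + 10 * (w ^+ 2 * nu))) <= 2^-1 * k1 * (F * ci * X).
  have e1 : H * (18 * betd + 10 * (w ^+ 2 * nu)) <= (F * ci * X) *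
    ((18 * (4 * F0 * Z * y ^+ 2 + 2 + 4 * F0 * Z + 9 * y ^+ 2) + 30 * y ^+ 2 * F * Z) * ci).
    by apply: ler_pM.
  apply: le_trans (ler_wpM2l (ltW cd0) e1) _.
  have := ler_wpM2l fcX hC; lra.
have m3 : 504 * s4 * y * F0 * ci * X <= 2^-1 * k1 * (F * ci * X).
  have cX : 0 <= ci * X by rewrite mulr_ge0.
  have := ler_wpM2r cX hF; lra.
have fin : k1 * ff <= k1 * (F * ci * X).
  apply: le_trans (ler_wpM2r f0 kc) _; apply: le_trans main _; lra.
by move: fin; rewrite ler_pM2l.
Qed.
End Arith.

(** * The induction on the degree *)

Section Induction.
Variable K : numClosedFieldType.
Variable lam : K.
Hypothesis lam0 : lam != 0.
Hypothesis nonres : forall n, (0 < n)%N -> lam ^+ n != 1.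
Variables (R : realFieldType) (A : absval K R).
Hypothesis Alam : A lam = 1.
Local Notation nrm := (nrm A).
Local Notation degN := (degN A).
Local Notation EE := (EE lam).
Local Notation wt := (wt lam A).
Local Notation rr := (rr lam A).
Variables (a : fps1 K) (f : ser K).
Hypothesis nf : normal_form lam a f.
Hypothesis E0 : EE a f = 0.
Variables (cd : R) (sg : nat).
Hypothesis cd0 : 0 < cd.
Hypothesis dio : forall i, (0 < i)%N -> cd <= A (lam ^+ i - 1) * i%:R ^+ sg.

Let w0 : 0 < wt. Proof. exact: wt_gt0. Qed.

Section Step.
Variable p : nat.
Local Notation k := p.+1.
Local Notation kk := (k./2).
Variable t : R.
Hypothesis t_gt0 : 0 < t.
Let t0 : 0 <= t. Proof. exact: ltW. Qed.
Let tt0 : 0 <= t ^+ 2. Proof. exact: sqr_ge0. Qed.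

(** Bounds, relatively to the radius, for the Euler derivatives of the lower half
    of phi without its linear part, and for the tail in the degrees known so far. *)
Definition nuq := \sum_(i < kk) i.*2.+3%:R * (degN i.*2.+3 f * (t ^+ 2) ^+ i.+1).
Definition Hq := \sum_(i < p) degN i.*2.+3 f * (t ^+ 2) ^+ i.+1.

Let todd i : t ^+ i.*2.+3 = t * (t ^+ 2) ^+ i.+1.
Proof. by rewrite -exprM mul2n -exprS. Qed.

Let odd_zero (g : ser K) d : (forall j l, ~~ odd (j + l) -> g j l = 0) -> ~~ odd d -> degN d g = 0.
Proof.
move=> g0 od; apply: big1 => -[j jd] _ /=; rewrite g0 ?av0// subnKC//.
Qed.

Lemma nrm_nuq (g : ser K) n : ord 2 g -> (forall j l, ~~ odd (j + l) -> g j l = 0) ->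
  (forall j l, (kk.*2.+2 <= j + l)%N -> g j l = 0) ->
  (forall i, degN i.*2.+3 g <= i.*2.+3%:R * degN i.*2.+3 f) ->
  nrm n t g <= t * nuq.
Proof.
move=> g2 godd gtop gf; pose x i := degN i g * t ^+ i.
have x0 i : 0 <= x i by rewrite mulr_ge0 ?degN_ge0 ?exprn_ge0.
have xtop i : (kk.*2.+2 <= i)%N -> x i = 0.
  move=> ki; rewrite /x [degN _ _]big1 ?mul0r// => -[j ji] _ /=.
  by rewrite gtop ?av0// subnKC.
apply: le_trans (ler_sum_widen x0 (_ : (n.+1 <= (kk.+1 + n).*2)%N)) _; first by lia.
rewrite sum_odd => [|i io]; last by rewrite /x odd_zero ?mul0r.
rewrite big_split_ord /= [X in _ + X]big1 ?addr0 => [|i _]; last first.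
  by apply: xtop; rewrite -[kk.*2.+2]doubleS ltnW// ltnS leq_double leq_addr.
rewrite big_ord_recl {1}/x (degN_ord _ g2)// mul0r add0r /nuq mulr_sumr.
apply: ler_sum => -[i ik] _; rewrite lift0 [nat_of_ord _]/= /x doubleS todd.
rewrite (_ : t * (_ * (_ * _)) = i.*2.+3%:R * degN i.*2.+3 f * (t * (t ^+ 2) ^+ i.+1)); last first.
  by move: (_%:R) (degN _ _) (_ ^+ i.+1) => *; ring.
by apply: ler_wpM2r => //; rewrite mulr_ge0 ?exprn_ge0.
Qed.

Let lin_odd (x y : K) j l : ~~ odd (j + l) -> lin x y j l = 0.
Proof. by case: j l => [|[|j]] [|[|l]]. Qed.
Let lin_top (x y : K) j l : (2 <= j + l)%N -> lin x y j l = 0.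
Proof. by case: j l => [|[|j]] [|[|l]]. Qed.
Let degN_sub_lin (g : ser K) x y i : degN i.*2.+3 (g - lin x y) = degN i.*2.+3 g.
Proof. by apply: eq_degN => j l jl; rewrite cfB lin_top ?subr0// jl. Qed.

Let i0kk : (uphalf k <= kk.+1)%N.
Proof. by rewrite uphalf_half; case: (odd k). Qed.

Lemma lo_nuq n : nrm n t (lo f k - lin 1 1) <= t * nuq.
Proof.
apply: nrm_nuq; first exact: (lo_ord2 nf).
- by move=> j l jl; rewrite cfB lin_odd// subr0 /= (nf_f_even nf)// if_same.
- move=> j l jl; rewrite cfB lin_top ?subr0; last by apply: leq_trans jl.
  have [oj|ej] := boolP (odd (j + l)); last by rewrite /= (nf_f_even nf)// if_same.
  rewrite tr_cf0//; move: jl; rewrite leq_eqVlt => /orP[/eqP e|jl].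
    by move: oj; rewrite -e /= negbK odd_double.
  by apply: leq_trans jl; rewrite ltnS -[kk.*2.+2]doubleS leq_double.
- move=> i; rewrite degN_sub_lin degN_tr; case: ifP => _.
    by rewrite ler_peMl ?degN_ge0// ler1n.
  by rewrite mulr_ge0 ?degN_ge0.
Qed.

Let degN_eul (w : nat -> nat -> K) d : (forall j l, (j + l = d)%N -> A (w j l) <= d%:R) ->
  degN d (eul w f) <= d%:R * degN d f.
Proof.
move=> wd; rewrite mulr_sumr; apply: ler_sum => -[j jd] _ /=.
by rewrite avM ler_wpM2r ?av_ge0// wd// subnKC.
Qed.

Let tr_kk (g : ser K) j l : (kk.*2.+2 <= j + l)%N -> tr kk.*2.+2 g j l = 0.
Proof. exact: tr_cf0. Qed.

Let tr_nuq (w : nat -> nat -> K) x y n : (forall j l, A (w j l) <= (j + l)%:R) ->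
  ord 2 (tr kk.*2.+2 (eul w f) - lin x y) ->
  nrm n t (tr kk.*2.+2 (eul w f) - lin x y) <= t * nuq.
Proof.
move=> wd w2; apply: nrm_nuq => //.
- by move=> j l jl; rewrite cfB lin_odd// subr0 /= (nf_f_even nf)// mulr0 if_same.
- by move=> j l jl; rewrite cfB tr_kk// lin_top ?subr0//; apply: leq_trans jl.
- move=> i; rewrite degN_sub_lin degN_tr; case: ifP => _; last by rewrite mulr_ge0 ?degN_ge0.
  by apply: degN_eul => j l <-.
Qed.

Lemma ft_nuq n : nrm n t (ft f k - lin 1 1) <= t * nuq.
Proof.
apply: nrm_nuq; first exact: (ft_ord2 nf).
- by move=> j l jl; rewrite cfB lin_odd// subr0 /= (nf_f_even nf)// if_same.
- by move=> j l jl; rewrite cfB tr_kk// lin_top ?subr0//; apply: leq_trans jl.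
- move=> i; rewrite degN_sub_lin degN_tr; case: ifP => _.
    by rewrite ler_peMl ?degN_ge0// ler1n.
  by rewrite mulr_ge0 ?degN_ge0.
Qed.
Lemma ang_nuq n : nrm n t (ang (ft f k) - lin 1 (- 1)) <= t * nuq.
Proof.
rewrite /ang /ft eul_tr; apply: tr_nuq.
  by move=> j l; apply: le_trans (avD _ _ _) _; rewrite avN !av_nat natrD.
by rewrite -eul_tr; exact: (ang_ord2 nf).
Qed.
Lemma rad_nuq n : nrm n t (rad (ft f k) - lin 1 1) <= t * nuq.
Proof.
rewrite /rad /ft eul_tr; apply: tr_nuq.
  by move=> j l; apply: le_trans (avD _ _ _) _; rewrite !av_nat natrD.
by rewrite -eul_tr; exact: (rad_ord2 nf).
Qed.

Lemma hi_Hq : nrm k.*2 t (hi f k) <= t * Hq.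
Proof.
have hodd j l : ~~ odd (j + l) -> hi f k j l = 0.
  by move=> jl; rewrite cfB /= (nf_f_even nf)// if_same subrr.
rewrite nrmE big_ord_recr /= (odd_zero hodd) ?odd_double// mul0r addr0.
rewrite (@sum_odd _ (fun i => degN i (hi f k) * t ^+ i)) => [|i io]; last by rewrite odd_zero ?mul0r.
rewrite big_ord_recl (degN_ord _ (@hi_ord K f k)) ?mul0r ?add0r; last by rewrite ltnS double_gt0.
rewrite /Hq mulr_sumr; apply: ler_sum => -[i ik] _; rewrite lift0 [nat_of_ord _]/= doubleS todd.
rewrite [t * (_ * _)]mulrCA; apply: ler_wpM2r; first by rewrite mulr_ge0 ?exprn_ge0.
apply: ler_sum => j _; rewrite cfB /=; case: ifP => _; last by rewrite subr0.
by rewrite subrr av0 av_ge0.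
Qed.
End Step.

Let nat4 j : (j.*2.+4 <= 4 * j.+1)%N. Proof. by lia. Qed.
Let nat42 j : (j.+1.*2.+2 <= 4 * j.+1)%N. Proof. by lia. Qed.
Let nat3 j : (j.*2.+3 <= 3 * j.+1)%N. Proof. by lia. Qed.

Variables (y Z E F C0 : R).
Let C := C0 ^+ 2.
Let k1 := 2^-1 * (cd / 2 ^+ sg) * cd.
Hypothesis y1 : 1 <= y.
Hypothesis wy : wt^-1 <= y.
Hypothesis Z1 : 1 <= Z.
Hypothesis HZ : forall N, \sum_(i < N) i.+1%:R ^+ (sg + 6) * 4^-1 ^+ i <= Z.
Hypothesis E1 : 738 * y <= E.
Hypothesis F1 : 1 <= F.
Hypothesis EF : 1008 * 4 ^+ sg * y * E <= k1 * F.
Hypothesis C3 : 3 <= C0.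
Hypothesis C1 : 12 * F * Z * y <= C.
Hypothesis C2 : 2 * (72 * F * Z * y ^+ 2 + 180 * y + 6 * F * Z * y) <= C.
Hypothesis C4 : 2 * cd * (18 * (4 * E * Z * y ^+ 2 + 2 + 4 * E * Z + 9 * y ^+ 2) + 30 * y ^+ 2 * F * Z) <= k1 * C.

(** The exponents 2j+4 = 2(j+1)+2 and 2j+2+sg+3 exceed the essential 2(j+1) by
    fixed amounts; those keep track of the derivatives of q and of the small
    divisor lost in a step. *)
Definition bound_a j := rr a j.+1 <= E * C ^+ j * j.+1%:R ^+ j.*2.+4.
Definition bound_f j := degN j.*2.+3 f <= F * C ^+ j * j.+1%:R ^+ (j.*2.+2 + (sg + 3)).

Section Inductive.
Variable p : nat.
Hypothesis IHa : forall j, (j < p)%N -> bound_a j.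
Hypothesis IHf : forall j, (j < p)%N -> bound_f j.
Local Notation k := p.+1.
Local Notation kk := (k./2).
Let x : R := k%:R.
Let t : R := (C0 * x)^-1.
Let ci : R := C^-1.

Let x1 : 1 <= x. Proof. by rewrite /x ler1n. Qed.
Let x0 : 0 < x. Proof. by apply: lt_le_trans x1. Qed.
Let C00 : 0 < C0. Proof. by apply: lt_le_trans C3; rewrite ltr0n. Qed.
Let Cp : 0 < C. Proof. by rewrite exprn_gt0. Qed.
Let ci0 : 0 < ci. Proof. by rewrite invr_gt0. Qed.
Let t_gt0 : 0 < t. Proof. by rewrite invr_gt0 mulr_gt0. Qed.
Let y0 : 0 < y. Proof. by apply: lt_le_trans y1. Qed.
Let Z0 : 0 < Z. Proof. by apply: lt_le_trans Z1. Qed.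
Let F0 : 0 < F. Proof. by apply: lt_le_trans F1. Qed.
Let E0' : 0 < E. Proof.
have h : 0 < 738 :> R by rewrite ltr0n.
exact: lt_le_trans (mulr_gt0 h y0) E1.
Qed.
Let t3 : 3 * t <= 1.
Proof.
rewrite /t ler_pdivrMr ?mulr_gt0// mul1r; apply: le_trans C3 _.
by rewrite ler_peMr// ltW.
Qed.
Let tt : t ^+ 2 = ci / x ^+ 2.
Proof. by rewrite /t exprVn exprMn invfM. Qed.

Let rho_x : t ^+ 2 * x ^+ 2 = ci.
Proof. by rewrite tt mulfVK// expf_neq0// gt_eqF. Qed.

Let rhoXS j : (ci / x ^+ 2) ^+ j.+1 = ci * ci ^+ j / x ^+ j.*2.+2.
Proof. by rewrite expr_div_n -exprM mul2n doubleS exprS. Qed.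

Let scale (M c : R) j q : c <= M * C ^+ j * j.+1%:R ^+ (j.*2.+2 + q) ->
  c * (t ^+ 2) ^+ j.+1 <= M * ci * (j.+1%:R ^+ q * wgt R k j).
Proof.
move=> h; apply: le_trans (ler_wpM2r _ h) _; first by rewrite exprn_ge0 ?sqr_ge0.
rewrite tt /wgt rhoXS expr_div_n exprD -/x.
apply: ler_of_eq.
have e : C ^+ j * ci ^+ j = 1 by rewrite -exprMn mulfV ?expr1n// gt_eqF.
rewrite -[RHS]mulr1 -e; move: (C ^+ j) (ci ^+ j) (_ ^+ j.*2.+2) (_ ^+ q) (_ ^- _) => *; ring.
Qed.

Let ra j : (j < p)%N -> rr a j.+1 * (t ^+ 2) ^+ j.+1 <= E * ci * (j.+1%:R ^+ 2 * wgt R k j).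
Proof. by move=> jp; apply: scale; rewrite addn2; exact: IHa. Qed.
Let rf j : (j < p)%N -> degN j.*2.+3 f * (t ^+ 2) ^+ j.+1 <= F * ci * (j.+1%:R ^+ (sg + 3) * wgt R k j).
Proof. by move=> jp; apply: scale; exact: IHf. Qed.

Let Rs := \sum_(j < p) j.*2.+4%:R * (rr a j.+1 * (t ^+ 2) ^+ j.+1).
Let R2 := \sum_(j < kk) j.*2.+4%:R ^+ 2 * (rr a j.+1 * (t ^+ 2) ^+ j.+1).
Let nu := nuq p t.
Let H := Hq p t.

Let rp0 j : 0 <= rr a j.+1 * (t ^+ 2) ^+ j.+1.
Proof. by apply: mulr_ge0; [exact: rr_ge0 | rewrite exprn_ge0 ?sqr_ge0]. Qed.
Let fp0 j : 0 <= degN j.*2.+3 f * (t ^+ 2) ^+ j.+1.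
Proof. by apply: mulr_ge0; [exact: degN_ge0 | rewrite exprn_ge0 ?sqr_ge0]. Qed.

Let Rs0 : 0 <= Rs. Proof. by apply: sumr_ge0 => j _; exact: mulr_ge0. Qed.
Let R20 : 0 <= R2. Proof. by apply: sumr_ge0 => j _; apply: mulr_ge0 => //; exact: sqr_ge0. Qed.
Let nu0 : 0 <= nu. Proof. by apply: sumr_ge0 => j _; exact: mulr_ge0. Qed.
Let H0 : 0 <= H. Proof. by apply: sumr_ge0 => j _; exact: fp0. Qed.

Let near (M : R) q (c : nat -> R) : 0 <= M ->
  (forall j, (j < p)%N -> c j <= M * (j.+1%:R ^+ q * wgt R k j)) ->
  \sum_(j < p) c j <= M * x ^+ q.
Proof.
move=> M0 hc; apply: (@le_trans _ _ (\sum_(j < p) M * x ^+ q * wgt R k j)).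
  apply: ler_sum => -[j jp] _ /=; apply: le_trans (hc _ jp) _.
  rewrite -mulrA; apply: ler_wpM2l => //; apply: ler_wpM2r; first exact: wgt_ge0.
  by apply: lerXn2r; rewrite ?nnegrE ?(ltW x0)// /x ler_nat ltnW.
by rewrite -mulr_sumr ler_piMr ?sum_wgt_near// mulr_ge0 ?exprn_ge0// ltW.
Qed.

(** The weights sum to at most 1 and the powers of j are at most those of k = x. *)
Let hRs : Rs <= 2 * E * ci * x ^+ 3.
Proof.
have h : \sum_(j < p) (rr a j.+1 * (t ^+ 2) ^+ j.+1) <= E * ci * x ^+ 2.
  apply: (@near _ _ (fun j => rr a j.+1 * (t ^+ 2) ^+ j.+1) _ ra).
  by rewrite mulr_ge0// ltW.
apply: (@le_trans _ _ (2 * x * (E * ci * x ^+ 2))); last first.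
  by apply: ler_of_eq; ring.
apply: le_trans (ler_wpM2l _ h); last by rewrite mulr_ge0// ltW.
rewrite mulr_sumr; apply: ler_sum => -[j jp] _ /=; apply: ler_wpM2r => //.
by rewrite /x -natrM ler_nat mul2n -[j.*2.+4]/(j.+2.*2) leq_double.
Qed.

Let hH : H <= F * ci * (x ^+ sg * x ^+ 3).
Proof.
rewrite -exprD; apply: (@near _ _ (fun j => degN j.*2.+3 f * (t ^+ 2) ^+ j.+1) _ rf).
by rewrite mulr_ge0// ltW.
Qed.

Let kkp : (kk <= p)%N.
Proof. by rewrite /= leq_uphalf_double -addnn leq_addr. Qed.

(** Here j <= k/2, where the weights decay geometrically: the powers of j sum to a
    constant and no power of k remains. *)
Let hR2 : R2 <= 4 * E * Z * ci.
Proof.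
apply: (@le_trans _ _ (\sum_(j < kk) 4 * E * ci * (j.+1%:R ^+ (sg + 6) * 4^-1 ^+ j))).
  apply: ler_sum => -[j jk] _ /=.
  apply: le_trans (ler_wpM2l (sqr_ge0 _) (ra (leq_trans jk kkp))) _.
  apply: (@le_trans _ _ (j.*2.+4%:R ^+ 2 * (E * ci * (j.+1%:R ^+ 2 * 4^-1 ^+ j.+1)))).
    apply: ler_wpM2l; first exact: sqr_ge0.
    apply: ler_wpM2l; first by rewrite mulr_ge0// ltW.
    by apply: ler_wpM2l; [exact: sqr_ge0 | exact: wgt_far].
  have h4 : j.*2.+4%:R <= 4 * j.+1%:R :> R by rewrite -natrM ler_nat; exact: nat4.
  have h5 : j.*2.+4%:R ^+ 2 <= (4 * j.+1%:R) ^+ 2 :> R by apply: lerXn2r; rewrite ?nnegrE ?mulr_ge0.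
  have ec : 0 <= E * ci by rewrite mulr_ge0// ltW.
  have q0 : 0 <= 4^-1 ^+ j :> R by rewrite exprn_ge0.
  apply: le_trans (ler_wpM2r _ h5) _.
    by apply: mulr_ge0; [exact: ec | apply: mulr_ge0; [exact: sqr_ge0 | rewrite exprn_ge0]].
  rewrite [4^-1 ^+ j.+1]exprS (_ : _ ^+ 2 * _ = 4 * E * ci * (j.+1%:R ^+ 4 * 4^-1 ^+ j)); last first.
    by move: (4^-1 ^+ j) (j.+1%:R : R) => q u; field.
  apply: ler_wpM2l; first by rewrite -mulrA mulr_ge0.
  by apply: ler_wpM2r => //; apply: ler_weXn2l; [rewrite ler1n | exact: (leq_trans _ (leq_addl sg 6))].
rewrite -mulr_sumr; apply: le_trans (ler_wpM2l _ (HZ _)) _; first by rewrite !mulr_ge0// ltW.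
by apply: ler_of_eq; ring.
Qed.

(** A factor x^2 is gained: for j <= k/2 even (j/k)^(2j) k^2 decays geometrically,
    up to powers of j. *)
Let hnu : nu * x ^+ 2 <= 3 * F * Z * ci.
Proof.
apply: (@le_trans _ _ (\sum_(j < kk) 3 * F * ci * (j.+1%:R ^+ (sg + 6) * 4^-1 ^+ j))).
  rewrite mulr_suml; apply: ler_sum => -[j jk] _ /=.
  have w : wgt R k j * x ^+ 2 <= j.+1%:R ^+ 2 * 4^-1 ^+ j.
    rewrite /wgt doubleS -[j.*2.+2]add2n exprD expr_div_n -/x mulrAC mulfVK; last by rewrite expf_neq0// gt_eqF.
    apply: ler_wpM2l; first exact: sqr_ge0.
    rewrite -mul2n exprM; apply: lerXn2r; rewrite ?nnegrE ?exprn_ge0 ?divr_ge0// ?(ltW x0)//.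
    rewrite (_ : 4^-1 = 2^-1 ^+ 2 :> R); last by lra.
    apply: lerXn2r; rewrite ?nnegrE ?divr_ge0// ?(ltW x0)//.
    rewrite ler_pdivrMr// mulrC ler_pdivlMr// /x -natrM ler_nat muln2.
    by rewrite -geq_half_double.
  have fc : 0 <= F * ci by rewrite mulr_ge0// ltW.
  have h3 : j.*2.+3%:R <= 3 * j.+1%:R :> R by rewrite -natrM ler_nat; exact: nat3.
  have h4 := rf (leq_trans jk kkp).
  have j0 : 0 <= j.+1%:R ^+ (sg + 3) :> R by rewrite exprn_ge0.
  apply: (@le_trans _ _ (3 * j.+1%:R * (F * ci * (j.+1%:R ^+ (sg + 3) * wgt R k j)) * x ^+ 2)).
    by apply: ler_wpM2r; [exact: sqr_ge0 | apply: ler_pM].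
  rewrite (_ : _ * x ^+ 2 = 3 * (F * ci) * (j.+1%:R * j.+1%:R ^+ (sg + 3)) * (wgt R k j * x ^+ 2)); last first.
    by move: (wgt _ _ _) (_ ^+ (sg + 3)) => *; ring.
  have c0 : 0 <= 3 * (F * ci) * (j.+1%:R * j.+1%:R ^+ (sg + 3)).
    by apply: mulr_ge0; [apply: mulr_ge0 | apply: mulr_ge0].
  apply: le_trans (ler_wpM2l c0 w) _; apply: ler_of_eq.
  rewrite (_ : (sg + 6 = sg + 3 + 3)%N); last by rewrite -addnA.
  rewrite [_ ^+ (sg + 3 + 3)]exprD; move: (_ ^+ (sg + 3)) (4^-1 ^+ j) => *; ring.
rewrite -mulr_sumr; apply: le_trans (ler_wpM2l _ (HZ _)) _; first by rewrite !mulr_ge0// ltW.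
by apply: ler_of_eq; ring.
Qed.

Let x2 : 1 <= x ^+ 2. Proof. by rewrite exprn_ege1. Qed.
Let nu_ci : nu <= 3 * F * Z * ci.
Proof. by apply: le_trans hnu; rewrite ler_peMr. Qed.

Let w'0 : 0 <= wt^-1. Proof. by rewrite invr_ge0 ltW. Qed.
Let e := nu * wt^-1.
Let e0 : 0 <= e. Proof. exact: mulr_ge0. Qed.
Let nue : nu <= wt * e.
Proof. by rewrite /e mulrCA mulfV ?gt_eqF// mulr1. Qed.

Let Cci (M : R) : M <= C -> M * ci <= 1.
Proof. by move=> h; rewrite ler_pdivrMr// mul1r. Qed.

Let nux : nu * x * y <= 4^-1.
Proof.
have h := Cci C1.
have a1 : nu * x <= nu * x ^+ 2 by rewrite ler_wpM2l// expr2 ler_peMr// ltW.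
have a2 := le_trans a1 hnu.
have a3 := ler_wpM2r (ltW y0) a2; lra.
Qed.

Let nu_le1 : nu <= 1.
Proof.
have a1 : nu <= nu * x by rewrite ler_peMr.
have a2 : nu * x <= nu * x * y by rewrite ler_peMr// mulr_ge0// ltW.
have := nux; lra.
Qed.

Let pe : p.*2.+2%:R * e <= 2^-1.
Proof.
have -> : p.*2.+2%:R = 2 * x :> R by rewrite /x -natrM -doubleS mul2n.
rewrite /e (_ : _ * _ = 2 * (nu * x * wt^-1)); last by ring.
have hx : nu * x * wt^-1 <= nu * x * y by rewrite ler_wpM2l// mulr_ge0// ltW.
have := nux; lra.
Qed.

Let G := Gam lam A p t e Rs.

Let G0 : 0 <= G.
Proof. exact: (Gam_ge0 lam0 nonres Alam t_gt0 e0 (lexx _)). Qed.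

Let gam : x * (Rs * nu) <= 6 * E * F * Z * ci ^+ 2 * x ^+ 2 /\
  G <= 123 * y * ci + ci ^+ 2 * E * x ^+ 2 * (24 * F * Z * y ^+ 2 + 60 * y).
Proof.
have [g1 g2] := gam_arith Rs0 nu0 (sqr_ge0 t) w'0 (ltW ci0) (ltW E0') (ltW F0) (ltW Z0) hRs hnu rho_x wy y1 x1.
split=> //; apply: le_trans g2; rewrite /G /Gam.
by rewrite (_ : p.*2.+2%:R = 2 * x :> R)// /x -natrM -doubleS mul2n.
Qed.

Let key : G <= E * ci * x ^+ 2 /\ 2 * G + nu * (wt^-1 * Rs + G) <= E * ci * x ^+ 2.
Proof.
have [g1 g2] := gam.
apply: (coef_arith Rs0 nu0 w'0 (ltW ci0) (ltW E0') (ltW F0) (ltW Z0) G0 nu_le1 wy y1 x1 g1 g2 E1).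
exact: Cci C2.
Qed.

Let r_new : rr a k * (t ^+ 2) ^+ k <= E * ci * x ^+ 2.
Proof.
apply: le_trans (proj2 key).
exact: (coefficient_step lam0 nonres Alam nf E0 t_gt0 t3 nu_le1 e0 nue pe
  (lo_nuq p t_gt0) (rad_nuq p t_gt0) (lexx Rs)).
Qed.

Let unscale (M c : R) q : c * (t ^+ 2) ^+ k <= M * ci * x ^+ q ->
  c <= M * C ^+ p * k%:R ^+ (p.*2.+2 + q).
Proof.
have tk : 0 < (t ^+ 2) ^+ k by rewrite !exprn_gt0.
move=> h; rewrite -(ler_pM2r tk); apply: le_trans h _.
rewrite tt -/x rhoXS exprD.
apply: ler_of_eq.
have e1 : C ^+ p * ci ^+ p = 1 by rewrite -exprMn mulfV ?expr1n// gt_eqF.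
have e2 : x ^+ p.*2.+2 * x ^- p.*2.+2 = 1 by rewrite mulfV// expf_neq0// gt_eqF.
rewrite -[LHS]mulr1 -[in LHS]e1 -[LHS]mulr1 -[in LHS]e2.
move: (C ^+ p) (ci ^+ p) (_ ^+ p.*2.+2) (_ ^+ q) (_ ^- _) => *; ring.
Qed.

Lemma new_a : bound_a p.
Proof. by have := unscale r_new; rewrite addn2. Qed.

Let G2 := Gam2 lam A a p t e Rs.

Let hG2 : 0 <= G2 /\ G2 <= 7 * y * E * ci * x ^+ 3.
Proof.
have h4 : p.*2.+4%:R <= 4 * x :> R by rewrite /x -natrM ler_nat; exact: nat4.
have rn := r_new; set r := rr a k * (t ^+ 2) ^+ k in rn.
have r0 : 0 <= r by exact: rp0.
have gE : G2 = wt^-1 * (Rs + p.*2.+4%:R * r) + G by [].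
have s0 : 0 <= Rs + p.*2.+4%:R * r by rewrite addr_ge0// mulr_ge0.
rewrite gE; split; first by rewrite addr_ge0// mulr_ge0.
have ec : 0 <= E * ci * x ^+ 2 by rewrite !mulr_ge0 ?sqr_ge0// ltW.
have a1 : p.*2.+4%:R * r <= 4 * x * (E * ci * x ^+ 2) by apply: ler_pM.
have a2 : Rs + p.*2.+4%:R * r <= 6 * E * ci * x ^+ 3.
  apply: le_trans (lerD hRs a1) _; apply: ler_of_eq; ring.
have a3 : wt^-1 * (Rs + p.*2.+4%:R * r) <= y * (6 * E * ci * x ^+ 3) by apply: ler_pM.
have a4 : G <= y * (E * ci * x ^+ 3).
  apply: le_trans (proj1 key) _.
  apply: (@le_trans _ _ (x * (E * ci * x ^+ 2))); first by rewrite ler_peMl.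
  rewrite (_ : x * _ = E * ci * x ^+ 3); last by ring.
  by rewrite ler_peMl// !mulr_ge0 ?exprn_ge0// ltW.
apply: le_trans (lerD a3 a4) _; apply: ler_of_eq; ring.
Qed.

Let f_new : degN k.*2.+1 f * (t ^+ 2) ^+ k <= F * ci * (x ^+ sg * x ^+ 3).
Proof.
have hR2' : \sum_(j < kk) j.*2.+4%:R ^+ 2 * (rr a j.+1 * (t ^+ 2) ^+ j.+1) <= R2 by [].
have main := tail_step lam0 nonres Alam nf E0 t_gt0 t3 nu_le1 e0 nue pe
  (lo_nuq p t_gt0) (ft_nuq p t_gt0) (ang_nuq p t_gt0) (rad_nuq p t_gt0) (lexx Rs) cd0 dio hR2' (hi_Hq p t_gt0).
have ci1 : ci <= 1.
  rewrite -[ci]mul1r; apply: Cci; rewrite /C; apply: le_trans (_ : 1 <= C0) _; first by apply: le_trans C3; lra.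
  by rewrite expr2 ler_peMl ?ltW//; apply: lt_le_trans C3; lra.
have rc : t ^+ 2 <= ci by rewrite -rho_x ler_peMr ?sqr_ge0.
have k10 : 0 < k1 by rewrite !mulr_gt0 ?invr_gt0 ?exprn_gt0.
have hs : k.*2.+2%:R ^+ sg <= 4 ^+ sg * x ^+ sg :> R.
  rewrite -exprMn; apply: lerXn2r; rewrite ?nnegrE ?mulr_ge0 ?(ltW x0)//.
  by rewrite /x -natrM ler_nat; exact: nat42.
have kc := ler_wpM2r (ltW cd0) (casoratian_lead_ge lam0 nonres Alam cd0 dio).
have C4' : 2 * cd * (18 * (4 * E * Z * y ^+ 2 + 2 + 4 * E * Z + 9 * y ^+ 2) + 30 * y ^+ 2 * F * Z) * ci <= k1.
  by rewrite ler_pdivrMr.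
apply: (tail_arith _ kc k10 nu0 w'0 (ltW ci0) ci1 (ltW E0') (ltW F0) (ltW Z0) R20 (sqr_ge0 t) cd0 H0 _ _ (proj1 hG2)
  wy y1 x1 rc hR2 nu_ci hH (proj2 hG2) hs (erefl _) EF C4').
- by apply: mulr_ge0; [exact: degN_ge0 | rewrite exprn_ge0 ?sqr_ge0].
- by rewrite exprn_ge0 ?(ltW x0).
- by rewrite exprn_ge0.
- exact: main.
Qed.

Lemma new_f : bound_f p.
Proof. by apply: unscale; rewrite exprD; exact: f_new. Qed.

End Inductive.

Lemma all_bounds j : bound_a j /\ bound_f j.
Proof.
elim/ltn_ind: j => j IH; split.
- by apply: new_a => i ij; have [] := IH i ij.
- by apply: new_f => i ij; have [] := IH i ij.
Qed.

End Induction.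

(** * Bounds with explicit constants *)

(** The constants are functions of c and of an integer sg >= tau alone, each chosen
    in terms of the previous ones so that the hypotheses of the induction hold.
    Half of gE absorbs three times the term 123 gy of gam_arith, and half of gF
    the product of 72 from tail_step with 7 from the bound of Gam2. *)
Section Growth.
Variable R : realFieldType.
Variables (cd : R) (sg : nat).
Hypothesis cd0 : 0 < cd.
Hypothesis cd1 : cd < 1.

Definition gy : R := 2 ^+ sg.+1 / cd.
Definition gZ : R := Zc R (sg + 6).
Definition gE : R := 738 * gy.
Definition gk : R := 2^-1 * (cd / 2 ^+ sg) * cd.
Definition gF : R := 1 + 1008 * 4 ^+ sg * gy * gE / gk.
Definition gC : R := 3 + (12 * gF * gZ * gy +
  (2 * (72 * gF * gZ * gy ^+ 2 + 180 * gy + 6 * gF * gZ * gy) +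
   2 * cd * (18 * (4 * gE * gZ * gy ^+ 2 + 2 + 4 * gE * gZ + 9 * gy ^+ 2) + 30 * gy ^+ 2 * gF * gZ) / gk)).
Definition gT : R := (2 * (sg + 3))%:R ^+ (sg + 3).
Definition growth : R := gE * gC ^+ 2 * gy * (gF * gT * 2).

Let y1 : 1 <= gy.
Proof.
rewrite /gy ler_pdivlMr// mul1r; apply: le_trans (ltW cd1) _.
by rewrite exprn_ege1// ler1n.
Qed.
Let y0 : 0 <= gy. Proof. exact: le_trans ler01 y1. Qed.
Let Z1 : 1 <= gZ. Proof. by apply: Zc_ge1; rewrite addnS. Qed.
Let Z0 : 0 <= gZ. Proof. exact: le_trans ler01 Z1. Qed.
Let h738 : 1 <= 738 :> R. Proof. by rewrite ler1n. Qed.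
Let E1 : 1 <= gE. Proof. by rewrite /gE mulr_ege1. Qed.
Let E0 : 0 <= gE. Proof. exact: le_trans ler01 E1. Qed.
Let k0 : 0 < gk. Proof. by rewrite /gk !mulr_gt0 ?invr_gt0 ?exprn_gt0. Qed.
Let q0 : 0 <= 1008 * 4 ^+ sg * gy * gE / gk.
Proof.
apply: mulr_ge0; last by rewrite invr_ge0 ltW.
have h : 0 <= 1008 :> R by rewrite ler0n.
have h4 : 0 <= 4 ^+ sg :> R by rewrite exprn_ge0.
exact: mulr_ge0 (mulr_ge0 (mulr_ge0 h h4) y0) E0.
Qed.
Let F1 : 1 <= gF. Proof. by rewrite /gF lerDl. Qed.
Let F0 : 0 <= gF. Proof. exact: le_trans ler01 F1. Qed.
Let s1 : 0 <= 12 * gF * gZ * gy.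
Proof. exact: mulr_ge0 (mulr_ge0 (mulr_ge0 (ler0n R 12) F0) Z0) y0. Qed.
Let s2 : 0 <= 2 * (72 * gF * gZ * gy ^+ 2 + 180 * gy + 6 * gF * gZ * gy).
Proof.
have p n : 0 <= n%:R * gF * gZ := mulr_ge0 (mulr_ge0 (ler0n R n) F0) Z0.
apply: mulr_ge0 => //; apply: addr_ge0; last exact: mulr_ge0 (p 6) y0.
exact: addr_ge0 (mulr_ge0 (p 72) (sqr_ge0 _)) (mulr_ge0 (ler0n R 180) y0).
Qed.
Let s3 : 0 <= 2 * cd * (18 * (4 * gE * gZ * gy ^+ 2 + 2 + 4 * gE * gZ + 9 * gy ^+ 2) + 30 * gy ^+ 2 * gF * gZ) / gk.
Proof.
have p : 0 <= 4 * gE * gZ := mulr_ge0 (mulr_ge0 (ler0n R 4) E0) Z0.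
have y2 n : 0 <= n%:R * gy ^+ 2 := mulr_ge0 (ler0n R n) (sqr_ge0 _).
apply: mulr_ge0; last by rewrite invr_ge0 ltW.
apply: mulr_ge0; first exact: mulr_ge0 (ler0n R 2) (ltW cd0).
apply: addr_ge0; last exact: mulr_ge0 (mulr_ge0 (y2 30) F0) Z0.
apply: mulr_ge0 => //; apply: addr_ge0; last exact: y2 9.
apply: (addr_ge0 _ p); apply: addr_ge0 => //; exact: mulr_ge0 p (sqr_ge0 _).
Qed.
Let C3 : 3 <= gC. Proof. by rewrite lerDl; exact: addr_ge0 s1 (addr_ge0 s2 s3). Qed.
Let gC1 : 1 <= gC. Proof. by apply: le_trans C3; rewrite ler1n. Qed.
Let C2 : gC <= gC ^+ 2. Proof. by rewrite expr2 ler_peMl// (le_trans ler01). Qed.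
Let T1 : 1 <= gT. Proof. by rewrite exprn_ege1// ler1n addnS. Qed.
Let EC1 : 1 <= gE * gC ^+ 2 * gy.
Proof. by apply: mulr_ege1 => //; apply: mulr_ege1 => //; exact: exprn_ege1. Qed.
Let FT1 : 1 <= gF * gT * 2.
Proof. by apply: mulr_ege1; [exact: mulr_ege1 | rewrite ler1n]. Qed.

Lemma growth_ge1 : 1 <= growth. Proof. exact: mulr_ege1 EC1 FT1. Qed.

Let parts_le (u v w : R) : 0 <= u -> 0 <= v -> 0 <= w ->
  [/\ u <= 3 + (u + (v + w)), v <= 3 + (u + (v + w)) & w <= 3 + (u + (v + w))].
Proof. by move=> *; split; lra. Qed.

Variable K : numClosedFieldType.
Variable lam : K.
Hypothesis lam0 : lam != 0.
Hypothesis nonres : forall n, (0 < n)%N -> lam ^+ n != 1.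
Variables (A : absval K R).
Hypothesis Alam : A lam = 1.
Variables (a : fps1 K) (f : ser K).
Hypothesis nf : normal_form lam a f.
Hypothesis EE0 : EE lam a f = 0.
Hypothesis dio : forall i, (0 < i)%N -> cd <= A (lam ^+ i - 1) * i%:R ^+ sg.
Local Notation wt := (wt lam A).

Let w0 : 0 < wt. Proof. exact: wt_gt0. Qed.

(** From (lam - 1)(lam + 1) = lam^2 - 1 and the Diophantine condition at 2. *)
Let wy : wt^-1 <= gy.
Proof.
have h : cd <= 2 ^+ sg.+1 * wt.
  apply: le_trans (dio (isT : (0 < 2)%N)) _.
  rewrite (_ : lam ^+ 2 - 1 = (lam - 1) * (1 + lam)); last by ring.
  rewrite avM mulrAC; apply: ler_wpM2r; first exact: av_ge0.
  rewrite exprS; apply: ler_wpM2r; first by rewrite exprn_ge0.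
  by apply: le_trans (avD _ _ _) _; rewrite avN Alam av1; lra.
rewrite /gy ler_pdivlMr// -ler_pdivlMl; last by rewrite invr_gt0.
by rewrite invrK mulrC.
Qed.

Lemma coefficient_bounds j : bound_a lam A a gE gC j /\ bound_f A f sg gF gC j.
Proof.
have HZ N : \sum_(i < N) i.+1%:R ^+ (sg + 6) * 4^-1 ^+ i <= gZ.
  by apply: sum_poly_geom; rewrite addnS.
have hF : 1008 * 4 ^+ sg * gy * gE <= 2^-1 * (cd / 2 ^+ sg) * cd * gF.
  by rewrite [leRHS]mulrC -ler_pdivrMr// /gF lerDr.
have [p1 p2 p3] := parts_le s1 s2 s3.
apply: (all_bounds lam0 nonres Alam nf EE0 cd0 dio y1 wy Z1 HZ (lexx _) F1 hF C3).
- exact: le_trans p1 C2.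
- exact: le_trans p2 C2.
- by rewrite [leRHS]mulrC -ler_pdivrMr//; exact: le_trans p3 C2.
Qed.

Lemma growth_a i : A (a (2 * i)%N) <= growth ^+ (2 * i) * (2 * i)%:R ^+ (2 * i).
Proof.
case: i => [|[|j]]; first by rewrite muln0 (nf_a0 nf) av1 !mul1r.
  have Gy : gy <= growth.
    apply: le_trans (_ : gE * gC ^+ 2 * gy <= _); last by rewrite /growth ler_peMr// (le_trans ler01).
    by rewrite ler_peMl//; apply: mulr_ege1 => //; exact: exprn_ege1.
  have h := A_q2 lam0 nonres Alam; rewrite -ler_pdivlMr ?exprn_gt0// in h.
  rewrite (nf_a2 nf) muln1; apply: le_trans h _.
  rewrite [leRHS]mulrC -exprVn; apply: ler_pM => //; first by rewrite exprn_ge0// invr_ge0 ltW.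
    by rewrite expr2 -natrM ler_nat.
  apply: lerXn2r; rewrite ?nnegrE ?invr_ge0 ?(ltW w0) ?(le_trans ler01 growth_ge1)//.
  exact: le_trans wy Gy.
rewrite mul2n; have [ba _] := coefficient_bounds j; move: ba; rewrite /bound_a /rr => ba.
set n := j.+2.*2; rewrite -[j.*2.+4]/n in ba.
have wn : 0 < wt ^+ n by rewrite exprn_gt0.
rewrite -ler_pdivlMr// -exprVn in ba; apply: le_trans ba _.
have jn : (j.+1 <= n)%N by rewrite /n -addnn ltnW// leq_addr.
have jn' : (j <= n)%N := ltnW jn.
have n0 : n != 0%N by [].
apply: (@le_trans _ _ (gE ^+ n * (gC ^+ 2) ^+ n * n%:R ^+ n * gy ^+ n)); last first.
  rewrite mulrAC; apply: ler_wpM2r; first by rewrite exprn_ge0.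
  rewrite -!exprMn; apply: lerXn2r; rewrite ?nnegrE ?(le_trans ler01 EC1) ?(le_trans ler01 growth_ge1)//.
  by rewrite /growth ler_peMr// (le_trans ler01).
have E0n : 0 <= gE ^+ n by rewrite exprn_ge0.
have C2n : 1 <= gC ^+ 2 by exact: exprn_ege1.
have Cj m : 0 <= (gC ^+ 2) ^+ m by rewrite exprn_ge0// (le_trans ler01).
have jn1 : j.+1%:R ^+ n <= n%:R ^+ n :> R.
  by apply: lerXn2r; rewrite ?nnegrE// ler_nat.
have yn : (wt^-1) ^+ n <= gy ^+ n by apply: lerXn2r; rewrite ?nnegrE ?invr_ge0 ?(ltW w0).
have p1 : gE * (gC ^+ 2) ^+ j <= gE ^+ n * (gC ^+ 2) ^+ n.
  by apply: ler_pM => //; [exact: ler_eXnr | exact: ler_weXn2l].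
have p0 : 0 <= gE * (gC ^+ 2) ^+ j by exact: mulr_ge0.
apply: ler_pM => //.
- by apply: mulr_ge0 => //; rewrite exprn_ge0.
- by rewrite exprn_ge0// invr_ge0 ltW.
- by apply: ler_pM => //; rewrite exprn_ge0.
Qed.

Lemma growth_f j l : A (f j l) <= growth ^+ (j + l) * (j + l)%:R ^+ (j + l).
Proof.
have G0 : 0 <= growth := le_trans ler01 growth_ge1.
have [ojl|ejl] := boolP (odd (j + l)); last first.
  by rewrite (nf_f_even nf)// av0 mulr_ge0// exprn_ge0.
have [/eqP jl1|jl1] := boolP (j + l == 1)%N.
  have -> : f j l = 1.
    by case: j l jl1 {ojl} => [|[|j]] [|[|l]]// _; rewrite ?(nf_f10 nf) ?(nf_f01 nf).
  by rewrite av1 jl1 !expr1 mulr1 growth_ge1.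
apply: le_trans (av_le_degN A j l f) _.
have [i ->] : exists i, (j + l = i.*2.+3)%N.
  exists (j + l)./2.-1; rewrite -[LHS]odd_double_half ojl add1n.
  by move: ojl jl1; case: (j + l)%N => [|[|[|d]]].
have [_ bf] := coefficient_bounds i; apply: le_trans bf _.
set n := i.*2.+3.
have iN : (i <= n)%N by rewrite /n -addnn -addnS -addnS -addnS leq_addr.
have n0 : n != 0%N by [].
have C2n : 1 <= gC ^+ 2 by exact: exprn_ege1.
have Cj m : 0 <= (gC ^+ 2) ^+ m by rewrite exprn_ge0// (le_trans ler01).
have T0 : 0 <= gT := le_trans ler01 T1.
have p1 : i.+1%:R ^+ (i.*2.+2 + (sg + 3)) <= n%:R ^+ n * (gT ^+ n * 2 ^+ n) :> R.
  rewrite exprD; apply: ler_pM; rewrite ?exprn_ge0//.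
    apply: (@le_trans _ _ (n%:R ^+ i.*2.+2)).
      by apply: lerXn2r; rewrite ?nnegrE// ler_nat /n -addnn ltnS; exact: leqW (leqW (leq_addr _ _)).
    by apply: ler_weXn2l; rewrite ?ler1n.
  have h : (0 < sg + 3)%N by rewrite addnS.
  apply: le_trans (pow_le_exp2 R i h) _; apply: ler_pM; rewrite ?exprn_ge0//.
    exact: ler_eXnr.
  by apply: ler_weXn2l; rewrite ?ler1n.
have p2 : gF * (gC ^+ 2) ^+ i <= gF ^+ n * (gC ^+ 2) ^+ n.
  by apply: ler_pM => //; [exact: ler_eXnr | exact: ler_weXn2l].
apply: (@le_trans _ _ (gF ^+ n * (gC ^+ 2) ^+ n * (n%:R ^+ n * (gT ^+ n * 2 ^+ n)))).
  by apply: ler_pM => //; rewrite ?exprn_ge0//; exact: mulr_ge0.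
rewrite [_ * (gT ^+ n * _)]mulrC mulrA; apply: ler_wpM2r; first by rewrite exprn_ge0.
rewrite -!exprMn; apply: lerXn2r; rewrite ?nnegrE//.
  exact: mulr_ge0 (mulr_ge0 F0 (le_trans ler01 C2n)) (mulr_ge0 T0 (ler0n R 2)).
rewrite /growth (_ : gF * gC ^+ 2 * (gT * 2) = gC ^+ 2 * (gF * gT * 2)); last by ring.
apply: ler_wpM2r; first exact: le_trans ler01 FT1.
rewrite -mulrAC ler_peMl ?(le_trans ler01 C2n)//.
exact: mulr_ege1.
Qed.
End Growth.

(** * The modulus of complex numbers and factorials *)

Section Complex.
Variable R : realType.
Import Normc.

Lemma normc_nat n : normc (n%:R : R[i]) = n%:R.
Proof. by rewrite (normcMn (1 : R[i])) normc1. Qed.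

Definition modulus : absval R[i] R :=
  @AbsVal R[i] R (@normc R) (fun x => let: (a +i* b)%C := x in sqrtr_ge0 _) normc_nat
    (@normcN R) (@normcM R) (@le_normcD R).

Lemma normcE (x : R[i]) : `|x| = (modulus x)%:C%C.
Proof. by case: x => x y; rewrite normc_def. Qed.

Lemma conj_fixed (x : R[i]) : x^* = x -> (complex.Re x)%:C%C = x.
Proof.
case: x => x y /= [] h; congr (_ +i* _)%C; lra.
Qed.

Lemma modulus_real (x : R) : modulus x%:C%C = `|x|.
Proof. by rewrite /= expr0n addr0 sqrtr_sqr. Qed.

Section Rotation.
Variable theta : R.
Local Notation lam := (cos theta +i* sin theta)%C.

Lemma rotation_modulus : modulus lam = 1.
Proof. by rewrite /= cos2Dsin2 sqrtr1. Qed.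

Lemma rotation_conj : lam^* = lam^-1.
Proof. by rewrite /= /GRing.inv /= cos2Dsin2 !divr1. Qed.

Lemma rotation_neq0 : lam != 0.
Proof. by apply/eqP => h; have := rotation_modulus; rewrite h av0 => /esym/eqP; rewrite oner_eq0. Qed.
End Rotation.

Lemma diophantine_nat (c tau : R) (lam : R[i]) i sg : diophantine c tau lam -> 0 <= c -> tau <= sg%:R ->
  (0 < i)%N -> c <= modulus (lam ^+ i - 1) * i%:R ^+ sg.
Proof.
move=> dio c0 tsg i0; have ne : i%:Z != 0 by lia.
have := dio i%:Z ne; rewrite absz_nat -exprnP normcE lecR powRN => h.
have ip : 1 <= i%:R :> R by rewrite ler1n.
have p0 : 0 < i%:R `^ tau :> R by apply: powR_gt0; rewrite ltr0n.
rewrite ler_pdivrMr// in h; apply: le_trans h _.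
apply: ler_wpM2l; first exact: av_ge0.
by rewrite -powR_mulrn ?ler_powR.
Qed.

Lemma pow_le_exp (alpha : R) n : 1 <= alpha -> n%:R ^+ n <= expR (alpha * n%:R * ln n%:R).
Proof.
case: n => [|n] al; first by rewrite mulr0 mul0r expR0.
have n1 : 1 <= n.+1%:R :> R by rewrite ler1n.
have -> : n.+1%:R ^+ n.+1 = expR (n.+1%:R * ln n.+1%:R) :> R.
  by rewrite expRM_natl lnK// posrE.
by rewrite ler_expR -mulrA ler_peMl// mulr_ge0// ln_ge0.
Qed.

(** A single term of the exponential series gives n^n <= e^n n!. *)
Lemma exp_le_fact (alpha : R) n : 0 <= alpha ->
  expR (alpha * n%:R * ln n%:R) <= expR alpha ^+ n * n`!%:R `^ alpha.
Proof.
move=> al; case: n => [|n]; first by rewrite mulr0 mul0r expR0 expr0 powR1 mulr1.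
have f0 : 0 < n.+1`!%:R :> R by rewrite ltr0n fact_gt0.
have h : n.+1%:R ^+ n.+1 / n.+1`!%:R <= expR n.+1%:R :> R.
  by apply: le_trans (expR_ge1Dxn n (ler0n R n.+1)); rewrite lerDr.
rewrite ler_pdivrMr// in h.
have h2 : ln (n.+1%:R ^+ n.+1) <= ln (expR n.+1%:R * n.+1`!%:R) :> R.
  by rewrite ler_ln ?posrE ?exprn_gt0 ?mulr_gt0 ?expR_gt0.
rewrite lnXn// lnM ?posrE ?expR_gt0// expRK -[ln _ *+ _]mulr_natl in h2.
rewrite -expRM_natr /powR (gt_eqF f0) -expRD ler_expR -mulrA -mulrDr.
exact: ler_wpM2l.
Qed.

End Complex.

Theorem theorem1p2 (R : realType) (c tau : R) :
  0 < c -> c < 1 -> 0 < tau ->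
  exists C : R -> R,
    (forall alpha : R, 5 / 4 < alpha -> 0 < C alpha) /\
    forall (theta : R) (lam : R[i]),
      lam = (cos theta +i* sin theta)%C ->
      diophantine c tau lam ->
      exists (q : fps1 R) (phi : fps2 R),
        (forall n, odd n -> q n = 0) /\
        q 0%N = 1 /\
        (forall j k, ~~ odd (j + k)%N -> phi j k = 0) /\
        (forall j k, phi j k = phi k j) /\
        phi 1%N 0%N = 1 /\ phi 0%N 1%N = 1 /\
        (forall j k, calE lam (fps1_complex q) (fps2_complex phi) j k = 0) /\
        (forall alpha : R, 5 / 4 < alpha ->
          (forall k : nat,
             `|q (2 * k)%N| <= C alpha ^+ (2 * k) *
                expR (alpha * (2 * k)%:R * ln (2 * k)%:R)) /\
          (forall n j k : nat, (j + k = n)%N ->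
             `|phi j k| <= C alpha ^+ n * expR (alpha * n%:R * ln n%:R)) /\
          gevrey1 (1 + alpha) q /\ gevrey2 (1 + alpha) phi).
Proof.
move=> c0 c1 tau0; pose sg := Num.bound tau.
have tsg : tau <= sg%:R by exact: ltW (archi_boundP (ltW tau0)).
pose G := growth c sg; have G1 : 1 <= G by exact: growth_ge1.
have G0 : 0 < G := lt_le_trans ltr01 G1.
exists (fun=> G); split=> // theta lam lamE dio.
have lam0 : lam != 0 by rewrite lamE; exact: rotation_neq0.
have Alam : modulus R lam = 1 by rewrite lamE; exact: rotation_modulus.
have lamJ : lam^* = lam^-1 by rewrite lamE; exact: rotation_conj.
have dioN i : (0 < i)%N -> c <= modulus R (lam ^+ i - 1) * i%:R ^+ sg.
  by move=> i0; apply: diophantine_nat dio _ tsg i0; exact: ltW.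
have nonres i : (0 < i)%N -> lam ^+ i != 1.
  by move=> i0; apply/eqP => h; have := dioN i i0; rewrite h subrr av0 mul0r leNgt c0.
have [nf EE0] := formal_solution lamJ lam0 nonres.
set a := sol_a lam in nf EE0; set f := sol_f lam in nf EE0.
pose q : fps1 R := fun n => complex.Re (a n).
pose phi : fps2 R := fun j k => complex.Re (f j k).
have aE n : (q n)%:C%C = a n by exact: conj_fixed (nf_a_conj nf n).
have fE j k : (phi j k)%:C%C = f j k by exact: conj_fixed (nf_f_conj nf j k).
have qE : fps1_complex q = a by apply/funext => n; exact: aE.
have phiE : fps2_complex phi = f by apply/funext => j; apply/funext => k; exact: fE.
have qb k : `|q (2 * k)%N| <= G ^+ (2 * k) * (2 * k)%:R ^+ (2 * k).
  by rewrite -modulus_real aE; exact: (growth_a c0 c1 lam0 nonres Alam nf EE0 dioN).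
have phib j k : `|phi j k| <= G ^+ (j + k) * (j + k)%:R ^+ (j + k).
  by rewrite -modulus_real fE; exact: (growth_f c0 c1 lam0 nonres Alam nf EE0 dioN).
have q_odd n : odd n -> q n = 0 by move=> on; rewrite /q (nf_a_odd nf).
exists q, phi; split; first exact: q_odd.
split; first by rewrite /q (nf_a0 nf).
split; first by move=> j k jk; rewrite /phi (nf_f_even nf).
split; first by move=> j k; rewrite /phi (nf_f_sym nf).
split; first by rewrite /phi (nf_f10 nf).
split; first by rewrite /phi (nf_f01 nf).
split=> [j k|alpha al].
  rewrite qE phiE; have := congr1 (fun g : ser R[i] => g j k) (calE_EE lam0 a (nf_ord nf)).
  by rewrite EE0.
have al1 : 1 <= alpha by lra.
have al0 : 0 <= alpha by lra.
have grow n : G ^+ n * n%:R ^+ n <= G ^+ n * expR (alpha * n%:R * ln n%:R).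
  by apply: ler_wpM2l; [rewrite exprn_ge0// ltW | exact: pow_le_exp].
have gevrey n : G ^+ n * expR (alpha * n%:R * ln n%:R) <=
    1 * (G * expR alpha) ^+ n * n`!%:R `^ (1 + alpha - 1).
  rewrite mul1r [(G * expR _) ^+ n]exprMn addrAC subrr add0r -[leRHS]mulrA.
  by apply: ler_wpM2l; [rewrite exprn_ge0// ltW | exact: exp_le_fact].
have Ge0 : 0 < G * expR alpha by rewrite mulr_gt0 ?expR_gt0.
have phib' n j k : (j + k = n)%N -> `|phi j k| <= G ^+ n * expR (alpha * n%:R * ln n%:R).
  by move=> <-; exact: le_trans (phib j k) (grow _).
have qb' k : `|q (2 * k)%N| <= G ^+ (2 * k) * expR (alpha * (2 * k)%:R * ln (2 * k)%:R).
  exact: le_trans (qb k) (grow _).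
split; first exact: qb'.
split; first exact: phib'.
split.
- split; first by rewrite lerDl.
  exists 1, (G * expR alpha); split=> // n; apply: le_trans (gevrey n).
  have [on|en] := boolP (odd n).
    by rewrite q_odd// normr0 mulr_ge0 ?expR_ge0// exprn_ge0// ltW.
  by rewrite -[n]odd_double_half (negbTE en) add0n -mul2n; exact: qb'.
- split; first by rewrite lerDl.
  exists 1, (G * expR alpha); split=> // n j k jk.
  exact: le_trans (phib' n j k jk) (gevrey n).
Qed.
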